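(* Let $W$ be a block-regulated graphon such that $$0<\inf_{x,y\in[0,1]}W(x,y)\le\sup_{x,y\in[0,1]}W(x,y)<1,$$ and let $\boldsymbol{G}\sim\mathcal{G}(n,W)$. Then, with high probability as $n\to\infty$, $$\chi(\boldsymbol{G})=(1+o(1))\,\varphi_*(W)\frac{n}{2\log n};$$ that is, for every fixed $\epsilon>0$, $\mathbb{P}\big((1-\epsilon)\varphi_*(W)\frac{n}{2\log n}\le\chi(\boldsymbol{G})\le(1+\epsilon)\varphi_*(W)\frac{n}{2\log n}\big)\to1$ as $n\to\infty$.
   Context: A graphon is a symmetric measurable function $W:[0,1]^2\to[0,1]$. It is a block graphon if there is a finite family $\mathcal{F}$ of disjoint measurable sets partitioning $[0,1]$ such that $W$ is constant on $S\times S'$ for all $S,S'\in\mathcal{F}$. A graphon $W$ is block-regulated if for any $\delta>0$ there is a block graphon $W^\delta$ with $\sup_{x,y\in[0,1]}|W(x,y)-W^\delta(x,y)|\le\delta$. The random graph $\mathcal{G}(n,W)$ has vertex set $[n]=\{1,\dots,n\}$: sample $X_1,\dots,X_n$ independently and uniformly from $[0,1]$; conditionally on these, each edge $ij$ ($i\ne j$) is present independently with probability $W(X_i,X_j)$. $\chi(G)$ is the chromatic number, $\log$ is the natural logarithm, $\lambda$ is the Lebesgue (uniform) measure on $[0,1]$, and $\mathcal{P}([0,1])$ is the set of probability measures on $[0,1]$. $\mathcal{C}_\lambda$ is the set of pairs $(\mathcal{M},\boldsymbol{\alpha})$ where $\mathcal{M}\subset\mathcal{P}([0,1])$ is finite and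 $\boldsymbol{\alpha}=(\alpha_\mu)_{\mu\in\mathcal{M}}\in[0,1]^{|\mathcal{M}|}$ satisfies $\sum_{\mu\in\mathcal{M}}\alpha_\mu=1$ and $\sum_{\mu\in\mathcal{M}}\alpha_\mu\mu=\lambda$. For $\mu\in\mathcal{P}([0,1])$, $$\varphi(\mu,W):=\sup_{S\subseteq[0,1]:\ \mu(S)>0}\frac1{\mu(S)}\int_S\int_S\log\Big(\frac1{1-W(x,y)}\Big)\,d\mu(x)\,d\mu(y)$$ (supremum over measurable $S$), and $$\varphi_*(W):=\inf_{(\mathcal{M},\boldsymbol{\alpha})\in\mathcal{C}_\lambda}\ \sum_{\mu\in\mathcal{M}}\alpha_\mu\varphi(\mu,W).$$ *)

(* Defs.v *)
From HB Require Import structures.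
From mathcomp Require Import all_boot all_order all_algebra finmap.
From mathcomp Require Import all_classical all_reals all_analysis.

Set Implicit Arguments.
Unset Strict Implicit.
Unset Printing Implicit Defensive.

Import Order.TTheory GRing.Theory Num.Theory.
Import numFieldNormedType.Exports.

Local Open Scope classical_set_scope.
Local Open Scope ring_scope.

(* [0, 1] is a subset of R rather than a type of its own: a function on
   [0, 1]^2 is a function R -> R -> R whose values off the unit square are
   irrelevant, and P([0, 1]) consists of the Borel probability measures on R
   that give mass 1 to [0, 1]. *)
Definition I01 (R : realType) : set R := `[0, 1]%classic.
Arguments I01 : clear implicits.

Definition graphon (R : realType) (W : R -> R -> R) : Prop :=
  [/\ measurable_fun (I01 R `*` I01 R) (fun p : R * R => W p.1 p.2),
      forall x y, I01 R x -> I01 R y -> W x y = W y x &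
      forall x y, I01 R x -> I01 R y -> 0 <= W x y <= 1].

Definition block_graphon (R : realType) (W : R -> R -> R) : Prop :=
  graphon W /\
  exists (k : nat) (F : 'I_k -> set R),
    [/\ forall i, measurable (F i),
        trivIset setT F,
        \bigcup_i F i = I01 R &
        forall i j, exists c : R, forall x y, F i x -> F j y -> W x y = c].

(* The real sup is meaningful here: two graphons differ by at most 1 on the
   unit square. *)
Definition block_regulated (R : realType) (W : R -> R -> R) : Prop :=
  graphon W /\
  forall delta : R, 0 < delta ->
    exists Wd : R -> R -> R,
      block_graphon Wd /\
      sup [set `|W x y - Wd x y| | x in I01 R & y in I01 R] <= delta.

Definition prob01 (R : realType) (mu : pprobability (measurableTypeR R) R) :
  Prop := mu (I01 R) = 1%E.

Definition lambda01 (R : realType) : probability (measurableTypeR R) R :=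
  uniform_prob (@ltr01 R).
Arguments lambda01 : clear implicits.

(* With the conventions 0^-1 = +oo and lne +oo = +oo of extended reals, the
   integrand is +oo where W = 1. *)
Definition phi (R : realType) (mu : pprobability (measurableTypeR R) R)
    (W : R -> R -> R) : \bar R :=
  ereal_sup
    [set ((mu S)^-1 *
          \int[mu]_(x in S) \int[mu]_(y in S) lne ((1 - W x y)%R%:E^-1))%E
    | S in [set S : set R |
             [/\ measurable S, S `<=` I01 R & (0 < mu S)%E]]].

Definition in_C_lambda (R : realType)
    (M : {fset pprobability (measurableTypeR R) R}) (alpha : M -> R) : Prop :=
  [/\ forall mu : M, prob01 (val mu),
      forall mu : M, 0 <= alpha mu <= 1,
      \sum_(mu : M) alpha mu = 1 &
      forall A : set R, measurable A ->
        (\sum_(mu : M) (alpha mu)%:E * val mu A)%E = lambda01 R A].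

Definition phi_star (R : realType) (W : R -> R -> R) : \bar R :=
  ereal_inf
    [set v | exists (M : {fset pprobability (measurableTypeR R) R})
                    (alpha : M -> R),
        in_C_lambda alpha /\
        v = (\sum_(mu : M) (alpha mu)%:E * phi (val mu) W)%E].

Definition simple_adj (V : finType) (E : {set V * V}) : bool :=
  [forall x, (x, x) \notin E] &&
  [forall x, forall y, ((x, y) \in E) == ((y, x) \in E)].

Definition simple_graph (V : finType) := {E : {set V * V} | simple_adj E}.

Definition adj (V : finType) (g : simple_graph V) (x y : V) : bool :=
  (x, y) \in val g.

Definition colorable (V : finType) (g : simple_graph V) (k : nat) : bool :=
  [exists c : {ffun V -> 'I_k},
     [forall x, forall y, adj g x y ==> (c x != c y)]].

Lemma colorable_card (V : finType) (g : simple_graph V) :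
  exists k, colorable g k.
Proof.
exists #|V|; apply/existsP; exists [ffun x => enum_rank x].
apply/forallP => x; apply/forallP => y; apply/implyP => xy; rewrite !ffunE.
apply: contraTneq xy => /enum_rank_inj ->.
by have /andP[/forallP/(_ y)] := valP g.
Qed.

Definition chromatic_number (V : finType) (g : simple_graph V) : nat :=
  ex_minn (colorable_card g).

Section random_graph.
Context d (T : measurableType d) (R : realType) (P : probability T R) (n : nat).
Local Open Scope ereal_scope.

Definition iid_uniform01 (X : 'I_n -> {RV P >-> measurableTypeR R}) : Prop :=
  [/\ forall i w, I01 R (X i w),
      forall i (A : set R), measurable A ->
        P (X i @^-1` A) = lambda01 R A &
      forall A : 'I_n -> set R, (forall i, measurable (A i)) ->
        P (\bigcap_i (X i @^-1` A i)) = \prod_(i < n) P (X i @^-1` A i)].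

Definition edge_weight (W : R -> R -> R) (x : 'I_n -> R)
    (g : simple_graph 'I_n) : R :=
  (\prod_(p : 'I_n * 'I_n | (p.1 < p.2)%N)
     if adj g p.1 p.2 then W (x p.1) (x p.2) else 1 - W (x p.1) (x p.2))%R.

(* The last clause says that edge_weight W (X_1, ..., X_n) g is a version of
   the conditional probability of G = g given the sigma-algebra generated by
   X_1, ..., X_n. *)
Definition sampled_from (W : R -> R -> R) (G : T -> simple_graph 'I_n) : Prop :=
  exists X : 'I_n -> {RV P >-> measurableTypeR R},
    [/\ iid_uniform01 X,
        forall g, measurable (G @^-1` [set g]) &
        forall g (D : set T), g_sigma_preimage (fun i => X i : T -> measurableTypeR R) D ->
          P (G @^-1` [set g] `&` D) =
          \int[P]_(w in D) (edge_weight W (fun i => X i w) g)%:E].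

End random_graph.

(* Main.v *)
Require Import Defs.
From HB Require Import structures.
From mathcomp Require Import all_boot all_order all_algebra finmap.
From mathcomp Require Import all_classical all_reals all_analysis.
From mathcomp Require Import measurable_realfun zify ring lra.

Set Implicit Arguments.
Unset Strict Implicit.
Unset Printing Implicit Defensive.

Import Order.TTheory GRing.Theory Num.Theory.
Import numFieldNormedType.Exports.

Local Open Scope classical_set_scope.
Local Open Scope ring_scope.

(** Put [w = - ln (1 - W)] and cut [[0, 1]] into blocks on which [w] is constant
    up to a factor [1 + eta]; the type of a vertex is the block of its position.

    Lower bound: by the first moment, with high probability every independent
    set [A] satisfies [sum_{pairs of A} w <= (1 + eta) |A| ln n].  Apply this to
    all unions of types inside the colour classes of an optimal colouring, and
    spread each class uniformly over its blocks, rescaled so that the resulting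
    measures add up to [lambda]: this is a competitor for [phi_star] of cost at
    most [(2 + o(1)) chi ln n / n].

    Upper bound: take a near-optimal [(M, alpha)].  For [mu] in [M], a set of
    [(2 - o(1)) ln n / phi mu] vertices with types distributed like [mu] has all
    its subsets below the first-moment threshold, by definition of [phi].
    Janson's inequality then shows that a given vertex set with [n^(1 - o(1))]
    vertices of each type contains no such independent set with probability at
    most [exp (- n^(3/2))], which beats the number [2^n] of vertex sets.  So one
    can greedily remove about [alpha_mu phi(mu) n / (2 ln n)] of them for each
    [mu], which exhausts almost all vertices. *)

(** * Bernoulli random sets and Janson's inequality *)

(** Probabilities are computed with the positions frozen: the edges are then independent, so the
    finite product average [Ex] suffices, and the sampled graph only returns through a sum over type
    patterns.

    Both bounds on [W] shape the blocks: [W] away from 1 makes [ln (1 - W)] Lipschitz, and [W] away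
    from 0 turns an additive error into a relative one.

    The supremum over [S] in [phi] is why all subsets must be controlled: a set of acceptable total
    weight may contain a part too heavy to be independent anywhere. In Janson's inequality the same
    condition reappears as the sum over the sub-profiles shared by two candidates. A variance bound
    would only be polynomially small in [n], useless against the exponentially many sets that may
    remain during the greedy removal.

    The double integral counts ordered pairs, whence the 2 in [2 ln n], and also the diagonal, which
    adds at most a constant per vertex and is negligible against [ln n]. Families in [phi_star] are
    finite but of any size, so one measure per colour class is admissible although their number
    grows with [n]. *)

Section bernoulli.
Import mathcomp.boot.finset.
Context {R : realType} {E : finType}.
Variable q : E -> R.
Hypothesis q01 : forall e, 0 <= q e <= 1.
Implicit Types (F H : {set E} -> R) (h D : {set E}) (s : seq E).

(* [Ex F] is the mean of [F] at the random set containing each [e] independently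
   with probability [q e]: once every coordinate has been resampled, the starting
   set is irrelevant. *)
Definition resample (e : E) F h : R :=
  q e * F (e |: h)%SET + (1 - q e) * F (h :\ e)%SET.

Definition avg s F : {set E} -> R := foldr resample F s.

Definition Ex F : R := avg (enum E) F set0.

Let q_ge0 e : 0 <= q e. Proof. by have /andP[] := q01 e. Qed.
Let p_ge0 e : 0 <= 1 - q e.
Proof. by rewrite subr_ge0; have /andP[] := q01 e. Qed.

Lemma eq_avg s F H : F =1 H -> avg s F =1 avg s H.
Proof. by move=> FH; elim: s => //= e s IH h; rewrite /resample !IH. Qed.

Lemma le_avg s F H : (forall h, F h <= H h) -> forall h, avg s F h <= avg s H h.
Proof.
move=> FH; elim: s => //= e s IH h.
by rewrite /resample lerD// ler_wpM2l.
Qed.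

Lemma avg_cst s (a : R) h : avg s (fun=> a) h = a.
Proof. by elim: s h => //= e s IH h; rewrite /resample !IH; ring. Qed.

Lemma avgD s F H h : avg s (fun h => F h + H h) h = avg s F h + avg s H h.
Proof. by elim: s h => //= e s IH h; rewrite /resample !IH; ring. Qed.

Lemma avgZ s a F h : avg s (fun h => a * F h) h = a * avg s F h.
Proof. by elim: s h => //= e s IH h; rewrite /resample !IH; ring. Qed.

Lemma eq_Ex F H : F =1 H -> Ex F = Ex H.
Proof. by move=> /eq_avg; apply. Qed.

Lemma le_Ex F H : (forall h, F h <= H h) -> Ex F <= Ex H.
Proof. by move=> /le_avg; apply. Qed.

Lemma Ex_cst a : Ex (fun=> a) = a. Proof. exact: avg_cst. Qed.

Lemma ExD F H : Ex (fun h => F h + H h) = Ex F + Ex H.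
Proof. exact: avgD. Qed.

Lemma ExZ a F : Ex (fun h => a * F h) = a * Ex F.
Proof. exact: avgZ. Qed.

Lemma ExB F H : Ex (fun h => F h - H h) = Ex F - Ex H.
Proof.
rewrite (@eq_Ex _ (fun h => F h + (-1) * H h)); last by move=> h; ring.
by rewrite ExD ExZ; ring.
Qed.

Lemma Ex_ge0 F : (forall h, 0 <= F h) -> 0 <= Ex F.
Proof. by move=> F0; rewrite -(Ex_cst 0); exact: le_Ex. Qed.

Lemma Ex_sum (I : Type) (r : seq I) (P : pred I) (F : I -> {set E} -> R) :
  Ex (fun h => \sum_(i <- r | P i) F i h) = \sum_(i <- r | P i) Ex (F i).
Proof.
elim: r => [|i r IH].
  rewrite big_nil (@eq_Ex _ (fun=> 0)) ?Ex_cst// => h; by rewrite big_nil.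
rewrite big_cons; case: ifP => Pi; last first.
  by rewrite -IH; apply: eq_Ex => h; rewrite big_cons Pi.
by rewrite -IH -ExD; apply: eq_Ex => h; rewrite big_cons Pi.
Qed.

Lemma avg_prod s (f : E -> bool -> R) h : uniq s ->
  avg s (fun h => \prod_e f e (e \in h)) h =
  \prod_e (if e \in s then q e * f e true + (1 - q e) * f e false
           else f e (e \in h)).
Proof.
elim: s h => [|e s IH] h /=; first by move=> _; apply: eq_bigr.
move=> /andP[es us]; rewrite /resample !IH//.
rewrite (bigD1 e)//= [X in _ + _ * X](bigD1 e)//= [RHS](bigD1 e)//=.
rewrite (negbTE es) !inE eqxx/=.
rewrite mulrA [X in _ + X]mulrA.
have -> : \prod_(i | i != e) (if i \in s then q i * f i true + (1 - q i) * f i false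
            else f i (i \in (e |: h)%SET)) =
   \prod_(i | i != e) (if i \in e :: s then q i * f i true + (1 - q i) * f i false
            else f i (i \in h)).
  by apply: eq_bigr => i ie; rewrite !inE (negbTE ie).
have -> : \prod_(i | i != e) (if i \in s then q i * f i true + (1 - q i) * f i false
            else f i (i \in (h :\ e)%SET)) =
   \prod_(i | i != e) (if i \in e :: s then q i * f i true + (1 - q i) * f i false
            else f i (i \in h)).
  by apply: eq_bigr => i ie; rewrite !inE (negbTE ie).
by rewrite -mulrDl.
Qed.

Lemma Ex_prod (f : E -> bool -> R) :
  Ex (fun h => \prod_e f e (e \in h)) =
  \prod_e (q e * f e true + (1 - q e) * f e false).
Proof.
rewrite /Ex avg_prod ?enum_uniq//; apply: eq_bigr => e _.
by rewrite mem_enum.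
Qed.

Definition increasing F := forall h1 h2, h1 \subset h2 -> F h1 <= F h2.
Definition decreasing F := forall h1 h2, h1 \subset h2 -> F h2 <= F h1.

Lemma avg_increasing s F : increasing F -> increasing (avg s F).
Proof.
move=> iF; elim: s => //= e s IH h1 h2 h12.
by apply: lerD; apply: ler_wpM2l => //; apply: IH; [exact: setUS | exact: setSD].
Qed.

Lemma avg_decreasing s F : decreasing F -> decreasing (avg s F).
Proof.
move=> iF; elim: s => //= e s IH h1 h2 h12.
by apply: lerD; apply: ler_wpM2l => //; apply: IH; [exact: setUS | exact: setSD].
Qed.

(** Harris's inequality, one coordinate at a time: for a two-point law the gap between the two sides
    is [q e * (1 - q e)] times the increase of [F] times the decrease of [H], and averaging
    preserves monotonicity. *)
Lemma avg_harris s F H : increasing F -> decreasing H -> forall h,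
  avg s (fun h => F h * H h) h <= avg s F h * avg s H h.
Proof.
move=> iF dH; elim: s => //= e s IH h.
rewrite /resample.
have h12 : ((h :\ e) \subset (e |: h))%SET.
  by apply: (fintype.subset_trans (subsetDl _ _)); apply: subsetUr.
have := IH (e |: h)%SET; have := IH (h :\ e)%SET.
have := avg_increasing s iF h12; have := avg_decreasing s dH h12.
have := q_ge0 e; have := p_ge0 e.
move: (q e) (avg s F _) (avg s F _) (avg s H _) (avg s H _) => x a b c d.
move: (avg s _ _) (avg s _ _) => u v.
move=> x1 x0 ca ab uab vcd.
have y0 : 0 <= x * (1 - x) by apply: mulr_ge0.
have ab0 : 0 <= a - b by rewrite subr_ge0.
have cd0 : 0 <= c - d by rewrite subr_ge0.
have z0 := mulr_ge0 y0 (mulr_ge0 ab0 cd0).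
have u0 := ler_wpM2l x0 vcd; have v0 := ler_wpM2l x1 uab.
rewrite -subr_ge0.
have -> : (x * a + (1 - x) * b) * (x * d + (1 - x) * c) - (x * u + (1 - x) * v) =
  (x * (a * d) - x * u) + ((1 - x) * (b * c) - (1 - x) * v) +
  x * (1 - x) * ((a - b) * (c - d)) by ring.
by apply: addr_ge0 => //; apply: addr_ge0; rewrite subr_ge0.
Qed.

Lemma Ex_harris F H : increasing F -> decreasing H ->
  Ex (fun h => F h * H h) <= Ex F * Ex H.
Proof. by move=> iF dH; apply: avg_harris. Qed.

Definition indep_of e F := forall h, F (e |: h)%SET = F (h :\ e)%SET.

Lemma avg_indep_of e s F : indep_of e F -> indep_of e (avg s F).
Proof.
move=> eF; elim: s => //= e' s IH h.
rewrite /resample; have [->|ee'] := eqVneq e e'.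
  have -> : (e' |: (e' |: h) = e' |: (h :\ e'))%SET.
    by apply/setP => i; rewrite !inE; case: eqVneq.
  have -> // : ((e' |: h) :\ e' = (h :\ e') :\ e')%SET.
  by apply/setP => i; rewrite !inE; case: eqVneq.
have -> : (e' |: (e |: h) = e |: (e' |: h))%SET by rewrite setUCA.
have -> : ((e |: h) :\ e' = e |: (h :\ e'))%SET.
  by apply/setP => i; rewrite !inE; case: (eqVneq i e) => // ->; rewrite ee'.
have -> : (e' |: (h :\ e) = (e' |: h) :\ e)%SET.
  by apply/setP => i; rewrite !inE; case: (eqVneq i e') => // ->; rewrite eq_sym ee'.
have -> : ((h :\ e) :\ e' = (h :\ e') :\ e)%SET by rewrite !setDDl setUC.
by rewrite !IH.
Qed.

Lemma avg_indep s F H : (forall e, indep_of e F \/ indep_of e H) ->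
  forall h, avg s (fun h => F h * H h) h = avg s F h * avg s H h.
Proof.
move=> FH; elim: s => //= e s IH h.
rewrite /resample !IH.
by have [/avg_indep_of->|/avg_indep_of->] := FH e; ring.
Qed.

Lemma Ex_indep F H : (forall e, indep_of e F \/ indep_of e H) ->
  Ex (fun h => F h * H h) = Ex F * Ex H.
Proof. by move=> FH; apply: avg_indep. Qed.

Definition avoid D h : R := (D \subset ~: h)%SET%:R.

Lemma avoid_ge0 D h : 0 <= avoid D h. Proof. exact: ler0n. Qed.

Lemma avoid_le1 D h : avoid D h <= 1. Proof. by rewrite lern1 leq_b1. Qed.

Lemma avoid_decreasing D : decreasing (avoid D).
Proof.
move=> h1 h2 h12; rewrite ler_nat.
case: (boolP (D \subset ~: h2)%SET) => // Dh2.
by rewrite (fintype.subset_trans Dh2)// setCS.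
Qed.

Lemma avoidU D1 D2 h : avoid (D1 :|: D2)%SET h = avoid D1 h * avoid D2 h.
Proof. by rewrite /avoid -natrM mulnb subUset. Qed.

Lemma avoid_indep_of D e : e \notin D -> indep_of e (avoid D).
Proof.
move=> eD h; congr (nat_of_bool _)%:R.
apply/fintype.subsetP/fintype.subsetP => Dh i iD; have := Dh i iD; rewrite !inE;
  by have [ie|] := eqVneq i e => //; rewrite ie (negbTE eD) in iD.
Qed.

Lemma avoidE D h : avoid D h = \prod_e (if e \in D then (e \notin h)%:R else 1).
Proof.
rewrite /avoid; case: (boolP (D \subset ~: h)%SET) => [/fintype.subsetP dDh|].
  rewrite big1// => e _; case: ifP => // /dDh.
  by rewrite inE => ->.
case/fintype.subsetPn => e eD; rewrite inE negbK => eh.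
by rewrite (bigD1 e)//= eD eh mul0r.
Qed.

Lemma Ex_avoid D : Ex (avoid D) = \prod_(e in D) (1 - q e).
Proof.
rewrite (@eq_Ex _ (fun h => \prod_e (if e \in D then (~~ (e \in h))%:R else 1)));
  last exact: avoidE.
rewrite (Ex_prod (fun e b => if e \in D then (~~ b)%:R else 1)).
rewrite [RHS]big_mkcond/=; apply: eq_bigr => e _.
by case: ifP => _; ring.
Qed.

End bernoulli.

Section janson.
Import mathcomp.boot.finset.
Context {R : realType} {E I : finType}.
Variables (q : E -> R) (D : I -> {set E}) (w : I -> R).
Hypothesis q01 : forall e, 0 <= q e <= 1.
Hypothesis w01 : forall i, 0 <= w i <= 1.
Implicit Types (r : seq I) (P : pred I) (h : {set E}).

Let w_ge0 i : 0 <= w i. Proof. by have /andP[] := w01 i. Qed.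
Let w_le1 i : w i <= 1. Proof. by have /andP[] := w01 i. Qed.

(** Conditional probability, given [h], that no [i] is at once selected, independently with
    probability [w i], and such that [D i] is disjoint from [h]. *)
Let Z r P h : R := \prod_(i <- r | P i) (1 - w i * avoid (D i) h).

Let factor01 i h : 0 <= 1 - w i * avoid (D i) h <= 1.
Proof.
rewrite subr_ge0 lerBlDr lerDl mulr_ge0 ?avoid_ge0// andbT.
by rewrite mulr_ile1 ?avoid_ge0 ?avoid_le1.
Qed.

Let Z_ge0 r P h : 0 <= Z r P h.
Proof. by apply: prodr_ge0 => i _; have /andP[] := factor01 i h. Qed.

Let Z_le1 r P h : Z r P h <= 1.
Proof. by apply: prodr_ile1 => i _; exact: factor01. Qed.

Let Z_increasing r P : increasing (Z r P).
Proof.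
move=> h1 h2 h12; apply: ler_prod => i _.
have /andP[-> _] := factor01 i h1.
by rewrite lerD2l lerN2 ler_wpM2l// avoid_decreasing.
Qed.

Let Z_indep_of r P e : (forall i, P i -> e \notin D i) -> indep_of e (Z r P).
Proof.
move=> eP h; apply: eq_bigr => i Pi.
by rewrite (avoid_indep_of (eP i Pi)).
Qed.

Let Z_union_bound r P h :
  1 - \sum_(i <- r | P i) w i * avoid (D i) h <= Z r P h.
Proof.
rewrite /Z; elim: r => [|i r IH]; first by rewrite !big_nil subr0.
rewrite !big_cons; case: ifP => // Pi.
have /andP[f0 f1] := factor01 i h.
have s0 : 0 <= \sum_(j <- r | P j) w j * avoid (D j) h.
  by apply: sumr_ge0 => j _; rewrite mulr_ge0 ?avoid_ge0.
apply: le_trans (ler_wpM2l f0 IH).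
have : 0 <= w i * avoid (D i) h by rewrite mulr_ge0 ?avoid_ge0.
by nra.
Qed.

(** One step of the Boppana-Spencer argument. The factor of [i] removes [w i] times the joint mean
    of [avoid (D i)] and [Z r]. The members [j] with [D j] disjoint from [D i] are independent of
    [avoid (D i)]; the others are handled by a union bound, where Harris's inequality decouples
    [avoid (D i :|: D j)] from the disjoint part. *)
Let Z_step i r :
  Ex q (Z (i :: r) predT) <=
  Ex q (Z r predT) * expR (- (w i * Ex q (avoid (D i))) +
    \sum_(j <- r | D i :&: D j != set0) w i * w j * Ex q (avoid (D i :|: D j))).
Proof.
set M := fun j => D i :&: D j != set0.
have Zsplit h : Z r predT h = Z r M h * Z r (predC M) h.
  by rewrite /Z (bigID M)/=.
have -> : Ex q (Z (i :: r) predT) =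
    Ex q (Z r predT) - w i * Ex q (fun h => avoid (D i) h * Z r predT h).
  rewrite -ExZ// -ExB//; apply: eq_Ex => h.
  by rewrite /Z big_cons; ring.
set A := Ex q (fun h => avoid (D i) h * Z r predT h).
have A0 : 0 <= A by apply: Ex_ge0 => // h; rewrite mulr_ge0 ?avoid_ge0.
set B := Ex q (Z r predT).
have B0 : 0 <= B by apply: Ex_ge0.
set p := Ex q (avoid (D i)).
set S := \sum_(j <- r | M j) w j * Ex q (avoid (D i :|: D j)).
have -> : \sum_(j <- r | M j) w i * w j * Ex q (avoid (D i :|: D j)) = w i * S.
  by rewrite /S mulr_sumr; apply: eq_bigr => j _; rewrite mulrA.
suff AB : B * (p - S) <= A.
  apply: (@le_trans _ _ (B * (1 + (- (w i * p) + w i * S)))).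
    have := ler_wpM2l (w_ge0 i) AB; nra.
  by rewrite ler_wpM2l// expR_ge1Dx.
have [/ltW pS|pS] := ltP (p - S) 0.
  by apply: le_trans A0; rewrite mulr_ge0_le0//.
set C := Ex q (Z r (predC M)).
have BC : B <= C.
  apply: le_Ex => // h; rewrite Zsplit.
  by rewrite ler_piMl.
apply: (@le_trans _ _ (C * (p - S))).
  by rewrite ler_wpM2r.
have -> : C * (p - S) = C * p - \sum_(j <- r | M j) w j * (C * Ex q (avoid (D i :|: D j))).
  rewrite mulrBr /S mulr_sumr; congr (_ - _).
  by apply: eq_bigr => j _; rewrite mulrCA.
apply: (@le_trans _ _ (Ex q (fun h => Z r (predC M) h * avoid (D i) h) -
   \sum_(j <- r | M j) w j * Ex q (fun h => Z r (predC M) h * avoid (D i :|: D j) h))).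
  rewrite Ex_indep//; last first.
    move=> e; have [eDi|eDi] := boolP (e \in D i).
      left; apply: Z_indep_of => j /=; rewrite negbK => /eqP/setP/(_ e).
      by rewrite !inE eDi/= => ->.
    by right; exact: avoid_indep_of.
  rewrite lerD2l lerN2; apply: ler_sum => j _; rewrite ler_wpM2l//.
  by apply: Ex_harris => //; exact: avoid_decreasing.
have -> : \sum_(j <- r | M j) w j * Ex q (fun h => Z r (predC M) h * avoid (D i :|: D j) h) =
   Ex q (fun h => \sum_(j <- r | M j) w j * (Z r (predC M) h * avoid (D i :|: D j) h)).
  by rewrite Ex_sum//; apply: eq_bigr => j _; rewrite ExZ.
rewrite -ExB//; apply: le_Ex => // h.
have -> : \sum_(j <- r | M j) w j * (Z r (predC M) h * avoid (D i :|: D j) h) =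
   Z r (predC M) h * avoid (D i) h * \sum_(j <- r | M j) w j * avoid (D j) h.
  by rewrite mulr_sumr; apply: eq_bigr => j _; rewrite avoidU; ring.
rewrite -[X in X - _]mulr1 -mulrBr Zsplit.
rewrite [leRHS](_ : _ = (Z r (predC M) h * avoid (D i) h) * Z r M h); last by ring.
by rewrite ler_wpM2l// mulr_ge0// avoid_ge0.
Qed.

(* Weights [w i <= 1] act as an independent sparsification of the family, so this
   contains the extended Janson inequality. *)
Lemma janson r :
  Ex q (fun h => \prod_(i <- r) (1 - avoid (D i) h)) <=
  expR (- (\sum_(i <- r) w i * Ex q (avoid (D i))) +
    \sum_(i <- r) \sum_(j <- r | D i :&: D j != set0)
       w i * w j * Ex q (avoid (D i :|: D j))).
Proof.
have a0 (A : {set E}) : 0 <= Ex q (avoid A).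
  by apply: Ex_ge0 => // h; exact: avoid_ge0.
apply: (@le_trans _ _ (Ex q (Z r predT))).
  apply: le_Ex => // h; apply: ler_prod => i _.
  rewrite subr_ge0 avoid_le1/= lerD2l lerN2.
  by rewrite ler_piMl ?avoid_ge0.
elim: r => [|i r IH].
  rewrite !big_nil oppr0 addr0 expR0 -[leRHS](Ex_cst q 1).
  by apply: le_Ex.
apply: (le_trans (Z_step i r)).
have /ler_wpM2r := IH; move=> /(_ _ (expR_ge0 _)) h; apply: (le_trans (h _)).
rewrite -expRD ler_expR !big_cons.
have S1 : \sum_(j <- r) \sum_(i0 <- r | D j :&: D i0 != set0)
     w j * w i0 * Ex q (avoid (D j :|: D i0)) <=
   \sum_(j <- r) \sum_(i0 <- i :: r | D j :&: D i0 != set0)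
     w j * w i0 * Ex q (avoid (D j :|: D i0)).
  apply: ler_sum => j _; rewrite big_cons; case: ifP => // _.
  by rewrite lerDr !mulr_ge0.
have S2 : 0 <= w i * w i * Ex q (avoid (D i :|: D i)) by rewrite !mulr_ge0.
case: ifP => _; lra.
Qed.

End janson.

(** * Random graphs with given vertex positions *)

Section edges.
Import mathcomp.boot.finset.

(** Increasing pairs, so that each unordered pair of vertices is one coordinate of the product
    law. *)
Definition edge (n : nat) := {p : 'I_n * 'I_n | p \in [pred p : 'I_n * 'I_n | (p.1 < p.2)%N]}.

Definition edges_in n (A : {set 'I_n}) : {set edge n} :=
  [set e | ((val e).1 \in A) && ((val e).2 \in A)].

Lemma big_edges_in (R : Type) (idx : R) (op : Monoid.com_law idx) n
    (A : {set 'I_n}) (F : 'I_n * 'I_n -> R) :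
  \big[op/idx]_(e in edges_in A) F (val e) =
  \big[op/idx]_(p : 'I_n * 'I_n | [&& (p.1 < p.2)%N, p.1 \in A & p.2 \in A]) F p.
Proof.
pose lt := [pred p : 'I_n * 'I_n | (p.1 < p.2)%N].
pose inA := [pred p : 'I_n * 'I_n | (p.1 \in A) && (p.2 \in A)].
transitivity (\big[op/idx]_(p in lt | inA p) F p); last by apply: eq_bigl.
by rewrite big_sub_cond; apply: eq_bigl => e; rewrite !inE.
Qed.

(** Ordered pairs count each edge twice and the diagonal once. This converts the weight of a vertex
    set into the quadratic form that [phi] sees. *)
Lemma sum_edges_in (R : realType) n (A : {set 'I_n}) (b : 'I_n -> 'I_n -> R) :
  (forall x y, b x y = b y x) ->
  2 * (\sum_(e in edges_in A) b (val e).1 (val e).2) + \sum_(x in A) b x x =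
  \sum_(x in A) \sum_(y in A) b x y.
Proof.
move=> bC; rewrite (big_edges_in _ A (fun p => b p.1 p.2)).
rewrite pair_big/= [RHS](bigID (fun p : 'I_n * 'I_n => (p.1 < p.2)%N))/=.
rewrite [X in _ = _ + X](bigID (fun p : 'I_n * 'I_n => (p.2 < p.1)%N))/=.
rewrite mulr2n mulrDl mul1r -addrA; congr (_ + (_ + _)).
- by apply: eq_bigl => p; rewrite andbC.
- rewrite (@reindex_inj _ _ _ _ (fun p : 'I_n * 'I_n => (p.2, p.1)))/=; last by case=> ? ? [? ?] [-> ->].
  apply: eq_big => -[x y]/=.
    by case: ltngtP => //=; rewrite ?andbT ?andbF// andbC.
  by move=> _; rewrite bC.
rewrite (reindex_onto (fun x : 'I_n => (x, x)) (fun p => p.1)) /=.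
  by apply: eq_bigl => x; rewrite ltnn eqxx !andbT andbb.
by move=> [x y]/= /andP[/andP[_]]; case: ltngtP => // /val_inj ->.
Qed.

Lemma prod_setUI (R : realType) (E : finType) (A B : {set E}) (f : E -> R) :
  (\prod_(e in A :|: B) f e) * (\prod_(e in A :&: B) f e) =
  (\prod_(e in A) f e) * (\prod_(e in B) f e).
Proof.
rewrite !(big_mkcond (fun e => e \in _))/= -!big_split/=; apply: eq_bigr => e _.
by rewrite !inE; case: (e \in A); case: (e \in B) => /=; rewrite ?mulr1 ?mul1r.
Qed.

Lemma edges_inI n (A B : {set 'I_n}) :
  edges_in A :&: edges_in B = edges_in (A :&: B).
Proof. by apply/setP => e; rewrite !inE andbACA. Qed.

End edges.

(** * Independent transversals *)

Section transversal.
Import mathcomp.boot.finset.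
Context {R : realType} {n m : nat} {S : finType}.
Variables (q : edge n -> R) (v : S -> 'I_m -> 'I_n).
Variables (b : 'I_n -> 'I_n -> R) (c : S -> S -> R).
Hypothesis q01 : forall e, 0 <= q e <= 1.
Hypothesis b_ge0 : forall x y, 0 <= b x y.
Hypothesis bC : forall x y, b x y = b y x.
Hypothesis b_q : forall e, expR (- b (val e).1 (val e).2) <= 1 - q e.
Hypothesis v_inj : forall j a j' a', v j a = v j' a' -> j = j' /\ a = a'.
Hypothesis b_v : forall j a j' a', b (v j a) (v j' a') = c j j'.
Hypothesis m_gt0 : (0 < m)%N.
Hypothesis S_gt1 : (1 < #|S|)%N.

(** Half of the full form, diagonal included, hence at least the edge weight of a partial
    transversal over [Q]: such a set is independent with probability at least [expR (- beta Q)]. *)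
Let beta (Q : {set S}) : R := 2^-1 * \sum_(j in Q) \sum_(j' in Q) c j j'.

(** The normalised correlation sum of Janson's inequality: a fraction [m^-#|Q|] of all transversals
    agrees with a given one on [Q], and [expR (beta Q)] bounds the gain from sharing that part. Two
    transversals have a common edge only if they agree at two indices, whence [1 < #|Q|]. *)
Let rho : R := \sum_(Q : {set S} | (1 < #|Q|)%N) (m%:R^-1) ^+ #|Q| * expR (beta Q).

Definition pick_set (f : {ffun S -> 'I_m}) : {set 'I_n} :=
  [set v j (f j) | j : S].

Let agree (f g : {ffun S -> 'I_m}) : {set S} := [set j | f j == g j].

Let transversalI f g :
  pick_set f :&: pick_set g = [set v j (f j) | j in agree f g].
Proof.
apply/setP => x; apply/setIP/imsetP.
  move=> [/imsetP[j _ xj] /imsetP[j' _ xj']].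
  have [jj' ff] : j = j' /\ f j = g j' by apply: v_inj; rewrite -xj -xj'.
  by exists j => //; rewrite inE ff jj'.
move=> [j]; rewrite inE => /eqP fg ->; split; apply/imsetP; exists j => //.
by rewrite fg.
Qed.

Let sum_image (f : {ffun S -> 'I_m}) (Q : {set S}) (F : 'I_n -> R) :
  \sum_(x in [set v j (f j) | j in Q]) F x = \sum_(j in Q) F (v j (f j)).
Proof. by rewrite big_imset//= => j j' _ _ /v_inj[]. Qed.

Let prod_edges_image (f : {ffun S -> 'I_m}) (Q : {set S}) :
  expR (- beta Q) <= \prod_(e in edges_in [set v j (f j) | j in Q]) (1 - q e).
Proof.
set A := [set v j (f j) | j in Q].
apply: (@le_trans _ _ (expR (- \sum_(e in edges_in A) b (val e).1 (val e).2))).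
  rewrite ler_expR lerN2.
  have := sum_edges_in A bC.
  have : 0 <= \sum_(x in A) b x x by apply: sumr_ge0.
  have -> : \sum_(x in A) \sum_(y in A) b x y = 2 * beta Q.
    rewrite /beta mulrA divff// mul1r sum_image; apply: eq_bigr => j _.
    by rewrite sum_image; apply: eq_bigr => j' _.
  lra.
rewrite -sumrN expR_sum; apply: ler_prod => e _.
by rewrite expR_ge0 b_q.
Qed.

Let N : R := #|{ffun S -> 'I_m}|%:R.

Let mR_gt0 : 0 < m%:R :> R. Proof. by rewrite ltr0n. Qed.

Let N_gt0 : 0 < N.
Proof. by rewrite ltr0n card_ffun card_ord expn_gt0 m_gt0. Qed.

Let count_agree (f : {ffun S -> 'I_m}) (Q : {set S}) :
  \sum_(g : {ffun S -> 'I_m}) (Q \subset agree f g)%:R = N * (m%:R^-1) ^+ #|Q|.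
Proof.
transitivity (\sum_(g : {ffun S -> 'I_m}) \prod_j
    (if j \in Q then (f j == g j)%:R else 1) : R).
  apply: eq_bigr => g _.
  case: (boolP (Q \subset agree f g)) => [/fintype.subsetP Qfg|].
    rewrite big1// => j _; case: ifP => // /Qfg.
    by rewrite inE => ->.
  case/subsetPn => j jQ; rewrite inE => fg.
  by rewrite (bigD1 j)//= jQ (negbTE fg) mul0r.
rewrite -(bigA_distr_bigA (fun j a => if j \in Q then (f j == a)%:R else 1)).
transitivity (\prod_j (m%:R * (if j \in Q then m%:R^-1 else 1)) : R).
  apply: eq_bigr => j _; case: ifP => _.
    rewrite mulfV ?gt_eqF// (bigD1 (f j))//= eqxx big1 ?addr0// => a.
    by rewrite eq_sym => /negbTE ->.
  by rewrite sumr_const card_ord mulr1.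
rewrite big_split/= prodr_const -big_mkcond/= prodr_const.
by rewrite /N card_ffun card_ord natrX.
Qed.

Let rho_term (Q : {set S}) : (1 < #|Q|)%N ->
  (m%:R^-1) ^+ #|Q| * expR (beta Q) <= rho.
Proof.
move=> Q1; rewrite /rho (bigD1 Q)//= lerDl; apply: sumr_ge0 => Q' _.
by rewrite mulr_ge0 ?expR_ge0// exprn_ge0// invr_ge0 ltW.
Qed.

Let rho_gt0 : 0 < rho.
Proof.
have h : (1 < #|[set: S]|)%N by rewrite cardsT.
by apply: lt_le_trans (rho_term h); rewrite mulr_gt0 ?expR_gt0// exprn_gt0// invr_gt0.
Qed.

(* Janson's inequality with weights [k / p f], where [p f] is the probability that
   [pick_set f] is independent and [k = 1 / (2 rho m^|S|)]; the term of the full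
   set in [rho] is what makes these weights at most 1. *)
Lemma no_independent_transversal :
  Ex q (fun h => [forall f, ~~ (edges_in (pick_set f) \subset ~: h)]%:R) <=
  expR (- (4 * \sum_(Q : {set S} | (1 < #|Q|)%N)
     (m%:R^-1) ^+ #|Q| *
     expR (2^-1 * \sum_(j in Q) \sum_(j' in Q) c j j'))^-1).
Proof.
rewrite -/rho.
pose D f := edges_in (pick_set f).
pose p f := Ex q (avoid (D f)).
pose k := (2 * rho * N)^-1.
have transversalE f : pick_set f = [set v j (f j) | j in [set: S]].
  by apply/setP => x; apply/imsetP/imsetP => -[j _ ->]; exists j.
have p_lb f : expR (- beta [set: S]) <= p f.
  by rewrite /p Ex_avoid// /D transversalE.
have p_gt0 f : 0 < p f by apply: lt_le_trans (p_lb f); exact: expR_gt0.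
have k_gt0 : 0 < k by rewrite invr_gt0 !mulr_gt0.
have k_p f : k <= p f.
  apply: le_trans (p_lb f).
  have h : (1 < #|[set: S]|)%N by rewrite cardsT.
  have := rho_term h; rewrite cardsT expRN => h1.
  rewrite /k lef_pV2 ?posrE ?expR_gt0 ?mulr_gt0//.
  have NE : N * (m%:R^-1) ^+ #|S| = 1.
    by rewrite /N card_ffun card_ord natrX -exprMn divff ?gt_eqF// expr1n.
  have := ler_wpM2l (ltW N_gt0) h1; rewrite mulrA NE mul1r => h2.
  apply: (le_trans h2); rewrite mulrC -mulrA ler_peMl ?mulr_ge0 ?ltW//.
  by rewrite ltr1n.
have w01 f : 0 <= k / p f <= 1.
  apply/andP; split; first by apply: divr_ge0; apply: ltW.
  by rewrite ler_pdivrMr// mul1r k_p.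
have := @janson R _ _ q D (fun f => k / p f) q01 w01 (enum {ffun S -> 'I_m}).
rewrite -/p => J.
apply: le_trans (le_trans J _).
  apply: le_Ex => // h.
  case: (boolP [forall f, _]) => [/forallP H|_]; last first.
    by apply: prodr_ge0 => f _; rewrite subr_ge0 avoid_le1.
  rewrite big1// => f _; rewrite /avoid (negbTE (H f)).
  by rewrite subr0.
rewrite ler_expR !big_enum/=.
have -> : \sum_f k / p f * p f = k * N.
  rewrite (eq_bigr (fun=> k)); last by move=> f _; rewrite divfK// gt_eqF.
  by rewrite sumr_const -[in LHS]mulr_natr.
have S2 : \sum_f \sum_(g <- enum {ffun S -> 'I_m} | D f :&: D g != set0)
     k / p f * (k / p g) * Ex q (avoid (D f :|: D g)) <= k ^+ 2 * N ^+ 2 * rho.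
  apply: (@le_trans _ _ (\sum_(f : {ffun S -> 'I_m}) \sum_(g : {ffun S -> 'I_m})
      \sum_(Q : {set S} | (1 < #|Q|)%N) k ^+ 2 * expR (beta Q) * (Q \subset agree f g)%:R)).
    apply: ler_sum => f _; rewrite big_enum_cond/= big_mkcond/=; apply: ler_sum => g _.
    have F0 Q : 0 <= k ^+ 2 * expR (beta Q) * (Q \subset agree f g)%:R.
      by rewrite mulr_ge0// mulr_ge0 ?expR_ge0// exprn_ge0// ltW.
    case: ifP => [/set0Pn[e]|_]; last by apply: sumr_ge0.
    rewrite /D edges_inI transversalI inE => /andP[/imsetP[j1 j1Q e1] /imsetP[j2 j2Q e2]].
    have agree_gt1 : (1 < #|agree f g|)%N.
      apply/card_gt1P; exists j1, j2; split => //.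
      apply/eqP => j12; have := valP e; rewrite inE e1 e2 j12 ltnn//.
    (* The term of the agreement set itself suffices; keeping all its subsets only enlarges the
       bound and makes the count over [g] a plain product. *)
    rewrite (bigD1 (agree f g))//= subxx mulr1.
    apply: ler_wpDr; first by apply: sumr_ge0.
    have := prod_setUI (D f) (D g) (fun e => 1 - q e).
    rewrite -!Ex_avoid// -/(p f) -/(p g) {2}/D edges_inI transversalI => pp.
    have lb := prod_edges_image f (agree f g).
    rewrite -Ex_avoid// in lb.
    set r := Ex q (avoid (edges_in _)) in pp lb.
    have r0 : 0 < r by apply: lt_le_trans lb; rewrite expR_gt0.
    have -> : Ex q (avoid (edges_in (pick_set f) :|: edges_in (pick_set g))) =
        p f * p g / r by rewrite -pp mulfK// gt_eqF.
    rewrite [leLHS](_ : _ = k ^+ 2 * r^-1); last first.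
      by field; rewrite !gt_eqF.
    rewrite ler_wpM2l ?exprn_ge0 ?(ltW k_gt0)//.
    by rewrite -[leRHS]invrK -expRN lef_pV2 ?posrE ?expR_gt0.
  under eq_bigr => f _.
    rewrite exchange_big/=.
    under eq_bigr => Q _ do rewrite -mulr_sumr count_agree.
    over.
  rewrite sumr_const -[leLHS]mulr_natl -/N.
  rewrite (eq_bigr (fun Q : {set S} => k ^+ 2 * N * ((m%:R^-1) ^+ #|Q| * expR (beta Q)))).
    by rewrite -mulr_sumr -/rho; lra.
  by move=> Q _; ring.
(* With [x = k * N] the exponent is [- x + rho * x ^+ 2]; this value of [x] minimises it and gives
   [- (4 * rho)^-1]. *)
have kN : k * N = (2 * rho)^-1.
  by rewrite /k invfM -mulrA mulVf ?mulr1// gt_eqF.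
apply: (@le_trans _ _ (- (k * N) + k ^+ 2 * N ^+ 2 * rho)).
  by rewrite lerD2l.
rewrite -exprMn kN le_eqVlt; apply/orP; left; apply/eqP.
by field; rewrite gt_eqF.
Qed.

End transversal.

(** * Greedy colouring by removal of type profiles *)

Section colouring.
Import mathcomp.boot.finset.
Context {n : nat}.
Variable g : simple_graph 'I_n.
Implicit Types (A B T U : {set 'I_n}).

Lemma chromatic_number_le k : colorable g k -> (chromatic_number g <= k)%N.
Proof. by rewrite /chromatic_number; case: ex_minnP => m _; apply. Qed.

Lemma chromatic_numberP : colorable g (chromatic_number g).
Proof. by rewrite /chromatic_number; case: ex_minnP. Qed.

Definition independent A := [forall x in A, forall y in A, ~~ adj g x y].

Lemma independentP A :
  reflect {in A &, forall x y, ~~ adj g x y} (independent A).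
Proof.
apply: (iffP forall_inP) => [H x y xA yA|H x xA].
  by move/forall_inP: (H x xA); apply.
by apply/forall_inP => y yA; apply: H.
Qed.

Lemma adjC x y : adj g x y = adj g y x.
Proof. by have /andP[_ /forallP/(_ x)/forallP/(_ y)/eqP] := valP g. Qed.

Lemma adj_irr x : adj g x x = false.
Proof. by apply/negbTE; have /andP[/forallP/(_ x)] := valP g. Qed.

(** Colours are plain naturals, so that a colouring extends to a larger set with more colours
    without a change of type. *)
Definition colorable_on A k := exists c : 'I_n -> nat,
  (forall x, x \in A -> c x < k)%N /\
  {in A &, forall x y, adj g x y -> c x != c y}.

Lemma colorable_onU A T k : colorable_on A k -> independent T ->
  colorable_on (A :|: T) k.+1.
Proof.
move=> [c [ck cA]] /independentP iT.
exists (fun x => if x \in A then c x else k); split.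
  by move=> x _; case: ifP => // xA; rewrite ltnS ltnW// ck.
move=> x y; rewrite !inE.
case: (boolP (x \in A)) => xA; case: (boolP (y \in A)) => yA //= xT yT xy.
- exact: cA.
- by rewrite ltn_eqF// ck.
- by rewrite gtn_eqF// ck.
- by have := iT x y xT yT; rewrite xy.
Qed.

Lemma colorable_onU_card A B k : colorable_on A k ->
  colorable_on (A :|: B) (k + #|B|).
Proof.
move: {2}#|B| (erefl #|B|) => N; elim: N B k => [|N IH] B k.
  by move=> /eqP; rewrite cards_eq0 => /eqP ->; rewrite setU0 cards0 addn0.
move=> BN cA; have /card_gt0P[x xB] : (0 < #|B|)%N by rewrite BN.
have BxN : #|B :\ x| = N by move: BN; rewrite (cardsD1 x) xB => -[].
rewrite BN addnS; have := IH (B :\ x) k BxN cA; rewrite BxN.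
have ix : independent [set x].
  by apply/independentP => y z; rewrite !inE => /eqP-> /eqP->; rewrite adj_irr.
move=> /colorable_onU/(_ ix).
by rewrite -setUA [X in A :|: X]setUC setD1K.
Qed.

Lemma colorable_onT k : colorable_on setT k -> colorable g k.
Proof.
move=> [c [ck cE]].
apply/existsP; exists [ffun x => Ordinal (ck x (in_setT x))].
apply/forallP => x; apply/forallP => y; apply/implyP => xy; rewrite !ffunE.
by rewrite -val_eqE/=; apply: cE; rewrite ?inE.
Qed.

(* Classes that have shrunk below [m] are left alone from then on, so that each
   class either ends below [m] or has lost its share of every profile. *)
Lemma colorable_profiles (k m : nat) (tau : 'I_n -> 'I_k) (l : seq ('I_k -> nat)) :
  (forall i (s : 'I_k -> nat) U, (i < size l)%N -> s = nth (fun=> 0%N) l i ->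
     exists T, [/\ T \subset U, independent T &
       forall j, (m <= #|[set x in U | tau x == j]|)%N ->
         (s j <= #|[set x in T | tau x == j]|)%N]) ->
  (forall j, #|[set x | tau x == j]| <= \sum_(s <- l) s j)%N ->
  colorable g (size l + k * m).
Proof.
move=> H cover.
suff [U [colU small]] : exists U, colorable_on (~: U) (size l) /\
    forall j, (#|[set x in U | tau x == j]| < m)%N \/
      (#|[set x in U | tau x == j]| + \sum_(s <- l) s j <=
       #|[set x | tau x == j]|)%N.
  have {}small j : (#|[set x in U | tau x == j]| <= m)%N.
    case: (small j) => [/ltnW//|h].
    by have := cover j; lia.
  have Ukm : (#|U| <= k * m)%N.
    rewrite -sum1_card (partition_big tau xpredT)//=.
    rewrite -[k in (k * m)%N]card_ord -sum_nat_const leq_sum// => j _.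
    by apply: leq_trans (small j); rewrite -sum1_card; apply: eq_leq; apply: eq_bigl => x; rewrite inE.
  apply: colorable_onT; have := colorable_onU_card U colU.
  rewrite setUC setUCr => -[c [c1 c2]]; exists c; split => // x xT.
  by apply: leq_trans (c1 x xT) _; rewrite leq_add2l.
elim/last_ind: l H {cover} => [|l s IH] H.
  exists [set: 'I_n]; split; last first.
    by move=> j; right; rewrite big_nil addn0; apply: subset_leq_card; apply/fintype.subsetP => x; rewrite !inE.
  by exists (fun=> 0%N); split=> x; rewrite !inE.
have [i s' U il sE|U [colU small]] := IH.
  by apply: (H i s'); rewrite ?size_rcons ?ltnS ?(ltnW il)// nth_rcons il.
have [||T [TU iT sT]] := H (size l) s U.
- by rewrite size_rcons.
- by rewrite nth_rcons ltnn eqxx.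
exists (U :\: T); split.
  rewrite size_rcons setCD; exact: colorable_onU.
move=> j; pose cls A := [set x in A | tau x == j].
have UDj : cls (U :\: T) = cls U :\: cls T.
  by apply/setP => x; rewrite !inE; case: (tau x == j); rewrite ?andbT ?andbF.
have Tj : cls T \subset cls U.
  by apply/fintype.subsetP => x; rewrite !inE => /andP[/(fintype.subsetP TU) -> ->].
have cUD : (#|cls (U :\: T)| + #|cls T| = #|cls U|)%N.
  by rewrite UDj cardsD (setIidPr Tj) subnK// subset_leq_card.
rewrite -/(cls _); have [Um|mU] := ltnP #|cls U| m.
  by left; apply: leq_ltn_trans Um; rewrite -cUD leq_addr.
case: (small j) => [|sm]; first by rewrite ltnNge mU.
right; rewrite -cats1 big_cat/= big_seq1.
apply: leq_trans sm; rewrite -[in leqRHS]cUD -addnA leq_add2l addnC leq_add2r.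
exact: sT.
Qed.

End colouring.

(** * Quadratic forms on boxes *)

Lemma quadratic_scale (R : realType) (I : finType) (a : I -> I -> R) (z : R)
    (v : I -> R) :
  \sum_i \sum_j a i j * (z * v i * (z * v j)) =
  z * (z * \sum_i \sum_j a i j * (v i * v j)).
Proof.
rewrite !mulr_sumr; apply: eq_bigr => i _; rewrite !mulr_sumr.
by apply: eq_bigr => j _; ring.
Qed.

Section box.
Import mathcomp.boot.finset.
Context {R : realType} {I : finType}.
Variables (a : I -> I -> R) (u : I -> R) (B : R).
Hypothesis a_ge0 : forall i j, 0 <= a i j.
Hypothesis u_ge0 : forall i, 0 <= u i.
Hypothesis vertex : forall J : {set I},
  \sum_(i in J) \sum_(j in J) a i j * (u i * u j) <= B * \sum_(i in J) u i.

(* Choosing a random vertex of the box with mean [v] does not change the linear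
   side and can only increase the quadratic one. *)
Lemma quadratic_le_linear_on_box (v : I -> R) : (forall i, 0 <= v i <= u i) ->
  \sum_i \sum_j a i j * (v i * v j) <= B * \sum_i v i.
Proof.
(* [t i] is the probability of choosing [u i] rather than 0 in coordinate [i]. If [u i = 0] then
   [v i = 0], and the convention [0 / 0 = 0] is harmless. *)
move=> v01; pose t i := v i / u i.
have tu i : t i * u i = v i.
  rewrite /t; have [u0|u0] := eqVneq (u i) 0; last by rewrite divfK.
  by have := v01 i; rewrite u0 mulr0; lra.
have t01 i : 0 <= t i <= 1.
  have /andP[v0 vu] := v01 i; rewrite /t divr_ge0//=.
  have [u0|u0] := eqVneq (u i) 0; first by rewrite u0 invr0 mulr0.
  by rewrite ler_pdivrMr ?mul1r// lt0r u0 u_ge0.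
pose c i (h : {set I}) : R := 1 - avoid [set i] h.
have cE i h : c i h = (i \in h)%:R.
  rewrite /c /avoid sub1set inE; case: (i \in h) => /=; first by rewrite subr0.
  by rewrite subrr.
have Ec i : Ex t (c i) = t i.
  by rewrite ExB Ex_cst// Ex_avoid// big_set1; ring.
(* Off the diagonal this is an equality, by independence; on it [c i] is idempotent, so its second
   moment is [t i], at least [t i ^+ 2]. *)
have Ecc i j : t i * t j <= Ex t (fun h => c i h * c j h).
  have [<-|ij] := eqVneq i j.
    rewrite (@eq_Ex _ _ _ _ (c i)); last first.
      by move=> h; rewrite !cE -natrM mulnb andbb.
    by rewrite Ec; have := t01 i; nra.
  rewrite Ex_indep// ?Ec// => e.
  have [ei|ei] := eqVneq e i; [right|left] => h; rewrite /c;
    by rewrite (@avoid_indep_of _ _ _ e)// inE ?ei.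
have : Ex t (fun h => \sum_i \sum_j (a i j * (u i * u j)) * (c i h * c j h)) <=
       Ex t (fun h => B * \sum_i u i * c i h).
  apply: le_Ex => // h.
  have <- : \sum_(i in h) \sum_(j in h) a i j * (u i * u j) =
      \sum_i \sum_j a i j * (u i * u j) * (c i h * c j h).
    rewrite big_mkcond/=; apply: eq_bigr => i _; rewrite cE; case: (i \in h).
      rewrite big_mkcond/=; apply: eq_bigr => j _; rewrite cE; case: (j \in h);
      by rewrite ?mulr1 ?mulr0.
    by rewrite big1// => j _; rewrite mul0r mulr0.
  have <- : \sum_(i in h) u i = \sum_i u i * c i h.
    rewrite big_mkcond/=; apply: eq_bigr => i _.
    by rewrite cE; case: ifP; rewrite ?mulr1 ?mulr0.
  exact: vertex.
rewrite ExZ// !Ex_sum//.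
have -> : \sum_i Ex t (fun h => u i * c i h) = \sum_i v i.
  by apply: eq_bigr => i _; rewrite ExZ Ec mulrC tu.
apply: le_trans; apply: ler_sum => i _; rewrite Ex_sum//; apply: ler_sum => j _.
rewrite ExZ//; apply: le_trans (ler_wpM2l _ (Ecc i j)); last by rewrite !mulr_ge0.
by rewrite -!tu le_eqVlt; apply/orP; left; apply/eqP; ring.
Qed.

End box.

(** * Edge weights as a Bernoulli product law *)

Section edge_weight.
Import mathcomp.boot.finset.
Context {R : realType} {n : nat}.

Definition edges_of (g : simple_graph 'I_n) : {set edge n} :=
  [set e | adj g (val e).1 (val e).2].

Lemma edges_of_inj : injective edges_of.
Proof.
move=> g1 g2 g12; apply/val_inj/setP => -[x y].
have lt (z t : 'I_n) : (z < t)%N -> adj g1 z t = adj g2 z t.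
  move=> zt; pose e : edge n := exist _ (z, t) zt.
  by move/setP/(_ e): g12; rewrite !inE.
suff : adj g1 x y = adj g2 x y by [].
have [xy|yx|xy] := ltngtP x y; first exact: lt.
  by rewrite adjC [RHS]adjC lt.
by have -> : y = x; [exact: val_inj | rewrite !adj_irr].
Qed.

Lemma independent_edges (g : simple_graph 'I_n) (A : {set 'I_n}) :
  independent g A = (edges_in A \subset ~: edges_of g).
Proof.
apply/independentP/fintype.subsetP => [iA e|AE x y xA yA].
  by rewrite !inE => /andP[]; exact: iA.
have lt (z t : 'I_n) : z \in A -> t \in A -> (z < t)%N -> ~~ adj g z t.
  move=> zA tA zt; pose e : edge n := exist _ (z, t) zt.
  have /AE : e \in edges_in A by rewrite inE/= zA tA.
  by rewrite !inE.
have [xy|yx|xy] := ltngtP x y; first exact: lt.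
  by rewrite adjC lt.
by have -> : y = x; [exact: val_inj | rewrite adj_irr].
Qed.

Variables (W : R -> R -> R) (x : 'I_n -> R).

Definition edge_prob (e : edge n) : R := W (x (val e).1) (x (val e).2).

Hypothesis W01 : forall e, 0 <= edge_prob e <= 1.

Lemma edge_weight_Ex (g : simple_graph 'I_n) :
  edge_weight W x g = Ex edge_prob (fun h => (h == edges_of g)%:R).
Proof.
rewrite /edge_weight.
rewrite (@eq_Ex _ _ _ _ (fun h =>
    \prod_e (if e \in edges_of g then (e \in h)%:R else (~~ (e \in h))%:R))).
  rewrite (Ex_prod _ (fun e b => if e \in edges_of g then b%:R else (~~ b)%:R)).
  rewrite (@big_sub _ _ _ _ [pred p : 'I_n * 'I_n | (p.1 < p.2)%N]).
  apply: eq_bigr => e _; rewrite inE/=.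
  by case: ifP => _; rewrite mulr1 mulr0 ?addr0 ?add0r.
move=> h; have [->|hg] := eqVneq h (edges_of g).
  by rewrite big1// => e _; case: ifP => ->.
suff /existsP[e eh] : [exists e, (e \in h) != (e \in edges_of g)].
  rewrite (bigD1 e)//=; move: eh.
  by case: (e \in h); case: (e \in edges_of g) => //=; rewrite mul0r.
apply: contraNT hg; rewrite negb_exists => /forallP H.
by apply/eqP/setP => e; apply/eqP; have := H e; rewrite negbK.
Qed.

(** Markov's inequality: [F] dominates the indicator of [Q] on edge sets of graphs, and since
    [edges_of] is injective no edge set is charged twice. *)
Lemma sum_edge_weight_le (Q : pred (simple_graph 'I_n)) (F : {set edge n} -> R) :
  (forall h, 0 <= F h) -> (forall g, Q g -> 1 <= F (edges_of g)) ->
  \sum_(g | Q g) edge_weight W x g <= Ex edge_prob F.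
Proof.
move=> F0 F1; under eq_bigr do rewrite edge_weight_Ex.
rewrite -Ex_sum//; apply: le_Ex => // h.
have [/existsP[g /andP[Qg /eqP hg]]|] := boolP [exists g, Q g && (h == edges_of g)].
  rewrite (bigD1 g)//= hg eqxx big1 ?addr0 ?F1// => g' /andP[_ g'g].
  by rewrite (inj_eq edges_of_inj) eq_sym (negbTE g'g).
rewrite negb_exists => /forallP H; rewrite big1// => g Qg.
by have := H g; rewrite Qg/= => /negbTE ->.
Qed.

End edge_weight.

(** * First moment of heavy independent sets *)

Section first_moment.
Import mathcomp.boot.finset.
Context {R : realType}.

Lemma sum_expn_card (T : finType) (y : R) :
  \sum_(A : {set T}) y ^+ #|A| = (1 + y) ^+ #|T|.
Proof.
have -> : (1 + y) ^+ #|T| = \prod_(i : T) (y + 1) by rewrite prodr_const addrC.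
rewrite bigA_distr.
apply: eq_bigr => A _.
by rewrite -big_mkcond/= prodr_const.
Qed.

Lemma sum_expn_card_le (T : finType) (y : R) : 0 <= y ->
  \sum_(A : {set T}) y ^+ #|A| <= expR (#|T|%:R * y).
Proof.
move=> y0; rewrite sum_expn_card expRM_natl.
by apply: lerXn2r; rewrite ?nnegrE ?expR_ge0 ?expR_ge1Dx// addr_ge0.
Qed.

(** A bad set [A] is independent with probability at most [expR (- t) ^+ #|A|], and the binomial
    theorem sums this over all sizes at once. The empty set is never bad, which accounts for the
    [- 1]. *)
Lemma independent_set_first_moment n (W : R -> R -> R) (x : 'I_n -> R)
    (b : 'I_n -> 'I_n -> R) (t : R) :
  (forall e, 0 <= edge_prob W x e <= 1) ->
  (forall e, 1 - edge_prob W x e <= expR (- b (val e).1 (val e).2)) ->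
  \sum_(g | [exists A, independent g A &&
     (#|A|%:R * t < \sum_(e in edges_in A) b (val e).1 (val e).2)])
     edge_weight W x g <= expR (n%:R * expR (- t)) - 1.
Proof.
move=> q01 qb.
pose bad (A : {set 'I_n}) :=
  #|A|%:R * t < \sum_(e in edges_in A) b (val e).1 (val e).2.
apply: (le_trans (sum_edge_weight_le (F := fun h =>
    \sum_(A | bad A) avoid (edges_in A) h) q01 _ _)).
- by move=> h; apply: sumr_ge0 => A _; exact: avoid_ge0.
- move=> g /existsP[A /andP[iA bA]].
  rewrite (bigD1 A)//= /avoid -independent_edges iA lerDl.
  by apply: sumr_ge0 => B _; exact: avoid_ge0.
rewrite Ex_sum//.
apply: (@le_trans _ _ (\sum_(A : {set 'I_n} | A != set0) expR (- t) ^+ #|A|)).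
  rewrite big_mkcond [leRHS]big_mkcond; apply: ler_sum => A _.
  rewrite /bad; have [->|A0] := eqVneq A set0.
    rewrite cards0 mul0r big1 ?ltxx// => e.
    by rewrite !inE.
  case: ifP => [bA|_]; last by rewrite exprn_ge0// expR_ge0.
  rewrite Ex_avoid//; apply: (@le_trans _ _ (\prod_(e in edges_in A) expR (- b (val e).1 (val e).2))).
    by apply: ler_prod => e _; rewrite qb subr_ge0; have /andP[_ ->] := q01 e.
  by rewrite -expR_sum sumrN -expRM_natl ler_expR mulrN lerN2 ltW.
rewrite lerBrDl; have := @sum_expn_card_le 'I_n _ (expR_ge0 (- t)).
by rewrite card_ord (bigD1 set0)//= cards0 expr0.
Qed.

End first_moment.

(** * Independent sets with a prescribed profile of types *)

Section profile.
Import mathcomp.boot.finset.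
Context {R : realType} {n k : nat}.
Variables (q : edge n -> R) (tau : 'I_n -> 'I_k) (a : 'I_k -> 'I_k -> R).
Hypothesis q01 : forall e, 0 <= q e <= 1.
Hypothesis a_ge0 : forall i j, 0 <= a i j.
Hypothesis aC : forall i j, a i j = a j i.
Hypothesis a_q : forall e, expR (- a (tau (val e).1) (tau (val e).2)) <= 1 - q e.
Implicit Types (U T : {set 'I_n}) (s t : 'I_k -> nat).

Definition class U (i : 'I_k) : {set 'I_n} := [set x in U | tau x == i].

(* [h] is the edge set of the graph. *)
Definition has_profile U t (h : {set edge n}) : bool :=
  [exists T : {set 'I_n}, [&& T \subset U, edges_in T \subset ~: h &
                             [forall i, (t i <= #|class T i|)%N]]].

(** The places of an independent set with profile [t], namely [t i] numbered ones of each type [i]: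
    the index type to which [no_independent_transversal] is applied. *)
Let slot t := {i : 'I_k & 'I_(t i)}.

Let card_slot t : #|{: slot t}| = (\sum_i t i)%N.
Proof.
rewrite card_tagged sumnE big_map big_enum/=.
by apply: eq_bigr => i _; rewrite card_ord.
Qed.

Let profile_of t (Q : {set slot t}) i := #|[set j in Q | tag j == i]|.

Let card_profile_of t (Q : {set slot t}) : #|Q| = (\sum_i profile_of Q i)%N.
Proof.
rewrite -sum1_card (partition_big (fun j => tag j) xpredT)//=.
by apply: eq_bigr => i _; rewrite /profile_of -sum1_card; apply: eq_bigl => j; rewrite inE.
Qed.

Let profile_of_le t (Q : {set slot t}) i : (profile_of Q i <= t i)%N.
Proof.
have sub : [set j in Q | tag j == i] \subset
    [set Tagged (fun i => 'I_(t i)) l | l : 'I_(t i)].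
  apply/fintype.subsetP => -[i' l]; rewrite inE/= => /andP[_ /eqP ii'].
  by apply/imsetP; exists (ecast i0 'I_(t i0) ii' l) => //; case: _ / ii'.
apply: (leq_trans (subset_leq_card sub)); apply: (leq_trans (leq_imset_card _ _)).
by rewrite card_ord.
Qed.

Let sum_profile_of t (Q : {set slot t}) (F : 'I_k -> R) :
  \sum_(j in Q) F (tag j) = \sum_i (profile_of Q i)%:R * F i.
Proof.
rewrite (partition_big (fun j => tag j) xpredT)//=; apply: eq_bigr => i _.
rewrite (eq_bigr (fun=> F i)); last by move=> j /andP[_ /eqP ->].
rewrite (eq_bigl (fun j => j \in [set j in Q | tag j == i])); last by move=> j; rewrite inE.
by rewrite sumr_const mulr_natl.
Qed.

(** Each slot receives its own [m] vertices of the required type, and an independent transversal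
    realises the profile. The bound on sub-profiles is summed over all sets of slots by the binomial
    theorem: for [N] slots, [r0 * (1 + y)^N <= r0 * exp (N * y) <= r0 * e]. *)
Lemma no_profile_le (m : nat) (t : 'I_k -> nat) U (r0 y : R) :
  (0 < m)%N -> (1 < \sum_i t i)%N -> 0 <= y -> 0 < r0 -> (\sum_i t i)%:R * y <= 1 ->
  (forall i, t i * m <= #|class U i|)%N ->
  (forall r : 'I_k -> nat, (forall i, r i <= t i)%N -> (1 < \sum_i r i)%N ->
    (m%:R^-1) ^+ (\sum_i r i) *
    expR (2^-1 * \sum_i \sum_j a i j * ((r i)%:R * (r j)%:R)) <= r0 * y ^+ (\sum_i r i)) ->
  Ex q (fun h => (~~ has_profile U t h)%:R) <= expR (- (4 * (r0 * expR 1))^-1).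
Proof.
move=> m0 t1 y0 r00 ty tU rb.
have [j0 tj0] : exists i, (0 < t i)%N.
  apply/existsP; apply: contraTT t1; rewrite negb_exists => /forallP H.
  by rewrite big1// => i _; apply/eqP; have := H i; rewrite lt0n negbK.
have /card_gt0P[x0 _] : (0 < #|class U j0|)%N.
  by apply: leq_trans (tU j0); rewrite muln_gt0 tj0.
(* Slot number [l] of a type takes the run of [m] vertices starting at [l * m] in the enumeration of
   its class; [v_lt] shows that the default [x0] is never reached. *)
pose v (j : slot t) (c : 'I_m) : 'I_n :=
  nth x0 (enum (class U (tag j))) (tagged j * m + c).
have v_lt (j : slot t) (c : 'I_m) : (tagged j * m + c < size (enum (class U (tag j))))%N.
  rewrite -cardE; apply: leq_trans (tU (tag j)).
  apply: (@leq_trans ((tagged j).+1 * m)); first by rewrite mulSn addnC ltn_add2r.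
  by rewrite leq_mul2r ltn_ord orbT.
have vU j c : v j c \in class U (tag j).
  by rewrite -mem_enum mem_nth.
have v_inj j c j' c' : v j c = v j' c' -> j = j' /\ c = c'.
  move=> vv; have jj' : tag j = tag j'.
    have := vU j c; have := vU j' c'; rewrite !inE -vv => /andP[_ /eqP <-] /andP[_ /eqP <-] //.
  case: j j' jj' vv => [i l] [i' l'] /= ii'; case: _ / ii' l' => l' /eqP.
  rewrite /v/= nth_uniq ?enum_uniq//; [|exact: (v_lt (Tagged _ l))|exact: (v_lt (Tagged _ l'))].
  move=> /eqP lc.
  have cc : c = c' :> nat.
    by have := congr1 (modn^~ m) lc; rewrite !modnMDl !modn_small.
  have ll : l = l' :> nat.
    by move/eqP: lc; rewrite cc eqn_add2r eqn_pmul2r// => /eqP.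
  by split; [congr (Tagged _ _); exact: val_inj | exact: val_inj].
have tau_v j c : tau (v j c) = tag j.
  by have := vU j c; rewrite inE => /andP[_ /eqP].
pose b x y := a (tau x) (tau y).
have S1 : (1 < #|{: slot t}|)%N by rewrite card_slot.
have bv j c j' c' : b (v j c) (v j' c') = a (tag j) (tag j') by rewrite /b !tau_v.
have := @no_independent_transversal R n m (slot t) q v b
  (fun j j' => a (tag j) (tag j')) q01 (fun x y => a_ge0 _ _)
  (fun x y => aC _ _) a_q v_inj bv m0 S1.
move=> H; apply: le_trans (le_trans H _).
  apply: le_Ex => // h; rewrite ler_nat.
  case: (boolP (has_profile U t h)) => //= nh.
  rewrite lt0b; apply/forallP => f; apply: contraNN nh => fh.
  apply/existsP; exists (pick_set v f); rewrite fh/=; apply/andP; split.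
    apply/fintype.subsetP => x /imsetP[j _ ->].
    by have := vU j (f j); rewrite inE => /andP[].
  apply/forallP => i; pose mk (l : 'I_(t i)) : slot t := existT (fun i => 'I_(t i)) i l.
  have sub : [set v (mk l) (f (mk l)) | l : 'I_(t i)] \subset
      class (pick_set v f) i.
    apply/fintype.subsetP => x /imsetP[l _ ->]; rewrite inE tau_v eqxx andbT.
    by apply/imsetP; exists (mk l).
  apply: leq_trans (subset_leq_card sub).
  rewrite card_imset ?card_ord// => l l' /v_inj[/eqP + _].
  by rewrite /mk -!/(Tagged (fun i => 'I_(t i)) _) eq_Tagged => /eqP.
rewrite ler_expR lerN2 lef_pV2 ?posrE ?mulr_gt0 ?expR_gt0//; last first.
  rewrite (bigD1 [set: slot t])/=; last by rewrite cardsT.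
  rewrite ltr_wpDr//.
    by apply: sumr_ge0 => Q _; rewrite mulr_ge0 ?expR_ge0// exprn_ge0// invr_ge0.
  by rewrite mulr_gt0 ?expR_gt0// exprn_gt0// invr_gt0 ltr0n.
rewrite ler_wpM2l//.
apply: (@le_trans _ _ (\sum_(Q : {set slot t}) r0 * y ^+ #|Q|)).
  rewrite big_mkcond; apply: ler_sum => Q _; case: ifP => Q1; last first.
    by rewrite mulr_ge0 ?exprn_ge0 ?(ltW r00).
  have -> : \sum_(j in Q) \sum_(j' in Q) a (tag j) (tag j') =
      \sum_i \sum_j a i j * ((profile_of Q i)%:R * (profile_of Q j)%:R).
    rewrite (sum_profile_of Q (fun i => \sum_(j' in Q) a i (tag j'))).
    apply: eq_bigr => i _; rewrite (sum_profile_of Q (a i)) mulr_sumr.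
    by apply: eq_bigr => j _; ring.
  by rewrite card_profile_of; apply: rb; rewrite -?card_profile_of.
rewrite -mulr_sumr ler_wpM2l ?(ltW r00)//; apply: (le_trans (sum_expn_card_le _ y0)).
by rewrite ler_expR card_slot.
Qed.

End profile.

Section not_colorable.
Import mathcomp.boot.finset.
Context {R : realType} {n k : nat}.
Variables (W : R -> R -> R) (x : 'I_n -> R) (tau : 'I_n -> 'I_k).
Variables (a : 'I_k -> 'I_k -> R).
Hypothesis q01 : forall e, 0 <= edge_prob W x e <= 1.
Hypothesis a_ge0 : forall i j, 0 <= a i j.
Hypothesis aC : forall i j, a i j = a j i.
Hypothesis a_q : forall e,
  expR (- a (tau (val e).1) (tau (val e).2)) <= 1 - edge_prob W x e.

(** A set of at most one vertex spans no edge, so these profiles occur in every graph. They are set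
    apart because Janson's inequality is applied to at least two slots. *)
Lemma has_profile_small (t : 'I_k -> nat) (U : {set 'I_n}) (h : {set edge n}) :
  (\sum_i t i <= 1)%N -> (forall i, 0 < t i -> class tau U i != set0)%N ->
  has_profile tau U t h.
Proof.
move=> t1 tU.
have [/existsP[i0 ti0]|] := boolP [exists i, (0 < t i)%N]; last first.
  rewrite negb_exists => /forallP t0; apply/existsP; exists set0.
  rewrite sub0set; apply/and3P; split => //.
    by apply/fintype.subsetP => e; rewrite !inE.
  by apply/forallP => i; have := t0 i; rewrite lt0n negbK => /eqP ->.
have /set0Pn[z] := tU i0 ti0; rewrite inE => /andP[zU /eqP zi].
apply/existsP; exists [set z]; apply/and3P; split.
- by rewrite sub1set.
- apply/fintype.subsetP => e; rewrite !inE => /andP[/eqP e1 /eqP e2].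
  by have := valP e; rewrite inE e1 e2 ltnn.
apply/forallP => i; have [ii0|ii0] := eqVneq i i0.
  have -> : class tau [set z] i = [set z].
    by apply/setP => w; rewrite !inE; case: eqVneq => //= ->; rewrite zi ii0 eqxx.
  rewrite cards1; apply: leq_trans t1.
  by rewrite (bigD1 i)//= leq_addr.
move: t1; rewrite (bigD1 i0)//= (bigD1 i)//=; lia.
Qed.

(** If the colouring fails, it fails at some profile [c] with some set [U] of vertices left. Since
    [U] depends on the graph, the union bound runs over all [2 ^+ n] sets. *)
Lemma not_colorable_le (l : seq ('I_k -> nat)) (m m' : nat) (r0 y : R) :
  (0 < m)%N -> 0 <= y -> 0 < r0 ->
  (forall c, (c < size l)%N ->
    let s := nth (fun=> 0%N) l c in
    [/\ forall i, (s i * m <= m')%N, (\sum_i s i)%:R * y <= 1 &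
     forall r : 'I_k -> nat, (forall i, r i <= s i)%N -> (1 < \sum_i r i)%N ->
    (m%:R^-1) ^+ (\sum_i r i) *
    expR (2^-1 * \sum_i \sum_j a i j * ((r i)%:R * (r j)%:R)) <= r0 * y ^+ (\sum_i r i)]) ->
  (forall j, #|[set z | tau z == j]| <= \sum_(s <- l) s j)%N ->
  \sum_(g | ~~ colorable g (size l + k * m')) edge_weight W x g <=
  (size l)%:R * 2 ^+ n * expR (- (4 * (r0 * expR 1))^-1).
Proof.
move=> m0 y0 r00 lH cover.
(* A class with fewer than [m'] vertices left is asked for nothing, in accordance with
   [colorable_profiles]; the truncated profile inherits the bounds assumed for the original one. *)
pose t (c : 'I_(size l)) (U : {set 'I_n}) (i : 'I_k) :=
  if (m' <= #|class tau U i|)%N then nth (fun=> 0%N) l c i else 0%N.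
apply: (@le_trans _ _ (Ex (edge_prob W x) (fun h => \sum_(c < size l)
    \sum_(U : {set 'I_n}) (~~ has_profile tau U (t c U) h)%:R))).
  apply: sum_edge_weight_le => //.
    by move=> h; apply: sumr_ge0 => c _; apply: sumr_ge0.
  move=> g gl.
  suff /existsP[c /existsP[U cU]] : [exists c, [exists U, ~~ has_profile tau U (t c U) (edges_of g)]].
    rewrite (bigD1 c)//= (bigD1 U)//= cU -addrA lerDl addr_ge0//.
      exact: sumr_ge0.
    by apply: sumr_ge0 => c' _; apply: sumr_ge0.
  apply: contraNT gl; rewrite negb_exists => /forallP H.
  apply: (colorable_profiles (tau := tau) _ cover) => c s U cl ->.
  have := H (Ordinal cl); rewrite negb_exists => /forallP/(_ U).
  rewrite negbK => /existsP[T /and3P[TU iT /forallP tT]].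
  exists T; split => //; first by rewrite independent_edges.
  move=> j mU; have := tT j; rewrite /t/= /class ifT//.
rewrite Ex_sum//.
apply: (@le_trans _ _ (\sum_(c < size l) \sum_(U : {set 'I_n})
    expR (- (4 * (r0 * expR 1))^-1))); last first.
  set E0 := expR _; rewrite !sumr_const card_ord.
  have -> : #|{set 'I_n}| = (2 ^ n)%N.
    by rewrite -cardsT -powersetT card_powerset cardsT card_ord.
  by rewrite -mulrnA -[leLHS]mulr_natl natrM natrX [2 ^+ n * _]mulrC.
apply: ler_sum => c _; rewrite Ex_sum//; apply: ler_sum => U _.
have [sm sy rb] := lH c (ltn_ord c).
have ts i : (t c U i <= nth (fun=> 0%N) l c i)%N by rewrite /t; case: ifP.
have tU i : (t c U i * m <= #|class tau U i|)%N.
  by rewrite /t; case: ifP => // mU; apply: leq_trans mU; exact: sm.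
have [t1|t1] := leqP (\sum_i t c U i)%N 1.
  rewrite (@eq_Ex _ _ _ _ (fun=> 0)) ?Ex_cst ?expR_ge0// => h.
  rewrite has_profile_small// => i ti0; rewrite -card_gt0.
  by apply: leq_trans (tU i); rewrite muln_gt0 ti0.
apply: (no_profile_le q01 a_ge0 aC a_q m0 t1 y0 r00) => //.
  apply: le_trans sy; apply: ler_wpM2r => //; rewrite ler_nat.
  exact: leq_sum.
by move=> r rt; apply: rb => i; apply: leq_trans (rt i) (ts i).
Qed.

End not_colorable.

Section profile_weight.
Context {R : realType} {k : nat}.

(* For profiles of bounded size the factor [m^-r] wins because [r >= 2]; for
   larger ones the quadratic form is below the linear bound by a margin. *)
Lemma profile_weight_le (a : 'I_k -> 'I_k -> R) (C eta L : R) (m : nat)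
    (r : 'I_k -> nat) :
  (forall i j, a i j <= C) -> 0 < eta <= 5^-1 -> 0 <= L ->
  40 * C <= eta ^+ 2 * L ->
  expR ((1 - eta / 4) * L) <= m%:R ->
  (1 < \sum_i r i)%N ->
  2^-1 * \sum_i \sum_j a i j * ((r i)%:R * (r j)%:R) <=
    (1 - eta) * L * (\sum_i r i)%:R ->
  (m%:R^-1) ^+ (\sum_i r i) *
    expR (2^-1 * \sum_i \sum_j a i j * ((r i)%:R * (r j)%:R)) <=
  expR (- (8 / 5 * L)) * expR (- (eta / 4 * L)) ^+ (\sum_i r i).
Proof.
move=> aC /andP[eta0 eta5] L0 CL mL r1 betaL.
set s := (\sum_i r i)%N in r1 betaL *; set beta := 2^-1 * _ in betaL *.
have betaC : beta <= 2^-1 * (C * (s%:R * s%:R)).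
  rewrite ler_wpM2l// /s natr_sum big_distrlr/= mulr_sumr; apply: ler_sum => i _.
  by rewrite mulr_sumr; apply: ler_sum => j _; rewrite ler_wpM2r// mulr_ge0.
have s2 : 2 <= s%:R :> R by rewrite ler_nat.
(* Origin of [8 / 5], with [z] the size of the profile: if [eta * z < 4], the form is at most
   [L / 5], while [(1 - eta / 2) * z >= 9 / 5] because [z >= 2] and [eta <= 5^-1]. Otherwise the
   margin [eta * z * L / 2] is at least [2 * L]. *)
have key : beta <= (1 - eta / 2) * L * s%:R - 8 / 5 * L.
  move: (s%:R) betaL betaC s2 => z betaL betaC s2.
  have [es|es] := leP 4 (eta * z).
    apply: (le_trans betaL); rewrite -subr_ge0.
    have -> : (1 - eta / 2) * L * z - 8 / 5 * L - (1 - eta) * L * z =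
       (eta * z / 2 - 8 / 5) * L by field.
    by apply: mulr_ge0 => //; lra.
  apply: (le_trans betaC).
  have C0 : C * (z * z) * eta ^+ 2 <= 2 / 5 * L * eta ^+ 2.
    have ess : (eta * z) ^+ 2 <= 4 ^+ 2.
      have z0 : 0 <= z by lra.
      by apply: lerXn2r; rewrite ?nnegrE ?mulr_ge0// ltW.
    have [Cn|Cp] := leP C 0.
      apply: (@le_trans _ _ 0).
        apply: mulr_le0_ge0; last exact: sqr_ge0.
        by apply: mulr_le0_ge0 => //; exact: sqr_ge0.
      by apply: mulr_ge0; [apply: mulr_ge0 | exact: sqr_ge0].
    have -> : C * (z * z) * eta ^+ 2 = C * (eta * z) ^+ 2 by ring.
    by have := ler_wpM2l (ltW Cp) ess; lra.
  rewrite ler_pM2r ?exprn_gt0// in C0.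
  have h : 0 <= L * ((1 - eta / 2) * z - 9 / 5).
    by apply: mulr_ge0 => //; nra.
  have := h; rewrite mulrBr; lra.
have m_gt0 : 0 < m%:R :> R by apply: lt_le_trans mL; exact: expR_gt0.
apply: (@le_trans _ _ (expR (- ((1 - eta / 4) * L)) ^+ s * expR beta)).
  rewrite ler_wpM2r ?expR_ge0// lerXn2r ?nnegrE ?invr_ge0 ?expR_ge0 ?(ltW m_gt0)//.
  by rewrite expRN lef_pV2 ?posrE ?expR_gt0.
rewrite -!expRM_natl -!expRD ler_expR; lra.
Qed.

End profile_weight.

(** * Block partitions and the functionals phi and phi_star *)

Section partition.
Context {R : realType}.
Variables (W : R -> R -> R) (lo hi : R).
Hypotheses (lo_gt0 : 0 < lo) (hi_lt1 : hi < 1).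
Hypothesis W_bounds : forall x y, I01 R x -> I01 R y -> lo <= W x y <= hi.
Hypothesis W_br : block_regulated W.

Definition logw (x y : R) : R := - ln (1 - W x y).

Lemma I01_0 : I01 R 0. Proof. by rewrite /I01/= in_itv/= lexx ler01. Qed.

Lemma one_minus_W_gt0 x y : I01 R x -> I01 R y -> 0 < 1 - W x y.
Proof.
by move=> Ix Iy; have /andP[_ h] := W_bounds Ix Iy; have := hi_lt1; lra.
Qed.

Lemma logw_lower x y : I01 R x -> I01 R y -> lo <= logw x y.
Proof.
move=> Ix Iy; have /andP[h1 h2] := W_bounds Ix Iy.
have h : ln (1 - W x y) <= - W x y by apply: le_ln1Dx; have := hi_lt1; lra.
by rewrite /logw; lra.
Qed.

Lemma logw_upper x y : I01 R x -> I01 R y -> logw x y <= - ln (1 - hi).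
Proof.
move=> Ix Iy; have /andP[h1 h2] := W_bounds Ix Iy.
by rewrite /logw lerN2 ler_ln ?posrE ?one_minus_W_gt0// ?subr_gt0//; lra.
Qed.

(** From [ln (u' / u) <= u' / u - 1], where [u = 1 - W x y] is at least [1 - hi]. *)
Lemma logw_lipschitz x y x' y' : I01 R x -> I01 R y -> I01 R x' -> I01 R y' ->
  logw x y <= logw x' y' + `|W x y - W x' y'| / (1 - hi).
Proof.
move=> Ix Iy Ix' Iy'; rewrite /logw.
have /andP[_ h1] := W_bounds Ix Iy; have /andP[_ h2] := W_bounds Ix' Iy'.
set u := 1 - W x y; set u' := 1 - W x' y'.
have u0 : 0 < u by exact: one_minus_W_gt0.
have u'0 : 0 < u' by exact: one_minus_W_gt0.
rewrite -lerBlDl opprK addrC -ln_div ?posrE//.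
have -> : u' / u = 1 + (u' - u) / u by field; rewrite gt_eqF.
apply: le_trans (le_ln1Dx _) _.
  have : 0 < u' / u by rewrite divr_gt0.
  have -> : (u' - u) / u = u' / u - 1 by field; rewrite gt_eqF.
  by move=> ?; lra.
have -> : W x y - W x' y' = u' - u by rewrite /u /u'; ring.
apply: (@le_trans _ _ (`|u' - u| / u)).
  by rewrite ler_pM2r ?invr_gt0// ler_norm.
rewrite ler_wpM2l// lef_pV2 ?posrE ?subr_gt0// /u.
all: by have := hi_lt1; have /andP[_ h] := W_bounds Ix Iy; lra.
Qed.

(** [W] is nearly constant on block rectangles; [hi < 1] transfers this to [logw], and [logw >= lo]
    makes the error relative. The value at a representative point, divided by [1 + eta / 3], is then
    a lower bound on the whole rectangle, and [(1 + eta / 3)^2 <= 1 + eta]. *)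
Lemma block_partition (eta : R) : 0 < eta <= 1 ->
  exists (k : nat) (F : 'I_k -> set R) (a : 'I_k -> 'I_k -> R),
    [/\ forall i, measurable (F i), trivIset setT F, \bigcup_i F i = I01 R,
      forall i j, a i j = a j i &
      (forall i j, 0 <= a i j <= - ln (1 - hi)) /\
      forall i j x y, F i x -> F j y ->
        a i j <= logw x y <= (1 + eta) * a i j].
Proof.
move=> /andP[eta0 eta1]; have [[_ WC _] Wreg] := W_br.
have hi1 := hi_lt1; have lo0 := lo_gt0.
(* Chosen so that [2 * d / (1 - hi) = eta / 3 * lo]: [W] varies by at most [2 * d] on a block
   rectangle. *)
pose d := eta / 6 * lo * (1 - hi).
have d0 : 0 < d by rewrite /d !mulr_gt0//; lra.
have [Wd [[[_ _ Wd01] [k [F [mF tF UF cF]]]] supd]] := Wreg d d0.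
have Wd_close x y : I01 R x -> I01 R y -> `|W x y - Wd x y| <= d.
  move=> Ix Iy; apply: le_trans supd; apply: ub_le_sup.
    exists 1 => _ [s Is [t It <-]].
    have := W_bounds Is It; have := Wd01 s t Is It.
    by rewrite ler_norml; lra.
  by exists x => //; exists y.
have FI i x : F i x -> I01 R x by rewrite -UF => ?; exists i.
have osc i j x y x' y' : F i x -> F j y -> F i x' -> F j y' ->
    logw x y <= (1 + eta / 3) * logw x' y'.
  move=> Fx Fy Fx' Fy'.
  have [c Wc] := cF i j.
  have := Wd_close x y (FI i x Fx) (FI j y Fy).
  have := Wd_close x' y' (FI i x' Fx') (FI j y' Fy').
  rewrite !Wc// => h1 h2.
  have h3 : `|W x y - W x' y'| <= 2 * d.
    by move: h1 h2; rewrite !ler_norml; lra.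
  apply: le_trans (logw_lipschitz (FI _ _ Fx) (FI _ _ Fy) (FI _ _ Fx') (FI _ _ Fy')) _.
  rewrite mulrDl mul1r lerD2l.
  apply: (@le_trans _ _ (2 * d / (1 - hi))).
    by rewrite ler_pM2r// invr_gt0; lra.
  have -> : 2 * d / (1 - hi) = eta / 3 * lo by rewrite /d; field; lra.
  by rewrite ler_wpM2l ?logw_lower//; [lra | exact: FI Fx' | exact: FI Fy'].
(* An empty block is represented by 0, which keeps its coefficients within the bounds. *)
have pt i : exists p : R, I01 R p /\ (forall x, F i x -> F i p).
  have [[p Fp]|Fn] := pselect (exists p, F i p).
    by exists p; split => //; exact: FI Fp.
  by exists 0; split; [exact: I01_0|move=> x Fx; exfalso; apply: Fn; exists x].
have [p /all_and2[pI pF]] := choice pt.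
have e3 : 0 < 1 + eta / 3 by lra.
exists k, F, (fun i j => logw (p i) (p j) / (1 + eta / 3)); split => //.
- by move=> i j; rewrite /logw WC.
- split => [i j|i j x y Fx Fy].
    have l0 := logw_lower (pI i) (pI j); have l1 := logw_upper (pI i) (pI j).
    rewrite divr_ge0 ?(ltW e3)//=; last by lra.
    by rewrite ler_pdivrMr//; nra.
  have pFi := pF i x Fx; have pFj := pF j y Fy.
  have h1 := osc i j _ _ _ _ Fx Fy pFi pFj.
  have h2 := osc i j _ _ _ _ pFi pFj Fx Fy.
  rewrite ler_pdivrMr// mulrC h2/= mulrA ler_pdivlMr//.
  have l0 := logw_lower (pI i) (pI j).
  have h3 := ler_wpM2r (ltW e3) h1.
  apply: (le_trans h3); nra.
Qed.

End partition.

(** * Iterated integrals of step kernels *)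

Section integral_mono.
Import HBNNSimple.
Local Open Scope ereal_scope.
Context d (T : measurableType d) (R : realType) (mu : {measure set T -> \bar R}).

(** The integral of a nonnegative function is a supremum over the simple functions below it, hence
    monotone for arbitrary functions. The iterated integrals of [phi] are compared through this, so
    the measurability of their inner integrals never arises. *)
Lemma le_integral_nonmeasurable (D : set T) (f g : T -> \bar R) :
  (forall x, D x -> 0 <= f x <= g x) ->
  \int[mu]_(x in D) f x <= \int[mu]_(x in D) g x.
Proof.
move=> fg; rewrite !ge0_integralE; last 2 first.
- by move=> x /fg /andP[f0]; exact: le_trans.
- by move=> x /fg /andP[].
apply: ereal_sup_le => _ [h /= hf <-].
exists h => //= x; apply: (le_trans (hf x)); rewrite /patch.
by case: ifPn => //; rewrite inE => /fg /andP[].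
Qed.

End integral_mono.

Section step.
Context {R : realType} {k : nat}.
Variables (F : 'I_k -> set R) (mu : probability (measurableTypeR R) R).
Hypothesis mF : forall i, measurable (F i : set (measurableTypeR R)).
Hypothesis tF : trivIset setT F.
Hypothesis UF : \bigcup_i F i = I01 R.

Let mass (S : set (measurableTypeR R)) i : R := fine (mu (F i `&` S)).

Lemma probability_fineK (A : set (measurableTypeR R)) : measurable A -> (fine (mu A))%:E = mu A.
Proof. by move=> mA; rewrite fineK// fin_num_measure. Qed.

Lemma block_exists x : I01 R x -> exists i, F i x.
Proof. by rewrite -UF => -[i _ Fx]; exists i. Qed.

Lemma block_unique i j x : F i x -> F j x -> i = j.
Proof. by move=> Fi Fj; apply: (tF I I); exists x. Qed.

Lemma stepE (d : 'I_k -> R) i x : F i x -> \sum_j d j * \1_(F j) x = d i.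
Proof.
move=> Fx; rewrite (bigD1 i)//= indicE mem_set// mulr1 big1 ?addr0// => j ji.
rewrite indicE memNset ?mulr0// => Fj.
by rewrite (block_unique Fj Fx) eqxx in ji.
Qed.

Lemma integral_step (S : set (measurableTypeR R)) (d : 'I_k -> R) : measurable S ->
  (forall i, 0 <= d i) ->
  (\int[mu]_(x in S) (\sum_i d i * \1_(F i) x)%:E)%E =
  (\sum_i d i * mass S i)%:E.
Proof.
move=> mS d0; under eq_integral do rewrite -sumEFin.
rewrite ge0_integral_sum//; last 2 first.
- by move=> i; apply/measurable_EFinP/measurable_funM => //.
- by move=> i x _; rewrite lee_fin mulr_ge0.
rewrite -sumEFin; apply: eq_bigr => i _.
under eq_integral do rewrite EFinM.
rewrite ge0_integralZl_EFin//; last by apply/measurable_EFinP; apply: measurable_indic; exact: mF.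
by rewrite integral_indic// EFinM /mass probability_fineK//; exact: measurableI.
Qed.

Let step (c : 'I_k -> 'I_k -> R) x y := \sum_i (\sum_j c i j * \1_(F j) y) * \1_(F i) x.

Let step_val c i j x y : F i x -> F j y -> step c x y = c i j.
Proof. by move=> Fx Fy; rewrite /step (stepE _ Fx) (stepE _ Fy). Qed.

Let step_ge0 c x y : (forall i j, 0 <= c i j) -> 0 <= step c x y.
Proof. by move=> c0; apply: sumr_ge0 => i _; rewrite mulr_ge0// sumr_ge0// => j _; rewrite mulr_ge0. Qed.

Let integral_step2 (S : set (measurableTypeR R)) c : measurable S -> (forall i j, 0 <= c i j) ->
  (\int[mu]_(x in S) \int[mu]_(y in S) (step c x y)%:E)%E =
  (\sum_i \sum_j c i j * (mass S i * mass S j))%:E.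
Proof.
move=> mS c0.
have m0 i : 0 <= mass S i by rewrite fine_ge0.
transitivity (\int[mu]_(x in S) (\sum_j (\sum_i c i j * \1_(F i) x) * mass S j)%:E)%E.
  apply: eq_integral => x _; rewrite -integral_step//; last first.
    by move=> i; rewrite sumr_ge0// => j _; rewrite mulr_ge0.
  apply: eq_integral => y _; congr (_%:E); rewrite /step.
  under eq_bigr do rewrite mulr_suml.
  rewrite exchange_big/=; apply: eq_bigr => j _; rewrite mulr_suml.
  by apply: eq_bigr => i _; ring.
transitivity (\int[mu]_(x in S) (\sum_i (\sum_j c i j * mass S j) * \1_(F i) x)%:E)%E.
  apply: eq_integral => x _; congr (_%:E).
  under eq_bigr do rewrite mulr_suml.
  rewrite exchange_big/=; apply: eq_bigr => j _; rewrite mulr_suml.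
  by apply: eq_bigr => i _; ring.
rewrite integral_step//; last by move=> i; rewrite sumr_ge0// => j _; rewrite mulr_ge0.
congr (_%:E); apply: eq_bigr => i _; rewrite mulr_suml.
by apply: eq_bigr => j _; ring.
Qed.

Lemma iterated_integral_le_step (S : set (measurableTypeR R)) (f : R -> R -> \bar R)
    (c : 'I_k -> 'I_k -> R) : measurable S -> S `<=` I01 R ->
  (forall i j, 0 <= c i j) ->
  (forall i j x y, F i x -> F j y -> 0%E <= f x y <= (c i j)%:E)%E ->
  (\int[mu]_(x in S) \int[mu]_(y in S) f x y <=
  (\sum_i \sum_j c i j * (mass S i * mass S j))%:E)%E.
Proof.
move=> mS SI c0 fc; rewrite -integral_step2//.
have fs x y : S x -> S y -> (0 <= f x y <= (step c x y)%:E)%E.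
  move=> Sx Sy; have [i Fx] := block_exists (SI x Sx).
  have [j Fy] := block_exists (SI y Sy).
  by rewrite (step_val c Fx Fy); exact: fc Fx Fy.
apply: le_integral_nonmeasurable => x Sx; apply/andP; split.
  by apply: integral_ge0 => y Sy; have /andP[] := fs x y Sx Sy.
by apply: le_integral_nonmeasurable => y Sy; exact: fs.
Qed.

Lemma iterated_integral_ge_step (S : set (measurableTypeR R)) (f : R -> R -> \bar R)
    (c : 'I_k -> 'I_k -> R) : measurable S -> S `<=` I01 R ->
  (forall i j, 0 <= c i j) ->
  (forall i j x y, F i x -> F j y -> (c i j)%:E <= f x y)%E ->
  ((\sum_i \sum_j c i j * (mass S i * mass S j))%:E <=
  \int[mu]_(x in S) \int[mu]_(y in S) f x y)%E.
Proof.
move=> mS SI c0 fc; rewrite -integral_step2//.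
have fs x y : S x -> S y -> ((step c x y)%:E <= f x y)%E.
  move=> Sx Sy; have [i Fx] := block_exists (SI x Sx).
  have [j Fy] := block_exists (SI y Sy).
  by rewrite (step_val c Fx Fy); exact: fc Fx Fy.
apply: le_integral_nonmeasurable => x Sx; apply/andP; split.
  by apply: integral_ge0 => y Sy; rewrite lee_fin step_ge0.
by apply: le_integral_nonmeasurable => y Sy; rewrite lee_fin step_ge0//= fs.
Qed.

Lemma sum_mass (S : set (measurableTypeR R)) : measurable S -> S `<=` I01 R ->
  (\sum_i mass S i) = fine (mu S).
Proof.
move=> mS SI; have := integral_step (d := fun=> 1) mS (fun=> ler01).
under [in X in _ = X -> _]eq_bigr do rewrite mul1r.
rewrite (eq_integral (cst 1%E)); first by rewrite integral_cst// mul1e => ->.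
move=> x; rewrite inE => /SI /block_exists[i Fx]; rewrite (stepE _ Fx)//.
Qed.

End step.

(** * Bounds on [phi] through block masses *)

Section phi_bounds.
Context {R : realType}.
Variables (W : R -> R -> R) (lo hi : R).
Hypotheses (lo_gt0 : 0 < lo) (hi_lt1 : hi < 1).
Hypothesis W_bounds : forall x y, I01 R x -> I01 R y -> lo <= W x y <= hi.
Variable mu : pprobability (measurableTypeR R) R.

Lemma lne_logw x y : I01 R x -> I01 R y ->
  lne ((1 - W x y)%R%:E^-1)%E = (logw W x y)%:E.
Proof.
move=> Ix Iy; have W1 : 0 < 1 - W x y by exact: (one_minus_W_gt0 hi_lt1 W_bounds).
by rewrite inver gt_eqF// lne_EFin ?invr_gt0// lnV.
Qed.

Lemma logw_ge0 x y : I01 R x -> I01 R y -> 0 <= logw W x y.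
Proof.
move=> Ix Iy; apply: le_trans (logw_lower hi_lt1 W_bounds Ix Iy).
exact: ltW.
Qed.

Section with_partition.
Variables (k : nat) (F : 'I_k -> set R) (c : 'I_k -> 'I_k -> R).
Hypothesis mF : forall i, measurable (F i : set (measurableTypeR R)).
Hypothesis tF : trivIset setT F.
Hypothesis UF : \bigcup_i F i = I01 R.
Hypothesis c_ge0 : forall i j, 0 <= c i j.

Let block_I01 i x : F i x -> I01 R x.
Proof. by move=> Fx; rewrite -UF; exists i. Qed.

(** The set [S] enters only through the masses of its intersections with the blocks, a point [v] of
    the box of block masses. *)
Lemma phi_le (B : R) :
  (forall i j x y, F i x -> F j y -> logw W x y <= c i j) ->
  (forall v : 'I_k -> R, (forall i, 0 <= v i <= fine (mu (F i))) ->
    \sum_i \sum_j c i j * (v i * v j) <= B * \sum_i v i) ->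
  (phi mu W <= B%:E)%E.
Proof.
move=> Wc H; apply: ge_ereal_sup => _ [S [mS SI S0] <-].
have m0 : 0 < fine (mu S) by rewrite fine_gt0// S0 (le_lt_trans (probability_le1 mu mS)) ?ltry.
rewrite -(probability_fineK mu mS) inver gt_eqF//.
rewrite muleC lee_pdivrMr//.
apply: le_trans (iterated_integral_le_step mu mF tF UF mS SI c_ge0 _) _.
  move=> i j x y Fx Fy; rewrite lne_logw; [|exact: block_I01 Fx|exact: block_I01 Fy].
  by rewrite !lee_fin Wc// andbT logw_ge0//; [exact: block_I01 Fx|exact: block_I01 Fy].
rewrite -EFinM lee_fin -(sum_mass mu mF tF UF mS SI); apply: H => i.
rewrite fine_ge0//= fine_le ?fin_num_measure//; first exact: measurableI.
by apply: le_measure; rewrite ?inE//; exact: measurableI.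
Qed.

(** Only unions of blocks are tested as [S], which are the corners of the box;
    [quadratic_le_linear_on_box] recovers the rest. If the union has mass 0, both sides vanish. *)
Lemma phi_ge (f : R) (J : {set 'I_k}) :
  (forall i j x y, F i x -> F j y -> c i j <= logw W x y) ->
  phi mu W = f%:E ->
  \sum_(i in J) \sum_(j in J) c i j * (fine (mu (F i)) * fine (mu (F j))) <=
  f * \sum_(i in J) fine (mu (F i)).
Proof.
move=> Wc phif; pose S : set (measurableTypeR R) := \bigcup_(i in [set` J]) F i.
have mS : measurable S by apply: fin_bigcup_measurable.
have SI : S `<=` I01 R by move=> x [i _]; exact: block_I01.
have massE i : fine (mu (F i `&` S)) = if i \in J then fine (mu (F i)) else 0.
  case: ifPn => iJ.
    by congr (fine (mu _)); apply/setIidPl => x Fx; exists i.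
  rewrite (_ : F i `&` S = set0) ?measure0//; apply/seteqP; split => // x [Fx [j jJ Fjx]].
  by move: iJ; rewrite (block_unique tF Fx Fjx) => /negP; apply.
have I0 := iterated_integral_ge_step mu mF tF UF mS SI c_ge0
  (f := fun x y => lne ((1 - W x y)%R%:E^-1)%E).
have {}I0 : ((\sum_(i in J) \sum_(j in J) c i j * (fine (mu (F i)) * fine (mu (F j))))%:E <=
    \int[mu]_(x in S) \int[mu]_(y in S) lne ((1 - W x y)%R%:E^-1))%E.
  apply: le_trans (I0 _); last first.
    move=> i j x y Fx Fy; rewrite lne_logw; [|exact: block_I01 Fx|exact: block_I01 Fy].
    by rewrite lee_fin Wc.
  rewrite lee_fin le_eqVlt; apply/orP; left; apply/eqP.
  rewrite big_mkcond; apply: eq_bigr => i _.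
  rewrite massE; case: ifP => _; last by rewrite big1// => j _; rewrite mul0r mulr0.
  rewrite big_mkcond; apply: eq_bigr => j _; rewrite massE.
  by case: ifP; rewrite ?mulr0.
have sumS : \sum_(i in J) fine (mu (F i)) = fine (mu S).
  rewrite -(sum_mass mu mF tF UF mS SI) big_mkcond.
  by apply: eq_bigr => i _; rewrite massE.
rewrite sumS; have [m0|m0] := ltP 0 (fine (mu S)).
  have S0 : (0 < mu S)%E by rewrite -(probability_fineK mu mS) lte_fin.
  have : ((mu S)^-1 * \int[mu]_(x in S) \int[mu]_(y in S) lne ((1 - W x y)%R%:E^-1) <= f%:E)%E.
    by rewrite -phif; apply: ereal_sup_ubound; exists S.
  rewrite -(probability_fineK mu mS) inver gt_eqF// muleC lee_pdivrMr// -EFinM => I1.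
  by have := le_trans I0 I1; rewrite lee_fin.
have m00 : fine (mu S) = 0 by apply/eqP; rewrite eq_le m0 fine_ge0.
have z i : i \in J -> fine (mu (F i)) = 0.
  have := sumS; rewrite m00 => /eqP; rewrite psumr_eq0; last by move=> j _; rewrite fine_ge0.
  by move=> /allP/(_ i (mem_index_enum i))/implyP h /h /eqP.
rewrite m00 mulr0 big1// => i iJ; rewrite big1// => j jJ.
by rewrite (z i iJ) mul0r mulr0.
Qed.

End with_partition.

Let F1 := (fun _ : 'I_1 => I01 R).
Let mF1 i : measurable (F1 i : set (measurableTypeR R)).
Proof. exact: measurable_itv. Qed.
Let tF1 : trivIset setT F1.
Proof. by move=> i j _ _ _; rewrite (ord1 i) (ord1 j). Qed.
Let UF1 : \bigcup_i F1 i = I01 R.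
Proof. by apply/seteqP; split => [x [i _]//|x Ix]; exists ord0. Qed.

Lemma phi_upper : (phi mu W <= (- ln (1 - hi))%:E)%E.
Proof.
have C0 : 0 <= - ln (1 - hi).
  apply: le_trans (logw_upper hi_lt1 W_bounds I01_0 I01_0).
  exact: logw_ge0 I01_0 I01_0.
apply: (@phi_le _ F1 (fun _ _ => - ln (1 - hi)) mF1 tF1 UF1) => //.
  by move=> i j x y; exact: (logw_upper hi_lt1 W_bounds).
move=> v v01; rewrite !big_ord1 ler_wpM2l//.
have /andP[v0 v1] := v01 ord0.
rewrite ler_piMr//; apply: (le_trans v1).
by rewrite -lee_fin (probability_fineK mu (mF1 _)) probability_le1//; exact: mF1.
Qed.

(** A measure without mass on the unit interval has [phi] equal to [-oo], the supremum being over
    the empty set; the hypothesis excludes this. *)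
Lemma phi_fin : (0 <= phi mu W)%E -> phi mu W = (fine (phi mu W))%:E.
Proof.
move=> p0; rewrite fineK// ge0_fin_numE//.
exact: le_lt_trans phi_upper (ltry _).
Qed.

Lemma phi_lower : prob01 mu -> (lo%:E <= phi mu W)%E.
Proof.
move=> mu1.
have p0 : (0 <= phi mu W)%E.
  apply: (@le_trans _ _ ((mu (I01 R))^-1 *
      \int[mu]_(x in I01 R) \int[mu]_(y in I01 R) lne ((1 - W x y)%R%:E^-1))%E); last first.
    apply: ereal_sup_ubound; exists (I01 R) => //; split => //.
      exact: (mF1 ord0).
    by rewrite mu1.
  rewrite mu1 inve1 mul1e; apply: integral_ge0 => x Ix; apply: integral_ge0 => y Iy.
  by rewrite lne_logw// lee_fin logw_ge0.
have := @phi_ge _ F1 (fun _ _ => lo) mF1 tF1 UF1 (fun _ _ => ltW lo_gt0)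
  (fine (phi mu W)) [set ord0]%SET.
move=> /(_ (fun i j => logw_lower hi_lt1 W_bounds) (phi_fin p0)).
rewrite (phi_fin p0) lee_fin /=.
rewrite !big_set1.
by rewrite /F1 mu1/= !mulr1.
Qed.

End phi_bounds.

(** * Families of measures averaging to Lebesgue measure *)

Section phi_star.
Context {R : realType}.
Variables (W : R -> R -> R) (lo hi : R).
Hypotheses (lo_gt0 : 0 < lo) (hi_lt1 : hi < 1).
Hypothesis W_bounds : forall x y, I01 R x -> I01 R y -> lo <= W x y <= hi.
Local Notation PR := (pprobability (measurableTypeR R) R).

Definition lambda_family (I : finType) (mu : I -> PR) (alpha : I -> R) :=
  [/\ forall i, prob01 (mu i), forall i, 0 <= alpha i, \sum_i alpha i = 1 &
    forall A : set (measurableTypeR R), measurable A ->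
      \sum_i alpha i * fine (mu i A) = fine (lambda01 R A)].

Let phi_fine (mu : PR) : prob01 mu -> phi mu W = (fine (phi mu W))%:E.
Proof.
move=> mu1; apply: (phi_fin lo_gt0 hi_lt1 W_bounds).
by apply: le_trans (phi_lower lo_gt0 hi_lt1 W_bounds mu1); rewrite lee_fin ltW.
Qed.

(** The support in [in_C_lambda] is a set, so members of the family that coincide as measures are
    merged and their weights added. *)
Lemma phi_star_le_family (I : finType) (mu : I -> PR) (alpha : I -> R) :
  lambda_family mu alpha ->
  (phi_star W <= (\sum_i alpha i * fine (phi (mu i) W))%:E)%E.
Proof.
move=> [mu1 a0 a1 al].
pose M := [fset mu i | i in I]%fset.
pose alpha' (m : M) := \sum_(i | mu i == val m) alpha i.
have muM i : mu i \in M by apply/imfsetP; exists i.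
have sumM (G : PR -> R) : \sum_(m : M) alpha' m * G (val m) = \sum_i alpha i * G (mu i).
  rewrite (partition_big (fun i => [` muM i]%fset) xpredT)//=.
  apply: eq_bigr => m _; rewrite /alpha' mulr_suml.
  by apply: eq_bigr => i /eqP ->.
have sum1 : \sum_(m : M) alpha' m = 1.
  by rewrite -a1; have := sumM (fun=> 1); under eq_bigr do rewrite mulr1;
    under [in RHS]eq_bigr do rewrite mulr1.
have a'0 m : 0 <= alpha' m by apply: sumr_ge0.
have M1 (m : M) : prob01 (val m).
  by have /imfsetP[i _ ->] := valP m; exact: mu1.
apply: ereal_inf_lbound; exists M, alpha'; split; last first.
  rewrite -(sumM (fun m => fine (phi m W))) -sumEFin; apply: eq_bigr => m _.
  by rewrite EFinM -phi_fine.
split => //.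
- move=> m; rewrite a'0/= -sum1 (bigD1 m)//= lerDl.
  by apply: sumr_ge0.
- move=> A mA; transitivity (\sum_(m : M) (alpha' m * fine (val m A))%:E)%E.
    apply: eq_bigr => m _; rewrite EFinM fineK//.
    exact: (fin_num_measure (val m : probability _ R)).
  rewrite sumEFin (sumM (fun m => fine (m A))) al// fineK//.
  exact: fin_num_measure.
Qed.

Lemma phi_star_le_upper : (phi_star W <= (- ln (1 - hi))%:E)%E.
Proof.
have l01 : prob01 (lambda01 R).
  rewrite /prob01 /= /uniform_prob.
  exact: integral_uniform_pdf1.
have fam : lambda_family (fun _ : 'I_1 => lambda01 R : PR) (fun=> 1).
  split => //; first by rewrite big_ord1.
  by move=> A mA; rewrite big_ord1 mul1r.
apply: le_trans (phi_star_le_family fam) _.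
rewrite big_ord1 mul1r -phi_fine//.
exact: (phi_upper lo_gt0 hi_lt1 W_bounds).
Qed.

Lemma phi_star_ge_lower : (lo%:E <= phi_star W)%E.
Proof.
apply: le_ereal_inf_tmp => _ [M [alpha [[M1 a01 a1 al] ->]]].
apply: (@le_trans _ _ (\sum_(mu : M) (alpha mu * lo)%:E)%E).
  by rewrite sumEFin -mulr_suml a1 mul1r.
apply: lee_sum => m _; rewrite EFinM; apply: lee_wpmul2l.
  by rewrite lee_fin; have /andP[] := a01 m.
exact: (phi_lower lo_gt0 hi_lt1 W_bounds (M1 m)).
Qed.

Lemma phi_star_fin : exists2 f : R, lo <= f & phi_star W = f%:E.
Proof.
exists (fine (phi_star W)); last first.
  rewrite fineK// fin_real//; apply/andP; split.
    exact: lt_le_trans (ltNyr _) phi_star_ge_lower.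
  exact: le_lt_trans phi_star_le_upper (ltry _).
rewrite -lee_fin fineK ?phi_star_ge_lower// fin_real//; apply/andP; split.
  exact: lt_le_trans (ltNyr _) phi_star_ge_lower.
exact: le_lt_trans phi_star_le_upper (ltry _).
Qed.

Lemma phi_star_near_optimal (f eps : R) : phi_star W = f%:E -> 0 < eps ->
  exists (I : finType) (mu : I -> PR) (alpha : I -> R),
    lambda_family mu alpha /\ \sum_i alpha i * fine (phi (mu i) W) <= f + eps.
Proof.
move=> phif e0.
have : (phi_star W < (f + eps)%:E)%E by rewrite phif lte_fin ltrDl.
move=> /ereal_inf_lt[_ [M [alpha [[M1 a01 a1 al] ->]]] lt].
exists M, (fun m => val m), alpha; split; first split => //.
- by move=> m; have /andP[] := a01 m.
- move=> A mA; apply: EFin_inj; rewrite -sumEFin [RHS]fineK//; last exact: fin_num_measure.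
  rewrite -al//; apply: eq_bigr => m _; rewrite EFinM fineK//.
  exact: (fin_num_measure (val m : probability _ R)).
rewrite -lee_fin -sumEFin; apply: le_trans (ltW lt); rewrite le_eqVlt; apply/orP; left.
by apply/eqP/eq_bigr => m _; rewrite EFinM -phi_fine.
Qed.

End phi_star.

(** * Competitors obtained by splitting the blocks *)

Section phi_star_split.
Context {R : realType}.
Variables (W : R -> R -> R) (lo hi : R).
Hypotheses (lo_gt0 : 0 < lo) (hi_lt1 : hi < 1).
Hypothesis W_bounds : forall x y, I01 R x -> I01 R y -> lo <= W x y <= hi.
Variables (k : nat) (F : 'I_k -> set R) (c : 'I_k -> 'I_k -> R).
Hypothesis mF : forall i, measurable (F i : set (measurableTypeR R)).
Hypothesis tF : trivIset setT F.
Hypothesis UF : \bigcup_i F i = I01 R.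
Hypothesis c_ge0 : forall i j, 0 <= c i j.
Hypothesis Wc : forall i j x y, F i x -> F j y -> logw W x y <= c i j.
Local Notation PR := (pprobability (measurableTypeR R) R).

Let p i : R := fine (lambda01 R (F i)).

Let F_I01 i : F i `<=` I01 R.
Proof. by move=> x Fx; rewrite -UF; exists i. Qed.

Let mI01 : measurable (I01 R : set (measurableTypeR R)).
Proof. exact: measurable_itv. Qed.

Let mass_le i (A : set (measurableTypeR R)) : measurable A ->
  fine (lambda01 R (F i `&` A)) <= p i.
Proof.
move=> mA; rewrite fine_le ?fin_num_measure//; first exact: measurableI.
by apply: le_measure; rewrite ?inE//; exact: measurableI.
Qed.

Let mass_eq0 i (A : set (measurableTypeR R)) : measurable A -> p i = 0 ->
  fine (lambda01 R (F i `&` A)) = 0.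
Proof.
move=> mA pi0; have := mass_le i mA; rewrite pi0 => h.
by apply/eqP; rewrite eq_le h fine_ge0.
Qed.

Lemma lambda01_I01 : lambda01 R (I01 R) = 1%E.
Proof. exact: integral_uniform_pdf1. Qed.

Lemma lambda01_blocks (A : set (measurableTypeR R)) : measurable A ->
  fine (lambda01 R A) = \sum_i fine (lambda01 R (F i `&` A)).
Proof.
move=> mA; have mAI : measurable (A `&` I01 R) by exact: measurableI.
transitivity (fine (lambda01 R (A `&` I01 R))).
  congr fine; rewrite -[in LHS](setIT A) -(setvU (I01 R)) setIUr measureU//.
  - rewrite [X in (X + _)%E](_ : _ = 0%E) ?add0e//.
    apply/eqP; rewrite eq_le measure_ge0 andbT.
    apply: (@le_trans _ _ (lambda01 R (~` I01 R))).
      by apply: le_measure; rewrite ?inE//; [apply: measurableI => //|]; exact: measurableC.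
    by rewrite probability_setC// lambda01_I01 subee.
  - by apply: measurableI => //; exact: measurableC.
  - by rewrite setIACA setICl setI0.
rewrite -(sum_mass (lambda01 R) mF tF UF mAI); last by move=> x [].
apply: eq_bigr => i _; congr (fine (lambda01 R _)).
rewrite setIA; apply/setIidPl => x [Fx _]; exact: F_I01 Fx.
Qed.

Lemma sum_lambda01_blocks : \sum_i p i = 1.
Proof.
have := lambda01_blocks (A := setT) measurableT; rewrite probability_setT/= => ->.
by apply: eq_bigr => i _; rewrite setIT.
Qed.

Section mixture.
Variable u : 'I_k -> R.
Hypothesis u_ge0 : forall i, 0 <= u i.

(** Lebesgue measure multiplied by [u i] on the block [F i]. [msum] is indexed by naturals, hence
    the [insub]. *)
Let mixture_term (i : nat) : {measure set (measurableTypeR R) -> \bar R} :=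
  if insub i is Some o
  then mscale (NngNum (u_ge0 o)) (mrestr (lambda01 R) (mF o)) else mzero.

Definition mixture : {measure set (measurableTypeR R) -> \bar R} := msum mixture_term k.

(* The default [lambda01 R] of [mnormalize] is used only when [mixture] vanishes,
   in which case its weight below is 0. *)
Definition mixture_prob : PR := mnormalize mixture (lambda01 R).

Let z := \sum_i u i * p i.

Lemma mixtureE (A : set (measurableTypeR R)) : measurable A ->
  mixture A = (\sum_i u i * fine (lambda01 R (F i `&` A)))%:E.
Proof.
move=> mA; rewrite /mixture /= /msum -sumEFin; apply: eq_bigr => i _.
rewrite /mixture_term valK /= /mscale/= /mrestr setIC EFinM fineK//.
by apply: fin_num_measure; exact: measurableI.
Qed.

Lemma mixture_setT : mixture setT = z%:E.
Proof. by rewrite mixtureE//; under eq_bigr do rewrite setIT. Qed.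

(** Keeping the factor [z] on the left makes the identity hold also for [z = 0], where both sides
    vanish. *)
Lemma mixture_prob_mass (A : set (measurableTypeR R)) : measurable A ->
  z * fine (mixture_prob A) = \sum_i u i * fine (lambda01 R (F i `&` A)).
Proof.
move=> mA; have [z0|z0] := eqVneq z 0.
  rewrite z0 mul0r; apply/esym/eqP; rewrite psumr_eq0; last first.
    by move=> i _; rewrite mulr_ge0// fine_ge0.
  move/eqP: z0; rewrite psumr_eq0; last by move=> i _; rewrite mulr_ge0// fine_ge0.
  move=> /allP z0; apply/allP => i ii; apply/implyP => _.
  have := z0 i ii; rewrite /= !mulf_eq0 => /orP[->//|/eqP pi0]; apply/orP; right.
  by rewrite mass_eq0.
rewrite /mixture_prob/= /mnormalize mixture_setT eqe (negbTE z0)/=.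
by rewrite mixtureE// -EFinM/= mulrCA divff// mulr1.
Qed.

Lemma mixture_prob01 : prob01 mixture_prob.
Proof.
rewrite /prob01 /mixture_prob/= /mnormalize mixture_setT eqe.
have [z0|z0] /= := eqVneq z 0; first exact: lambda01_I01.
rewrite mixtureE// -EFinM (_ : \sum_i _ = z) ?divff//.
by apply: eq_bigr => i _; rewrite (_ : F i `&` I01 R = F i) //; apply/setIidPl; exact: F_I01.
Qed.

(** Normalising divides the box by [z], and by homogeneity the ratio of the quadratic to the linear
    form becomes at most [B / z]. Weighted by [z], every share costs at most [B], whatever its
    size. *)
Lemma mixture_phi_le (B : R) : 0 <= B ->
  (forall v : 'I_k -> R, (forall i, 0 <= v i <= u i * p i) ->
     \sum_i \sum_j c i j * (v i * v j) <= B * \sum_i v i) ->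
  z * fine (phi mixture_prob W) <= B.
Proof.
move=> B0 H; have z0 : 0 <= z by apply: sumr_ge0 => i _; rewrite mulr_ge0// fine_ge0.
have [->|zn0] := eqVneq z 0; first by rewrite mul0r.
have z_gt0 : 0 < z by rewrite lt0r zn0.
rewrite mulrC -ler_pdivlMr// -lee_fin.
have ph0 : (0 <= phi mixture_prob W)%E.
  by apply: le_trans (phi_lower lo_gt0 hi_lt1 W_bounds mixture_prob01); rewrite lee_fin ltW.
rewrite -(phi_fin lo_gt0 hi_lt1 W_bounds)//.
apply: (phi_le lo_gt0 hi_lt1 W_bounds mF tF UF c_ge0 Wc) => v v01.
have := H (fun i => z * v i).
have zv i : 0 <= z * v i <= u i * p i.
  have /andP[v0 v1] := v01 i; rewrite mulr_ge0//=.
  have := ler_wpM2l z0 v1; rewrite mixture_prob_mass; last exact: mF.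
  move=> /le_trans; apply; rewrite (bigD1 i)//= setIid big1 ?addr0// => j ji.
  rewrite (_ : F j `&` F i = set0) ?measure0 ?mulr0//.
  apply/seteqP; split => // x [Fj Fi].
  by rewrite (block_unique tF Fj Fi) eqxx in ji.
move=> /(_ zv).
rewrite quadratic_scale -mulr_sumr.
rewrite [B * _]mulrCA ler_pM2l// => h.
by rewrite mulrAC ler_pdivlMr// mulrC.
Qed.

End mixture.

(* [u j i] is the share of the block [F i] given to the [j]-th measure. *)
Lemma phi_star_le_split (m : nat) (u : 'I_m -> 'I_k -> R) (B : R) : 0 <= B ->
  (forall j i, 0 <= u j i) ->
  (forall i, 0 < p i -> \sum_j u j i = 1) ->
  (forall j (v : 'I_k -> R), (forall i, 0 <= v i <= u j i * p i) ->
     \sum_i \sum_j c i j * (v i * v j) <= B * \sum_i v i) ->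
  (phi_star W <= (m%:R * B)%:E)%E.
Proof.
move=> B0 u0 u1 H.
have up i : (\sum_j u j i) * p i = p i.
  have [->|p0] := eqVneq (p i) 0; first by rewrite mulr0.
  by rewrite u1 ?mul1r// lt0r p0 fine_ge0.
pose z j := \sum_i u j i * p i.
have fam : lambda_family (fun j => mixture_prob (u0 j)) z.
  split.
  - by move=> j; exact: mixture_prob01.
  - by move=> j; apply: sumr_ge0 => i _; rewrite mulr_ge0// fine_ge0.
  - rewrite /z exchange_big/=; under eq_bigr do rewrite -mulr_suml up.
    exact: sum_lambda01_blocks.
  - move=> A mA; rewrite (eq_bigr _ (fun j _ => mixture_prob_mass (u0 j) mA)).
    rewrite exchange_big/= lambda01_blocks//; apply: eq_bigr => i _.
    rewrite -mulr_suml; have [p0|p0] := eqVneq (p i) 0; last first.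
      by rewrite u1 ?mul1r// lt0r p0 fine_ge0.
    suff -> : fine (lambda01 R (F i `&` A)) = 0 by rewrite mulr0.
    exact: mass_eq0.
apply: le_trans (phi_star_le_family lo_gt0 hi_lt1 W_bounds fam) _.
rewrite lee_fin; apply: (@le_trans _ _ (\sum_(j < m) B)).
  by apply: ler_sum => j _; exact: (mixture_phi_le (u0 j) B0 (H j)).
by rewrite sumr_const card_ord mulr_natl.
Qed.

End phi_star_split.

(** * Types of the sampled vertices *)

Section type_concentration.
Import mathcomp.boot.finset.
Context {R : realType} {n k : nat}.
Variable p : 'I_k -> R.
Hypothesis p_ge0 : forall i, 0 <= p i.
Hypothesis sum_p : \sum_i p i = 1.
Implicit Types (tau : {ffun 'I_n -> 'I_k}).

Definition count_type tau i : R := #|[set x | tau x == i]|%:R.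

Let weight tau : R := \prod_x p (tau x).

Let weight_ge0 tau : 0 <= weight tau.
Proof. by apply: prodr_ge0. Qed.

Lemma sum_weight : \sum_tau weight tau = 1.
Proof.
by rewrite /weight -(bigA_distr_bigA (fun _ i => p i)) big1.
Qed.

Lemma expR_le_quadratic (t : R) : t <= 2^-1 -> expR t <= 1 + t + 2 * t ^+ 2.
Proof.
move=> t2; have h : 1 - t <= expR (- t) by exact: expR_ge1Dx.
have t1 : 0 < 1 - t by lra.
rewrite -[t in expR t]opprK expRN.
apply: (@le_trans _ _ (1 - t)^-1); first by rewrite lef_pV2 ?posrE// expR_gt0.
rewrite -[leLHS]mul1r ler_pdivrMr//.
have -> : (1 + t + 2 * t ^+ 2) * (1 - t) = 1 + t ^+ 2 * (1 - 2 * t) by ring.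
by rewrite lerDl mulr_ge0 ?sqr_ge0//; lra.
Qed.

(** Exponential moments. The sign of [t] selects the tail, so this one bound yields both
    deviations. *)
Lemma count_type_chernoff i (t s : R) : t <= 2^-1 ->
  \sum_(tau | s <= t * count_type tau i) weight tau <=
  expR (n%:R * p i * (t + 2 * t ^+ 2) - s).
Proof.
move=> t2; rewrite expRD expRN ler_pdivlMr ?expR_gt0// mulr_suml.
apply: (@le_trans _ _ (\sum_(tau : {ffun 'I_n -> 'I_k}) \prod_x (p (tau x) * expR (t * (tau x == i)%:R)))).
  rewrite [leLHS]big_mkcond; apply: ler_sum => tau _.
  have pos : 0 <= \prod_x (p (tau x) * expR (t * (tau x == i)%:R)).
    by apply: prodr_ge0 => x _; rewrite mulr_ge0// expR_ge0.
  case: ifP => // st; rewrite big_split/= ler_wpM2l//.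
  rewrite -expR_sum ler_expR -mulr_sumr; apply: (le_trans st).
  rewrite le_eqVlt; apply/orP; left; apply/eqP; congr (_ * _).
  rewrite /count_type -sum1_card natr_sum big_mkcond/=.
  by apply: eq_bigr => x _; rewrite inE; case: ifP.
rewrite -(bigA_distr_bigA (fun _ j => p j * expR (t * (j == i)%:R))).
rewrite prodr_const card_ord -mulrA expRM_natl lerXn2r ?nnegrE ?expR_ge0//.
  by apply: sumr_ge0 => j _; rewrite mulr_ge0// expR_ge0.
apply: le_trans (expR_ge1Dx _).
rewrite (bigD1 i)//= eqxx mulr1.
rewrite (eq_bigr p); last by move=> j /negbTE ->; rewrite mulr0 expR0 mulr1.
move: sum_p; rewrite (bigD1 i)//= => sp.
have := ler_wpM2l (p_ge0 i) (expR_le_quadratic t2); lra.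
Qed.

(** The tolerance is relative, so a type of probability 0 must be absent. *)
Definition balanced (eta : R) tau : bool :=
  [forall i, `|count_type tau i - p i * n%:R| <= eta * (p i * n%:R)].

Lemma unbalanced_weight_le (eta : R) : 0 < eta <= 1 ->
  \sum_(tau | ~~ balanced eta tau) weight tau <=
  \sum_(i | 0 < p i) 2 * expR (- (p i * eta ^+ 2 / 8 * n%:R)).
Proof.
move=> /andP[e0 e1].
(* Chernoff with [t = eta / 4] and [t = - (eta / 4)]: both exponents equal
   [- (eta ^+ 2 / 8) * p i * n]. *)
pose up i tau := eta / 4 * ((1 + eta) * (p i * n%:R)) <= eta / 4 * count_type tau i.
pose dn i tau := - (eta / 4) * ((1 - eta) * (p i * n%:R)) <= - (eta / 4) * count_type tau i.
apply: (@le_trans _ _ (\sum_(i | 0 < p i) (\sum_(tau | up i tau) weight tau +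
    \sum_(tau | dn i tau) weight tau))).
  apply: (@le_trans _ _ (\sum_(tau : {ffun 'I_n -> 'I_k}) \sum_(i | 0 < p i) ((up i tau)%:R * weight tau + (dn i tau)%:R * weight tau))).
    rewrite big_mkcond; apply: ler_sum => tau _.
    have F0 i : 0 <= (up i tau)%:R * weight tau + (dn i tau)%:R * weight tau.
      by rewrite addr_ge0// mulr_ge0.
    case: ifP => [|_]; last exact: sumr_ge0.
    rewrite negb_forall => /existsP[i]; rewrite -ltNge => bi.
    (* A pattern in which a type of probability 0 occurs has weight 0. *)
    have [pi0|pi0] := eqVneq (p i) 0.
      have : 0 < count_type tau i.
        by move: bi; rewrite pi0 mul0r mulr0 subr0 ger0_norm.
      rewrite ltr0n => /card_gt0P[x]; rewrite inE => /eqP tx.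
      by rewrite {1}/weight (bigD1 x)//= tx pi0 mul0r sumr_ge0.
    have pi : 0 < p i by rewrite lt0r pi0 p_ge0.
    rewrite (bigD1 i)//=; apply: ler_wpDr; first exact: sumr_ge0.
    have udi : up i tau || dn i tau.
      move: bi; rewrite /up /dn !mulNr lerN2 !ler_pM2l ?divr_gt0//.
      move: (count_type tau i) (p i * n%:R) => a b.
      by rewrite ltr_normr => /orP[] bi; apply/orP; [left|right]; lra.
    by case/orP: udi => ->; rewrite mul1r ?lerDl ?lerDr mulr_ge0.
  rewrite exchange_big/=; apply: ler_sum => i _.
  rewrite big_split/= lerD//.
    by rewrite [leRHS]big_mkcond; apply: ler_sum => tau _; case: (up i tau); rewrite ?mul1r ?mul0r.
  by rewrite [leRHS]big_mkcond; apply: ler_sum => tau _; case: (dn i tau); rewrite ?mul1r ?mul0r.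
apply: ler_sum => i _; rewrite mulr2n mulrDl mul1r; apply: lerD.
  have t1 : eta / 4 <= 2^-1 by lra.
  apply: (le_trans (count_type_chernoff i _ t1)).
  by rewrite ler_expR le_eqVlt; apply/orP; left; apply/eqP; field.
have t1 : - (eta / 4) <= 2^-1 by lra.
apply: (le_trans (count_type_chernoff i _ t1)).
by rewrite ler_expR le_eqVlt; apply/orP; left; apply/eqP; field.
Qed.

End type_concentration.

(** * From frozen positions to the sampled graph *)

Lemma finite_subadditive d (T : measurableType d) (R : realType)
    (mu : {measure set T -> \bar R}) (I : finType) (P : pred I) (A : set T)
    (B : I -> set T) :
  measurable A -> (forall i, measurable (B i)) ->
  (forall x, A x -> exists2 i, P i & B i x) ->
  (mu A <= \sum_(i | P i) mu (B i))%E.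
Proof.
move=> mA mB AB; rewrite -big_filter fsbig_seq ?filter_uniq ?index_enum_uniq//.
apply: content_sub_fsum => //.
move=> x /AB[i Pi Bx]; exists i => //=.
by rewrite mem_filter Pi mem_index_enum.
Qed.

Lemma measurable_graph_event d (T : measurableType d) (n : nat)
    (G : T -> simple_graph 'I_n) (Q : pred (simple_graph 'I_n)) :
  (forall g, measurable (G @^-1` [set g])) -> measurable [set w | Q (G w)].
Proof.
move=> mG; rewrite (_ : [set w | _] = \bigcup_(g in [set` Q]) (G @^-1` [set g])).
  by apply: fin_bigcup_measurable => // g _; exact: mG.
apply/seteqP; split => [w Qw|w [g Qg Gw]]; first by exists (G w).
by rewrite /= Gw.
Qed.

Section sampled_graph.
Context d (T : measurableType d) (R : realType) (P : probability T R) (n : nat).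
Variables (W : R -> R -> R) (X : 'I_n -> {RV P >-> measurableTypeR R}).
Variable G : T -> simple_graph 'I_n.
Hypothesis W_graphon : graphon W.
Hypothesis X_iid : iid_uniform01 X.
Hypothesis mG : forall g, measurable (G @^-1` [set g]).
Hypothesis G_cond : forall g (D : set T),
  g_sigma_preimage (fun i => X i : T -> measurableTypeR R) D ->
  P (G @^-1` [set g] `&` D) =
    (\int[P]_(w in D) (edge_weight W (fun i => X i w) g)%:E)%E.
Variables (k : nat) (F : 'I_k -> set R).
Hypothesis mF : forall i, measurable (F i : set (measurableTypeR R)).
Hypothesis tF : trivIset setT F.
Hypothesis UF : \bigcup_i F i = I01 R.
Implicit Types (tau : {ffun 'I_n -> 'I_k}) (g : simple_graph 'I_n).

Let p i : R := fine (lambda01 R (F i)).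

Let types tau : set T := \bigcap_i (X i @^-1` F (tau i)).

Let X01 i w : I01 R (X i w). Proof. by have [h _ _] := X_iid; exact: h. Qed.

Let mX i (A : set (measurableTypeR R)) : measurable A -> measurable (X i @^-1` A).
Proof. by move=> mA; rewrite -[X in measurable X]setTI; exact: measurable_funP. Qed.

Let m_types tau : measurable (types tau).
Proof. by apply: fin_bigcap_measurable => // i _; exact: mX. Qed.

Let types_sigma tau : g_sigma_preimage (fun i => X i : T -> measurableTypeR R) (types tau).
Proof.
pose S := g_sigma_preimage (fun i => X i : T -> measurableTypeR R).
have sS : sigma_algebra setT S by exact: smallest_sigma_algebra.
have S_I A B : S A -> S B -> S (A `&` B).
  move=> SA SB; have -> : A `&` B = ~` (\bigcup_i (bigcup2 (~` A) (~` B) i)).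
    by rewrite bigcup2E setCU !setCK.
  have [S0 SC SU] := sS.
  rewrite -setTD; apply: (SC); apply: SU => -[|[|i]]/=.
  - by rewrite -setTD; exact: SC.
  - by rewrite -setTD; exact: SC.
  - exact: S0.
have S_T : S setT by have [S0 SC _] := sS; rewrite -(setD0 setT); exact: SC.
have -> : types tau = \big[setI/setT]_(i < n) (X i @^-1` F (tau i)).
  rewrite -bigcap_seq /types; apply: eq_bigcapl.
  by split=> i // _; exact: mem_index_enum.
apply: (big_ind S) => // i _.
apply: sub_gen_smallest.
rewrite (bigD1 i)//=; left; exists (F (tau i)); first exact: mF.
by rewrite setTI.
Qed.

Let types_cover w : exists tau, types tau w.
Proof.
have : forall i : 'I_n, exists j, F j (X i w).
  by move=> i; apply: (block_exists UF); exact: X01.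
move=> /choice[f Ff]; exists [ffun i => f i] => i _ /=.
by rewrite ffunE; exact: Ff.
Qed.

Let P_types tau : P (types tau) = (\prod_i p (tau i))%:E.
Proof.
have [_ Xl XI] := X_iid.
rewrite /types (XI (fun i => F (tau i))); last by move=> i; exact: mF.
rewrite (big_morph EFin (@EFinM R) erefl); apply: eq_bigr => i _.
by rewrite Xl; [rewrite fineK// fin_num_measure//; exact: mF|exact: mF].
Qed.

Let sum_p : \sum_i p i = 1.
Proof. exact: sum_lambda01_blocks mF tF UF. Qed.

Let sum_P_types (Q : pred {ffun 'I_n -> 'I_k}) :
  (\sum_(tau | Q tau) P (types tau))%E = (\sum_(tau | Q tau) \prod_i p (tau i))%:E.
Proof. by rewrite -sumEFin; apply: eq_bigr => tau _; rewrite P_types. Qed.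

Let edge_weight_ge0 g w : 0 <= edge_weight W (fun i => X i w) g.
Proof.
have [_ _ W01] := W_graphon.
apply: prodr_ge0 => e _; have /andP[h0 h1] := W01 _ _ (X01 e.1 w) (X01 e.2 w).
by case: ifP => // _; rewrite subr_ge0.
Qed.

Let measurable_edge_weight g :
  measurable_fun setT (fun w => edge_weight W (fun i => X i w) g).
Proof.
have [mW _ _] := W_graphon.
have mWX i j : measurable_fun setT (fun w => W (X i w) (X j w)).
  pose h w : R * R := (X i w, X j w).
  have mh : measurable_fun setT (h : T -> (measurableTypeR R * measurableTypeR R)%type).
    by apply: measurable_fun_pair; exact: measurable_funP.
  apply: (measurable_comp (F := I01 R `*` I01 R) _ _ mW mh).
    by apply: measurableX; exact: measurable_itv.
  by move=> _ [w _ <-]; split; exact: X01.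
rewrite /edge_weight; under eq_fun do rewrite big_mkcond.
apply: measurable_prod => e _; case: (e.1 < e.2)%N => //; case: (adj g e.1 e.2) => //.
by apply: measurable_funB.
Qed.

(** The events [types tau] cover the space and belong to the sigma-algebra of the positions. On each
    of them [G_cond] writes the probability as an integral of edge weights, which is bounded
    pointwise. *)
Lemma sampled_graph_prob_le (Q : pred (simple_graph 'I_n))
    (ok : pred {ffun 'I_n -> 'I_k}) (delta delta' : R) :
  0 <= delta ->
  (forall tau (x : 'I_n -> R), ok tau -> (forall i, F (tau i) (x i)) ->
    \sum_(g | Q g) edge_weight W x g <= delta) ->
  \sum_(tau | ~~ ok tau) \prod_i p (tau i) <= delta' ->
  (P [set w | Q (G w)] <= (delta + delta')%:E)%E.
Proof.
move=> d0 H H'.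
have mE : measurable [set w | Q (G w)] by exact: measurable_graph_event.
apply: (@le_trans _ _ (\sum_(tau : {ffun 'I_n -> 'I_k}) P ([set w | Q (G w)] `&` types tau))%E).
  apply: finite_subadditive => //; first by move=> tau; exact: measurableI.
  by move=> w Qw; have [tau tw] := types_cover w; exists tau.
rewrite (bigID ok)/= EFinD; apply: leeD; last first.
  apply: (@le_trans _ _ (\sum_(tau | ~~ ok tau) P (types tau))%E).
    apply: lee_sum => tau _; apply: le_measure; rewrite ?inE//; exact: measurableI.
  by rewrite sum_P_types lee_fin.
apply: (@le_trans _ _ (\sum_(tau | ok tau) delta%:E * P (types tau))%E).
  apply: lee_sum => tau ok_tau.
  apply: (@le_trans _ _ (\sum_(g | Q g) P (G @^-1` [set g] `&` types tau))%E).
    apply: finite_subadditive.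
    - exact: measurableI.
    - by move=> g; apply: measurableI => //; exact: mG.
    - by move=> w [Qw tw]; exists (G w).
  under eq_bigr => g _ do rewrite G_cond//.
  rewrite -big_filter -ge0_integral_sum//; last 2 first.
  - by move=> g; apply/measurable_EFinP; apply: measurable_funS (measurable_edge_weight g).
  - by move=> g w _; rewrite lee_fin.
  rewrite -integral_cst//; apply: le_integral_nonmeasurable => w tw.
  rewrite big_filter sumEFin !lee_fin sumr_ge0//=.
  by apply: H ok_tau _ => i; exact: tw.
rewrite -ge0_sume_distrr//.
rewrite sum_P_types -EFinM lee_fin ler_piMr//.
have := sum_weight (n := n) sum_p; rewrite (bigID ok)/= => h1.
rewrite -[leRHS]h1 lerDl.
by apply: sumr_ge0 => tau _; apply: prodr_ge0 => i _; rewrite fine_ge0.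
Qed.

End sampled_graph.

(** * Lower and upper tails *)

Section estimates.
Context {R : realType}.

Lemma expRN_le_inv (x : R) : 0 < x -> expR (- x) <= x^-1.
Proof.
move=> x0; rewrite expRN lef_pV2 ?posrE ?expR_gt0//.
by apply: le_trans (expR_ge1Dx x); rewrite lerDr.
Qed.

Lemma unbalanced_small (k : nat) (p : 'I_k -> R) (eta delta : R) :
  0 < eta -> 0 < delta -> (forall i, 0 <= p i) ->
  exists L0 : R, forall L : R, L0 <= L -> 0 < L ->
    \sum_(i | 0 < p i) 2 * expR (- (p i * eta ^+ 2 / 8 * L)) <= delta.
Proof.
move=> e0 d0 p0; exists (\sum_(i | 0 < p i) 16 / (p i * eta ^+ 2 * delta)) => L L0 Lp.
apply: (@le_trans _ _ (\sum_(i | 0 < p i) (16 / (p i * eta ^+ 2 * delta)) * (delta / L))).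
  apply: ler_sum => i pi.
  have x0 : 0 < p i * eta ^+ 2 / 8 * L by rewrite !mulr_gt0// exprn_gt0.
  apply: le_trans (ler_wpM2l _ (expRN_le_inv x0)) _ => //.
  by rewrite le_eqVlt; apply/orP; left; apply/eqP; field; rewrite !gt_eqF.
rewrite -mulr_suml mulrA ler_pdivrMr// [leRHS]mulrC ler_wpM2r//; exact: ltW.
Qed.

End estimates.

Section edge_prob_bounds.
Context {R : realType}.
Variables (W : R -> R -> R) (lo hi : R).
Hypotheses (lo_gt0 : 0 < lo) (hi_lt1 : hi < 1).
Hypothesis W_bounds : forall x y, I01 R x -> I01 R y -> lo <= W x y <= hi.
Variables (n : nat) (x : 'I_n -> R).
Hypothesis x01 : forall i, I01 R (x i).

Lemma edge_prob01 e : 0 <= edge_prob W x e <= 1.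
Proof.
have := W_bounds (x01 (val e).1) (x01 (val e).2); rewrite -/(edge_prob W x e).
by have := lo_gt0; have := hi_lt1; lra.
Qed.

Lemma one_minus_edge_prob e :
  1 - edge_prob W x e = expR (- logw W (x (val e).1) (x (val e).2)).
Proof.
rewrite /logw opprK lnK// posrE.
exact: (one_minus_W_gt0 hi_lt1 W_bounds).
Qed.

End edge_prob_bounds.

(** * Lower tail: colour classes as measures *)

Section colour_classes.
Import mathcomp.boot.finset.
Context {R : realType} {n k : nat}.
Variables (g : simple_graph 'I_n) (tau : 'I_n -> 'I_k) (a : 'I_k -> 'I_k -> R).
Variables (C t : R).
Hypothesis a_ge0 : forall i j, 0 <= a i j.
Hypothesis aC : forall i j, a i j = a j i.
Hypothesis a_le : forall i j, a i j <= C.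
Hypothesis sparse : forall A, independent g A ->
  \sum_(e in edges_in A) a (tau (val e).1) (tau (val e).2) <= #|A|%:R * t.

(** At the corner of the box given by [J], sparsity is applied to the vertices of [A] with type in
    [J]: doubling the pairs gives [2 * t], and the diagonal at most [C] per vertex. *)
Lemma independent_profile_box (A : {set 'I_n}) (v : 'I_k -> R) :
  independent g A ->
  (forall i, 0 <= v i <= #|class tau A i|%:R) ->
  \sum_i \sum_j a i j * (v i * v j) <= (2 * t + C) * \sum_i v i.
Proof.
move=> iA; apply: quadratic_le_linear_on_box => // J.
pose B := [set x in A | tau x \in J].
have iB : independent g B.
  apply/independentP => x y; rewrite !inE => /andP[xA _] /andP[yA _].
  by move/independentP: iA; apply.
have sumB (G : 'I_k -> R) : \sum_(x in B) G (tau x) = \sum_(i in J) #|class tau A i|%:R * G i.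
  rewrite (partition_big tau (mem J))/=; last by move=> x; rewrite inE => /andP[].
  apply: eq_bigr => i iJ; rewrite (eq_bigr (fun=> G i)); last by move=> x /andP[_ /eqP ->].
  rewrite (eq_bigl (fun x => x \in class tau A i)); last first.
    by move=> x; rewrite !inE; case: eqVneq => [->|]; rewrite ?andbF// iJ !andbT.
  by rewrite sumr_const mulr_natl.
have -> : \sum_(i in J) \sum_(j in J) a i j * (#|class tau A i|%:R * #|class tau A j|%:R) =
    \sum_(x in B) \sum_(y in B) a (tau x) (tau y).
  rewrite (sumB (fun i => \sum_(y in B) a i (tau y))); apply: eq_bigr => i iJ.
  rewrite (sumB (a i)) mulr_sumr; apply: eq_bigr => j _; ring.
have -> : \sum_(i in J) #|class tau A i|%:R = #|B|%:R :> R.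
  have := sumB (fun=> 1); rewrite sumr_const => ->.
  by apply: eq_bigr => i _; rewrite mulr1.
rewrite -(sum_edges_in B (b := fun x y => a (tau x) (tau y))); last by move=> x y; exact: aC.
rewrite [leRHS]mulrDl; apply: lerD.
  by rewrite -mulrA ler_wpM2l// mulrC sparse.
apply: (@le_trans _ _ (\sum_(x in B) C)); first exact: ler_sum.
by rewrite sumr_const mulr_natr.
Qed.

End colour_classes.

Lemma ler_sum_pred (R : realType) (I : finType) (Q Q' : pred I) (w : I -> R) :
  (forall i, 0 <= w i) -> (forall i, Q i -> Q' i) ->
  \sum_(i | Q i) w i <= \sum_(i | Q' i) w i.
Proof.
move=> w0 QQ; rewrite big_mkcond [leRHS]big_mkcond; apply: ler_sum => i _.
by case: ifP => [/QQ ->//|_]; case: ifP.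
Qed.

Lemma edge_weight_nneg (R : realType) (n : nat) (W : R -> R -> R) (x : 'I_n -> R) g :
  (forall e, 0 <= edge_prob W x e <= 1) -> 0 <= edge_weight W x g.
Proof. by move=> q01; rewrite edge_weight_Ex; exact: Ex_ge0. Qed.

Section lower_tail.
Context {R : realType}.
Variables (W : R -> R -> R) (lo hi : R).
Hypotheses (lo_gt0 : 0 < lo) (hi_lt1 : hi < 1).
Hypothesis W_bounds : forall x y, I01 R x -> I01 R y -> lo <= W x y <= hi.

Lemma phi_star_le_chromatic_number (k n : nat) (F : 'I_k -> set R)
    (a : 'I_k -> 'I_k -> R) (C eta t : R) (tau : {ffun 'I_n -> 'I_k})
    (g : simple_graph 'I_n) :
  (forall i, measurable (F i : set (measurableTypeR R))) ->
  trivIset setT F -> \bigcup_i F i = I01 R ->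
  (forall i j, a i j = a j i) -> (forall i j, 0 <= a i j <= C) ->
  (forall i j x y, F i x -> F j y -> logw W x y <= (1 + eta) * a i j) ->
  0 < eta < 1 -> 0 <= t -> 0 <= C -> (0 < n)%N ->
  balanced (fun i => fine (lambda01 R (F i))) eta tau ->
  (forall A : {set 'I_n}, independent g A ->
    \sum_(e in edges_in A) a (tau (val e).1) (tau (val e).2) <= #|A|%:R * t) ->
  (phi_star W <= ((chromatic_number g)%:R *
     ((1 + eta) * (2 * t + C) / ((1 - eta) * n%:R)))%:E)%E.
Proof.
move=> mF tF UF aC a0C Wa /andP[e0 e1] t0 C0 n0 bal sparse.
have a_ge0 i j : 0 <= a i j by have /andP[] := a0C i j.
have a_le i j : a i j <= C by have /andP[] := a0C i j.
set p := (fun i => fine (lambda01 R (F i))) in bal.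
have p_ge0 i : 0 <= p i by rewrite fine_ge0.
have nR : 0 < n%:R :> R by rewrite ltr0n.
have cnt i : (1 - eta) * (p i * n%:R) <= count_type tau i.
  by have /forallP/(_ i) := bal; rewrite ler_norml => /andP[h _]; lra.
have /existsP[c /forallP cP] := chromatic_numberP g.
pose A (j : 'I_(chromatic_number g)) : {set 'I_n} := [set x | c x == j]%SET.
have iA j : independent g (A j).
  apply/independentP => x y; rewrite !inE => /eqP xj /eqP yj; apply/negP => xy.
  by move: (cP x) => /forallP/(_ y)/implyP/(_ xy); rewrite xj yj eqxx.
(* Shares of the actual counts rather than of [p i * n], so that they add up to exactly 1 for every
   type that occurs. *)
pose u j i : R := #|class tau (A j) i|%:R / count_type tau i.
have s0 : 0 < (1 - eta) * n%:R by rewrite mulr_gt0// subr_gt0.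
apply: (phi_star_le_split lo_gt0 hi_lt1 W_bounds mF tF UF (c := fun i j => (1 + eta) * a i j)
  _ _ (u := u)) => //.
- by move=> i j; rewrite mulr_ge0//; lra.
- by rewrite divr_ge0 ?(ltW s0)// mulr_ge0//; lra.
- by move=> j i; rewrite divr_ge0.
- move=> i pi; have ct : 0 < count_type tau i :> R.
    by apply: lt_le_trans _ (cnt i); rewrite !mulr_gt0// subr_gt0.
  rewrite /u -mulr_suml -[X in X / _](_ : count_type tau i = _) ?divff ?gt_eqF//.
  rewrite /count_type -natr_sum; congr _%:R.
  rewrite -sum1_card (partition_big c xpredT)//=; apply: eq_bigr => j _.
  rewrite -sum1_card; apply: eq_bigl => x; rewrite !inE.
  by rewrite andbC.
move=> j v v01.
(* By balance [s * p i] is at most the count of type [i], so scaling by [s] carries the box of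
   shares into the box of class sizes. *)
pose s := (1 - eta) * n%:R.
have sv i : 0 <= s * v i <= #|class tau (A j) i|%:R.
  have /andP[v0 v1] := v01 i; rewrite mulr_ge0 ?(ltW s0)//=.
  have [pi0|pi0] := eqVneq (p i) 0.
    have v00 : v i <= 0 by apply: (le_trans v1); rewrite -/(p i) pi0 mulr0.
    have -> : v i = 0 by apply/eqP; rewrite eq_le v00 v0.
    by rewrite mulr0.
  have pi : 0 < p i by rewrite lt0r pi0 p_ge0.
  have ct : 0 < count_type tau i :> R.
    by apply: lt_le_trans _ (cnt i); rewrite !mulr_gt0// subr_gt0.
  apply: le_trans (ler_wpM2l (ltW s0) v1) _; rewrite /u -/(p i).
  have -> : (1 - eta) * n%:R * (#|class tau (A j) i|%:R / count_type tau i * p i) =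
    #|class tau (A j) i|%:R * ((1 - eta) * (p i * n%:R) / count_type tau i).
    by field; rewrite gt_eqF.
  by rewrite ler_piMr// ler_pdivrMr// mul1r.
have := independent_profile_box a_ge0 aC a_le sparse (iA j) sv.
rewrite quadratic_scale -mulr_sumr.
rewrite [_ * (s * \sum_i v i)]mulrCA ler_pM2l// => h.
have -> : \sum_i \sum_j (1 + eta) * a i j * (v i * v j) =
    (1 + eta) * \sum_i \sum_j a i j * (v i * v j).
  rewrite !mulr_sumr; apply: eq_bigr => i _; rewrite !mulr_sumr; apply: eq_bigr => l _.
  by ring.
rewrite mulrAC ler_pdivlMr// -/s -!mulrA ler_wpM2l ?(mulrC _ s)//; lra.
Qed.

(** The threshold on [ln n] is chosen before the probability space, which in the theorem varies with
    [n]. *)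
Lemma lower_tail (f eps delta : R) : block_regulated W -> phi_star W = f%:E ->
  0 < eps -> 0 < delta ->
  exists L0 : R, forall (n : nat) (d : measure_display) (T : measurableType d)
    (P : probability T R) (G : T -> simple_graph 'I_n),
    sampled_from P W G -> L0 <= ln (n%:R : R) ->
    (P [set w | ((chromatic_number (G w))%:R < (1 - eps) * f * (n%:R / (2 * ln n%:R)))%R]
       <= delta%:E)%E.
Proof.
move=> Wbr phif eps0 delta0.
have lo0 := lo_gt0; have hi1 := hi_lt1.
(* The losses amount to a factor [(1 + eta) * (1 + 2 * eta) / (1 - eta)], which [1 - 4 * eta]
   absorbs. *)
pose eta := Num.min eps 1 / 4.
have [e0 e1 e2] : [/\ 0 < eta, eta <= 4^-1 & 4 * eta <= eps].
  by rewrite /eta minEle; case: ifP => /= h; split; lra.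
have e01 : 0 < eta <= 1 by lra.
have [k [F [a [mF tF UF aC [a0C Wa]]]]] := block_partition lo_gt0 hi_lt1 W_bounds Wbr e01.
set C := - ln (1 - hi) in a0C.
have C0 : 0 <= C.
  have := logw_upper hi_lt1 W_bounds (@I01_0 R) (@I01_0 R).
  have := logw_lower hi_lt1 W_bounds (@I01_0 R) (@I01_0 R); rewrite -/C; lra.
pose p i := fine (lambda01 R (F i)).
have p_ge0 i : 0 <= p i by rewrite fine_ge0.
have d2 : 0 < delta / 2 by rewrite divr_gt0.
have [L1 HL1] := unbalanced_small e0 d2 p_ge0.
(* After [L1] for balance and 1 for positivity, the summands ensure [C <= 2 * eta * L] for the
   diagonal, then [eta * L >= 2] and [eta * L >= 4 / delta] for the first moment. *)
pose L0 := Num.max L1 0 + 1 + C / (2 * eta) + 2 / eta + 4 / (eta * delta).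
have L0_1 : 0 <= C / (2 * eta) by rewrite divr_ge0// mulr_ge0// ltW.
have L0_2 : 0 < 2 / eta by rewrite divr_gt0.
have L0_3 : 0 < 4 / (eta * delta) by rewrite divr_gt0// mulr_gt0.
have m1 : L1 <= Num.max L1 0 by rewrite le_max lexx.
have m2 : 0 <= Num.max L1 0 by rewrite le_max lexx orbT.
exists L0 => n d T P G [X [iid mG Gc]] L0L.
set L := ln (n%:R : R) in L0L *.
have L_gt0 : 0 < L by rewrite /L0 in L0L; lra.
have n0 : (0 < n)%N.
  by rewrite lt0n; apply/eqP => n0; move: L_gt0; rewrite /L n0 ln0// ltxx.
have nR : 0 < n%:R :> R by rewrite ltr0n.
have nE : n%:R = expR L by rewrite /L lnK// posrE.
have Ln : L <= n%:R by rewrite nE; apply: le_trans (expR_ge1Dx L); rewrite lerDr.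
pose t := (1 + eta) * L.
have t0 : 0 <= t by rewrite mulr_ge0//; lra.
rewrite (_ : delta = delta / 2 + delta / 2); last by field.
have [graphonW _] := Wbr.
apply: (sampled_graph_prob_le graphonW iid mG Gc mF tF UF (ok := balanced p eta)
  (Q := fun g => (chromatic_number g)%:R < (1 - eps) * f * (n%:R / (2 * L)))).
- exact: ltW.
- move=> tau x bal Fx.
  have x01 i : I01 R (x i) by rewrite -UF; exists (tau i).
  have q01 := edge_prob01 lo_gt0 hi_lt1 W_bounds x01.
  pose b y z := a (tau y) (tau z).
  have qb e : 1 - edge_prob W x e <= expR (- b (val e).1 (val e).2).
    rewrite (one_minus_edge_prob hi_lt1 W_bounds x01) ler_expR lerN2.
    by have /andP[] := Wa _ _ _ _ (Fx (val e).1) (Fx (val e).2).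
  apply: le_trans (le_trans (independent_set_first_moment t q01 qb) _); last first.
    have -> : n%:R * expR (- t) = expR (- (eta * L)).
      by rewrite nE -expRD; congr expR; rewrite /t; ring.
    have eL : 0 < eta * L by rewrite mulr_gt0.
    have h := expRN_le_inv eL; set z := expR (- (eta * L)) in h *.
    have z0 : 0 <= z by exact: expR_ge0.
    have zL : z * (eta * L) <= 1 by rewrite -ler_pdivlMr// mul1r.
    have eL1 : 2 <= eta * L.
      have : eta * (2 / eta) <= eta * L by rewrite ler_wpM2l ?(ltW e0)//; rewrite /L0 in L0L; lra.
      by rewrite mulrCA divff ?gt_eqF// mulr1.
    have eL2 : 4 / delta <= eta * L.
      have -> : 4 / delta = eta * (4 / (eta * delta)) by field; rewrite !gt_eqF.
      by rewrite ler_wpM2l ?(ltW e0)//; rewrite /L0 in L0L; lra.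
    have z2 : z <= 2^-1 by nra.
    have z4 : z <= delta / 4.
      have : z * (4 / delta) <= 1 by apply: le_trans zL; rewrite ler_wpM2l.
      by rewrite mulrA ler_pdivrMr// mul1r; lra.
    have := expR_le_quadratic z2; nra.
  apply: ler_sum_pred => [g|g small]; first exact: edge_weight_nneg.
  apply: contraPT small; rewrite negb_exists => /forallP sparse; apply/negP.
  rewrite -leNgt.
  have := phi_star_le_chromatic_number (t := t) (g := g) mF tF UF aC a0C
    (fun i j x y Fx Fy => proj2 (andP (Wa i j x y Fx Fy))) _ t0 C0 n0 bal _.
  rewrite phif lee_fin => fle.
  have {}fle : f <= (chromatic_number g)%:R * ((1 + eta) * (2 * t + C) / ((1 - eta) * n%:R)).
    apply: fle; first lra.
    by move=> A iA; have := sparse A; rewrite iA/= -leNgt.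
  have f0 : 0 < f.
    by have := phi_star_ge_lower lo_gt0 hi_lt1 W_bounds; rewrite phif lee_fin; lra.
  have CL : C <= 2 * eta * L.
    rewrite mulrC -ler_pdivrMr; last by rewrite mulr_gt0.
    by rewrite /L0 in L0L; lra.
  move: fle; set m := (chromatic_number g)%:R : R.
  rewrite mulrA ler_pdivlMr; last by rewrite mulr_gt0//; lra.
  move=> fle.
  have m0 : 0 <= m by [].
  have h1 : f * ((1 - eta) * n%:R) <= m * ((1 + eta) * (2 * (1 + 2 * eta) * L)).
    apply: (le_trans fle); rewrite ler_wpM2l// ler_wpM2l//; first lra.
    by rewrite /t; lra.
  rewrite mulrA ler_pdivrMr; last by rewrite mulr_gt0.
  have fn0 : 0 < f * n%:R by rewrite mulr_gt0.
  have h2 : (1 - 4 * eta) * ((1 + eta) * (1 + 2 * eta)) <= 1 - eta by nra.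
  have h3 : 0 < (1 + eta) * (1 + 2 * eta) by rewrite mulr_gt0//; lra.
  rewrite -(ler_pM2r h3).
  have h4 := ler_wpM2l (ltW fn0) h2.
  have h5 : (1 - eps) * (f * n%:R) <= (1 - 4 * eta) * (f * n%:R).
    by rewrite ler_wpM2r ?(ltW fn0)//; lra.
  have h6 := ler_wpM2r (ltW h3) h5.
  have -> : m * (2 * L) * ((1 + eta) * (1 + 2 * eta)) =
     m * ((1 + eta) * (2 * (1 + 2 * eta) * L)) by ring.
  apply: le_trans h1; rewrite -[(1 - eps) * f * _]mulrA; apply: (le_trans h6).
  have -> : (1 - 4 * eta) * (f * n%:R) * ((1 + eta) * (1 + 2 * eta)) =
    f * n%:R * ((1 - 4 * eta) * ((1 + eta) * (1 + 2 * eta))) by ring.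
  by apply: (le_trans h4); rewrite le_eqVlt; apply/orP; left; apply/eqP; ring.
apply: le_trans (unbalanced_weight_le p_ge0 (sum_lambda01_blocks mF tF UF) e01) _.
apply: HL1; last by [].
by rewrite /L0 in L0L; lra.
Qed.

End lower_tail.

(** * Upper tail: colouring with few profiles *)

Lemma exp_dominates (R : realType) (c M : R) : 0 < c -> 0 <= M ->
  exists2 L0 : R, 0 <= L0 & forall L : R, L0 <= L -> M * L ^+ 2 <= expR (c * L).
Proof.
move=> c0 M0; exists (6 * M / c ^+ 3); first by apply: divr_ge0; [apply: mulr_ge0|apply/exprn_ge0/ltW].
move=> L; rewrite ler_pdivrMr ?exprn_gt0// => ML.
have L0 : 0 <= L.
  have : 0 <= L * c ^+ 3 by apply: le_trans ML; rewrite mulr_ge0.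
  by rewrite pmulr_lge0// exprn_gt0.
apply: le_trans (expR_ge1Dxn 2 (mulr_ge0 (ltW c0) L0)).
rewrite (_ : 3`!%:R = 6 :> R)//.
have := ler_wpM2r (sqr_ge0 L) ML.
have -> : (c * L) ^+ 3 / 6 = L * c ^+ 3 * L ^+ 2 / 6 by field.
lra.
Qed.

Definition repeat_profiles (I : finType) (T : Type) (N : I -> nat) (s : I -> T) : seq T :=
  flatten [seq nseq (N i) (s i) | i <- enum I].

Lemma sum_repeat_profiles (I : finType) (T : Type) (N : I -> nat) (s : I -> T)
    (F : T -> nat) :
  (\sum_(x <- repeat_profiles N s) F x = \sum_i N i * F (s i))%N.
Proof.
rewrite /repeat_profiles big_flatten/= big_map big_enum/=; apply: eq_bigr => i _.
by rewrite big_nseq iter_addn addn0 mulnC.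
Qed.

Lemma size_repeat_profiles (I : finType) (T : Type) (N : I -> nat) (s : I -> T) :
  size (repeat_profiles N s) = (\sum_i N i)%N.
Proof.
rewrite -sum1_size sum_repeat_profiles; apply: eq_bigr => i _; exact: muln1.
Qed.

Lemma nth_repeat_profiles (I : finType) (T : Type) (N : I -> nat) (s : I -> T)
    (x0 : T) c :
  (c < size (repeat_profiles N s))%N ->
  exists i, nth x0 (repeat_profiles N s) c = s i.
Proof.
have /all_nthP H : all (fun x => `[< exists i, x = s i >]) (repeat_profiles N s).
  rewrite /repeat_profiles; elim: (enum I) => //= i r IH.
  rewrite all_cat IH andbT; elim: (N i) => //= m ->; rewrite andbT.
  by apply/asboolP; exists i.
by move=> /(H x0) /asboolP.
Qed.

Section upper_tail.
Context {R : realType}.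
Variables (W : R -> R -> R) (lo hi : R).
Hypotheses (lo_gt0 : 0 < lo) (hi_lt1 : hi < 1).
Hypothesis W_bounds : forall x y, I01 R x -> I01 R y -> lo <= W x y <= hi.
Local Notation PR := (pprobability (measurableTypeR R) R).

(** [phi] bounds the form at the corners of the box of block masses; convexity over the box extends
    this to fractional parts of blocks, and scaling by [sigma] to vertex counts. *)
Lemma quadratic_le_phi (k : nat) (F : 'I_k -> set R) (a : 'I_k -> 'I_k -> R)
    (mu : PR) (ph sigma : R) (r : 'I_k -> R) :
  (forall i, measurable (F i : set (measurableTypeR R))) ->
  trivIset setT F -> \bigcup_i F i = I01 R ->
  (forall i j, 0 <= a i j) ->
  (forall i j x y, F i x -> F j y -> a i j <= logw W x y) ->
  phi mu W = ph%:E -> 0 < sigma ->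
  (forall i, 0 <= r i <= fine (mu (F i)) * sigma) ->
  \sum_i \sum_j a i j * (r i * r j) <= ph * sigma * \sum_i r i.
Proof.
move=> mF tF UF a0 Wa phE s0 rq.
have vq i : 0 <= sigma^-1 * r i <= fine (mu (F i)).
  by have /andP[r0 r1] := rq i; rewrite mulr_ge0 ?invr_ge0 ?(ltW s0)//= mulrC ler_pdivrMr.
have := quadratic_le_linear_on_box a0 (fun i => fine_ge0 (measure_ge0 mu (F i)))
  (fun J => phi_ge hi_lt1 W_bounds mF tF UF a0 J Wa phE) vq.
rewrite quadratic_scale -mulr_sumr [leRHS]mulrCA ler_pM2l ?invr_gt0//.
by rewrite ler_pdivrMl// => h; apply: (le_trans h); rewrite le_eqVlt; apply/orP; left; apply/eqP; ring.
Qed.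

End upper_tail.

Section upper_tail_arithmetic.
Context {R : realType}.

Lemma rounding_loss (eta : R) : 0 <= eta <= 24^-1 ->
  (1 + eta) * ((1 + eta) ^+ 2 / (1 - eta) ^+ 2) <= 1 + 12 * eta.
Proof.
move=> /andP[e0 e1]; have em : 0 < 1 - eta by lra.
rewrite mulrA ler_pdivrMr ?exprn_gt0// -subr_ge0.
have -> : (1 + 12 * eta) * (1 - eta) ^+ 2 - (1 + eta) * (1 + eta) ^+ 2 =
  eta * (7 - 26 * eta + 11 * eta ^+ 2) by ring.
by apply: mulr_ge0 => //; have := sqr_ge0 eta; lra.
Qed.

(** For [r0 = n^(-8/5)] the Janson exponent is [n^(8/5) / (4 e) >= 3 n]. One [n] pays for [2 ^+ n],
    another for the number of profiles, and the third leaves [K * exp (- n) <= delta]. *)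
Lemma union_bound_small (K L delta : R) (n l : nat) :
  n%:R = expR L -> 1 <= L -> 0 <= K -> 0 < delta ->
  12 * expR 1 * L ^+ 2 <= expR (3 / 5 * L) ->
  l%:R <= K * n%:R -> K / delta <= L ->
  l%:R * 2 ^+ n * expR (- (4 * (expR (- (8 / 5 * L)) * expR 1))^-1) <= delta.
Proof.
move=> nE L1 K0 d0 L_large lK KL.
have L0 : 0 <= L by lra.
have nR : 0 < n%:R :> R by rewrite nE expR_gt0.
have pow2 : 2 ^+ n <= expR n%:R :> R.
  rewrite -[n%:R]mulr1 expRM_natl lerXn2r ?nnegrE ?expR_ge0//.
  by have := expR_ge1Dx (1 : R); lra.
have n_exp : n%:R <= expR n%:R :> R.
  by apply: le_trans (expR_ge1Dx _); rewrite lerDr.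
have expo : 3 * n%:R <= (4 * (expR (- (8 / 5 * L)) * expR 1))^-1 :> R.
  have e1_gt0 : 0 < expR 1 :> R by exact: expR_gt0.
  have -> : (4 * (expR (- (8 / 5 * L)) * expR 1))^-1 =
      n%:R * (expR (3 / 5 * L) / (4 * expR 1)).
    have r0V : (expR (- (8 / 5 * L)))^-1 = n%:R * expR (3 / 5 * L).
      by rewrite -expRN opprK nE -expRD; congr expR; field.
    by rewrite !invfM r0V; field; rewrite gt_eqF.
  rewrite mulrC ler_wpM2l// ler_pdivlMr ?mulr_gt0//.
  apply: le_trans L_large.
  have -> : 3 * (4 * expR 1) = 12 * expR 1 * 1 :> R by ring.
  by rewrite ler_wpM2l ?mulr_ge0 ?expR_ge0// exprn_ege1.
apply: (@le_trans _ _ (K * expR n%:R * expR n%:R * expR (- (3 * n%:R)))).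
  apply: ler_pM; rewrite ?mulr_ge0 ?exprn_ge0 ?expR_ge0//.
    apply: ler_pM; rewrite ?exprn_ge0// ?expR_ge0//.
    by apply: (le_trans lK); rewrite ler_wpM2l.
  by rewrite ler_expR lerN2.
rewrite -!mulrA -!expRD.
have -> : n%:R + (n%:R - 3 * n%:R) = - n%:R :> R by ring.
apply: le_trans (ler_wpM2l K0 (expRN_le_inv nR)) _.
rewrite ler_pdivrMr// mulrC -ler_pdivrMr//; apply: (le_trans KL).
by rewrite nE; apply: le_trans (expR_ge1Dx L); rewrite lerDr.
Qed.

(** The vertices left by the greedy removal have order [L * n^(1 - eta / 4)], and [N] stands for one
    colour per measure lost to rounding; both are small against [n / L]. *)
Lemma leftover_small (eta lo e L : R) (n N k S m : nat) :
  0 < eta <= 1 -> 0 < lo -> 0 < e -> 1 <= L -> n%:R = expR L ->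
  (N%:R + 2 * k%:R * (2 / lo + 1)) * (2 / e) * L ^+ 2 <= expR (eta / 4 * L) ->
  m%:R <= 2 * expR ((1 - eta / 4) * L) -> S%:R <= (2 / lo + 1) * L ->
  N%:R + (k * (S * m))%:R <= e * (n%:R / (2 * L)).
Proof.
move=> /andP[eta0 eta1] lo0 e0 L1 nE L_large m_le S_le.
have L_gt0 : 0 < L by lra.
set E := expR ((1 - eta / 4) * L) in m_le *.
have E0 : 0 < E by exact: expR_gt0.
have E1 : 1 <= E.
  by rewrite -[X in X <= _]expR0 ler_expR mulr_ge0//; clear -eta1 L1; lra.
have Sm : (S * m)%:R <= (2 / lo + 1) * L * (2 * E) by rewrite natrM ler_pM.
have N_le : N%:R <= N%:R * (L * E) by rewrite ler_peMr// mulr_ege1.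
have h1 : N%:R + (k * (S * m))%:R <= (N%:R + 2 * k%:R * (2 / lo + 1)) * (L * E).
  by rewrite natrM; have := ler_wpM2l (ler0n R k) Sm; clear -N_le; lra.
apply: (le_trans h1).
have h2 := ler_wpM2r (ltW E0) L_large.
have EE : expR (eta / 4 * L) * E = n%:R.
  by rewrite nE /E -expRD; congr expR; field.
rewrite EE in h2.
have -> : e * (n%:R / (2 * L)) = n%:R * (e / (2 * L)) by field; rewrite gt_eqF.
have c0 : 0 < e / (2 * L) by rewrite divr_gt0// mulr_gt0.
apply: le_trans (ler_wpM2r (ltW c0) h2).
rewrite le_eqVlt; apply/orP; left; apply/eqP.
by field; rewrite !gt_eqF.
Qed.

Lemma truncn_ge (eta x : R) : 0 <= x -> x = 0 \/ 1 <= eta * x ->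
  (1 - eta) * x <= (Num.truncn x)%:R.
Proof.
move=> x0 [->|h]; first by rewrite mulr0.
by have /andP[_] := truncn_itv x0; rewrite -natr1; lra.
Qed.

Lemma truncnS_itv (x : R) : 0 <= x -> x <= (Num.truncn x).+1%:R <= x + 1.
Proof.
by move=> x0; have /andP[h1 h2] := truncn_itv x0; rewrite (ltW h2)/= -natr1 lerD2r.
Qed.

End upper_tail_arithmetic.

Section colouring_budget.
Context {R : realType} {n k : nat} {I : finType}.
Variables (a : 'I_k -> 'I_k -> R) (q : I -> 'I_k -> R) (ph alpha : I -> R).
Variables (p : 'I_k -> R) (tau : {ffun 'I_n -> 'I_k}).
Variables (lo C f eps eta L : R).
Hypothesis a_itv : forall i j, 0 <= a i j <= C.
Hypothesis aC : forall i j, a i j = a j i.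
Hypothesis q_ge0 : forall i j, 0 <= q i j.
Hypothesis sum_q : forall i, \sum_j q i j = 1.
Hypothesis alpha_ge0 : forall i, 0 <= alpha i.
Hypothesis sum_alpha_q : forall j, \sum_i alpha i * q i j = p j.
Hypothesis lo_gt0 : 0 < lo.
Hypothesis ph_itv : forall i, lo <= ph i <= C.
Hypothesis sum_alpha_ph : \sum_i alpha i * ph i <= f + eta * f.
Hypothesis quadratic : forall i (sigma : R) (r : 'I_k -> R), 0 < sigma ->
  (forall j, 0 <= r j <= q i j * sigma) ->
  \sum_j \sum_j' a j j' * (r j * r j') <= ph i * sigma * \sum_j r j.
Hypotheses (f_gt0 : 0 < f) (eps_gt0 : 0 < eps).
Hypothesis eta_itv : 0 < eta <= 24^-1.
Hypothesis eta_eps : 24 * eta <= eps.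
Hypothesis L_ge1 : 1 <= L.
Hypothesis n_eq : n%:R = expR L.
Hypothesis tau_balanced : balanced p eta tau.
Hypothesis L_large_q :
  forall i j, (1 + eta) * C / (2 * eta * (1 - eta) * q i j) <= L.
Hypothesis L_large_lo : 2 / lo * L ^+ 2 <= expR (eta / 4 * L).
Hypothesis L_large_C : 80 * C <= eta ^+ 2 * L.
Hypothesis L_large_rest :
  (#|I|%:R + 2 * k%:R * (2 / lo + 1)) * (2 / (eps / 2 * f)) * L ^+ 2 <=
  expR (eta / 4 * L).

(* [sigma i] keeps the profile [s i] below the first-moment threshold by a factor
   [1 - eta]; [K] makes up for the losses in [sigma], in rounding and in balance. *)
Let sigma i := 2 * (1 - eta) * L / ((1 + eta) * ph i).
Let s i j := Num.truncn (q i j * sigma i).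
Let K := (1 + eta) ^+ 2 / (1 - eta) ^+ 2.
Let A i := alpha i * ph i * (K * n%:R / (2 * L)).
Let N i := (Num.truncn (A i)).+1.
Let l := repeat_profiles N s.
(** Candidates per slot, just above [n^(1 - eta / 4)]. As [S] bounds every entry of a profile, a
    class of [S * m] vertices serves all its slots. *)
Let m := (Num.truncn (expR ((1 - eta / 4) * L))).+1.
Let S := (Num.truncn (2 / lo * L)).+1.
(** [phi] controls the lower coefficients [a], whereas Janson's inequality needs independence
    probabilities bounded from below, hence the upper ones. The [1 + eta] in the denominator of
    [sigma] pays for the exchange. *)
Let ah i j := (1 + eta) * a i j.

Let eta_gt0 : 0 < eta. Proof. by have /andP[] := eta_itv. Qed.
Let eta_le : eta <= 24^-1. Proof. by have /andP[] := eta_itv. Qed.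
Let em_gt0 : 0 < 1 - eta. Proof. by have := eta_le; lra. Qed.
Let ep_gt0 : 0 < 1 + eta. Proof. by have := eta_gt0; lra. Qed.
Let L_gt0 : 0 < L. Proof. by have := L_ge1; lra. Qed.
Let ph_gt0 i : 0 < ph i.
Proof. by have /andP[h _] := ph_itv i; exact: lt_le_trans h. Qed.
Let n_gt0 : 0 < n%:R :> R. Proof. by rewrite n_eq expR_gt0. Qed.
Let a_ge0 i j : 0 <= a i j. Proof. by have /andP[] := a_itv i j. Qed.

Let sigma_gt0 i : 0 < sigma i.
Proof. by rewrite /sigma divr_gt0// ?mulr_gt0. Qed.

Let ph_sigma i : ph i * sigma i = 2 * (1 - eta) * L / (1 + eta).
Proof. by rewrite /sigma; field; rewrite !gt_eqF. Qed.

Let sigma_le i : sigma i <= 2 / lo * L.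
Proof.
rewrite mulrAC ler_pdivlMr// mulrC; apply: (@le_trans _ _ (ph i * sigma i)).
  by rewrite ler_wpM2r ?(ltW (sigma_gt0 i))//; have /andP[] := ph_itv i.
rewrite ph_sigma ler_pdivrMr//.
by have := mulr_gt0 eta_gt0 L_gt0; lra.
Qed.

Let qs_ge0 i j : 0 <= q i j * sigma i.
Proof. by rewrite mulr_ge0// ltW. Qed.

Let s_le i j : (s i j)%:R <= q i j * sigma i.
Proof. by have /andP[] := truncn_itv (qs_ge0 i j). Qed.

Let s_ge i j : (1 - eta) * (q i j * sigma i) <= (s i j)%:R.
Proof.
apply: truncn_ge => //; have [q0|q0] := eqVneq (q i j) 0; first by left; rewrite q0 mul0r.
right; have qp : 0 < q i j by rewrite lt0r q0 q_ge0.
have den0 : 0 < 2 * eta * (1 - eta) * q i j by rewrite !mulr_gt0.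
have := L_large_q i j; rewrite ler_pdivrMr// => h.
have -> : eta * (q i j * sigma i) = L * (2 * eta * (1 - eta) * q i j) / ((1 + eta) * ph i).
  by rewrite /sigma; field; rewrite !gt_eqF.
rewrite ler_pdivlMr ?mulr_gt0// mul1r; apply: le_trans h.
by rewrite ler_wpM2l ?(ltW ep_gt0)//; have /andP[] := ph_itv i.
Qed.

Let sum_s i : (\sum_j s i j)%:R <= sigma i.
Proof.
rewrite natr_sum; apply: (@le_trans _ _ (\sum_j q i j * sigma i)); first exact: ler_sum.
by rewrite -mulr_suml sum_q mul1r.
Qed.

Let sS i j : (s i j <= S)%N.
Proof.
have /andP[S_ge _] : 2 / lo * L <= S%:R <= 2 / lo * L + 1.
  by apply: truncnS_itv; rewrite mulr_ge0 ?divr_ge0// ltW.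
rewrite -(ler_nat R); apply: le_trans (s_le i j) (le_trans _ S_ge).
apply: le_trans (sigma_le i); rewrite ler_piMl ?(ltW (sigma_gt0 i))//.
by rewrite -(sum_q i) (bigD1 j)//= lerDl sumr_ge0.
Qed.

Let m_itv : expR ((1 - eta / 4) * L) <= m%:R <= 2 * expR ((1 - eta / 4) * L).
Proof.
have /andP[-> h] /= := truncnS_itv (expR_ge0 ((1 - eta / 4) * L)).
apply: (le_trans h); rewrite [leRHS]mulrDl !mul1r lerD2l.
rewrite -[X in X <= _]expR0 ler_expR mulr_ge0 ?(ltW L_gt0)//.
by have := eta_le; lra.
Qed.

Lemma profile_admissible c : (c < size l)%N -> let t := nth (fun=> 0%N) l c in
  [/\ forall i, (t i * m <= S * m)%N,
   (\sum_i t i)%:R * expR (- (eta / 4 * L)) <= 1 &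
   forall r : 'I_k -> nat, (forall i, r i <= t i)%N -> (1 < \sum_i r i)%N ->
    (m%:R^-1) ^+ (\sum_i r i) *
    expR (2^-1 * \sum_i \sum_j ah i j * ((r i)%:R * (r j)%:R)) <=
    expR (- (8 / 5 * L)) * expR (- (eta / 4 * L)) ^+ (\sum_i r i)].
Proof.
move=> cl; have [i /= ->] := nth_repeat_profiles (fun=> 0%N) cl; split.
- by move=> j; rewrite leq_mul2r sS orbT.
- rewrite expRN ler_pdivrMr ?expR_gt0// mul1r.
  apply: (le_trans (sum_s i)); apply: (le_trans (sigma_le i)).
  apply: le_trans L_large_lo; apply: ler_wpM2l; first by rewrite divr_ge0// ltW.
  by rewrite expr2 ler_peMr// ltW.
move=> r rs r1; have /andP[m_ge _] := m_itv.
apply: (profile_weight_le (C := 2 * C)) => //.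
- move=> j j'; have /andP[a0 aC'] := a_itv j j'; rewrite /ah.
  by apply: ler_pM => //; [exact: ltW|have := eta_le; lra].
- by have := eta_le; have := eta_gt0; lra.
- exact: ltW.
- by have := L_large_C; lra.
have rq j : 0 <= (r j)%:R :> R /\ (r j)%:R <= q i j * sigma i.
  by split => //; apply: le_trans (s_le i j); rewrite ler_nat.
have := quadratic (sigma_gt0 i) (fun j => introT andP (rq j)).
rewrite ph_sigma -natr_sum.
have -> : \sum_i0 \sum_j ah i0 j * ((r i0)%:R * (r j)%:R) =
    (1 + eta) * \sum_i0 \sum_j a i0 j * ((r i0)%:R * (r j)%:R).
  rewrite mulr_sumr; apply: eq_bigr => j _; rewrite mulr_sumr; apply: eq_bigr => j' _.
  by rewrite /ah [RHS]mulrA.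
move: (\sum_i0 \sum_j _) ((\sum_i0 r i0)%:R) => u v uv.
have := ler_wpM2l (ltW ep_gt0) uv.
have -> : (1 + eta) * (2 * (1 - eta) * L / (1 + eta) * v) = 2 * ((1 - eta) * L * v).
  by field; rewrite gt_eqF.
lra.
Qed.

Let A_ge0 i : 0 <= A i.
Proof.
apply: mulr_ge0; first by apply: mulr_ge0 => //; apply: ltW.
apply: divr_ge0; last by rewrite mulr_ge0// ltW.
by rewrite mulr_ge0// divr_ge0// sqr_ge0.
Qed.

Lemma profiles_cover j :
  (#|[set z | tau z == j]%SET| <= \sum_(t <- l) t j)%N.
Proof.
rewrite -(ler_nat R) /l (sum_repeat_profiles N s (fun t => t j)) natr_sum.
have /forallP/(_ j) := tau_balanced; rewrite ler_norml => /andP[_ hb].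
apply: (@le_trans _ _ ((1 + eta) * (p j * n%:R))).
  by move: hb; rewrite /count_type; lra.
rewrite -sum_alpha_q mulr_suml mulr_sumr; apply: ler_sum => i _.
rewrite natrM.
apply: (@le_trans _ _ (A i * ((1 - eta) * (q i j * sigma i)))); last first.
  apply: ler_pM => //; first by rewrite mulr_ge0// ltW.
  by have /andP[] := truncnS_itv (A_ge0 i).
(* [K] is chosen to make this an equality. *)
rewrite le_eqVlt; apply/orP; left; apply/eqP; rewrite /A /sigma /K.
by field; rewrite !gt_eqF.
Qed.

Lemma colour_budget :
  (size l + k * (S * m))%:R <= (1 + eps) * f * (n%:R / (2 * L)).
Proof.
have size_l : (size l)%:R <= (1 + eta) * K * f * (n%:R / (2 * L)) + #|I|%:R.
  rewrite /l size_repeat_profiles natr_sum.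
  apply: (@le_trans _ _ (\sum_i (A i + 1))).
    by apply: ler_sum => i _; have /andP[] := truncnS_itv (A_ge0 i).
  rewrite big_split/= sumr_const lerD2r /A -mulr_suml.
  have -> : (1 + eta) * K * f * (n%:R / (2 * L)) =
      (f + eta * f) * (K * n%:R / (2 * L)) by field; rewrite gt_eqF.
  apply: ler_wpM2r => //; apply: divr_ge0; last by rewrite mulr_ge0// ltW.
  by rewrite mulr_ge0// divr_ge0// sqr_ge0.
have rest : #|I|%:R + (k * (S * m))%:R <= eps / 2 * f * (n%:R / (2 * L)).
  have /andP[_ m_le] := m_itv.
  have /andP[_ S_le] : 2 / lo * L <= S%:R <= 2 / lo * L + 1.
    by apply: truncnS_itv; rewrite mulr_ge0 ?divr_ge0// ltW.
  apply: (leftover_small _ lo_gt0 _ L_ge1 n_eq L_large_rest m_le).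
  - by have := eta_le; have := eta_gt0; lra.
  - by rewrite mulr_gt0// divr_gt0.
  - by apply: (le_trans S_le); rewrite [leRHS]mulrDl mul1r lerD2l.
have Ke : (1 + eta) * K <= 1 + eps / 2.
  apply: (le_trans (rounding_loss _)); last by have := eta_eps; lra.
  by rewrite (ltW eta_gt0) eta_le.
have fnL : 0 <= f * (n%:R / (2 * L)) by rewrite mulr_ge0// ?divr_ge0// ?mulr_ge0// ltW.
by have := ler_wpM2r fnL Ke; rewrite natrD; lra.
Qed.

Lemma few_colours_suffice (W : R -> R -> R) (x : 'I_n -> R) (delta : R) :
  (forall e, 0 <= edge_prob W x e <= 1) ->
  (forall e, expR (- ah (tau (val e).1) (tau (val e).2)) <= 1 - edge_prob W x e) ->
  0 < delta -> 12 * expR 1 * L ^+ 2 <= expR (3 / 5 * L) ->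
  (1 + eps) * f / delta <= L ->
  \sum_(g | (1 + eps) * f * (n%:R / (2 * L)) < (chromatic_number g)%:R)
     edge_weight W x g <= delta.
Proof.
move=> q01 ah_q delta0 L_large_exp L_large_delta.
have ah_ge0 i j : 0 <= ah i j by rewrite mulr_ge0// ltW.
have ahC i j : ah i j = ah j i by rewrite /ah aC.
have ef_ge0 : 0 <= (1 + eps) * f.
  by rewrite mulr_ge0 ?(ltW f_gt0)//; have := eps_gt0; lra.
have size_le : (size l)%:R <= (1 + eps) * f * n%:R.
  apply: le_trans (le_trans colour_budget _); first by rewrite ler_nat leq_addr.
  apply: ler_wpM2l => //; rewrite ler_pdivrMr ?mulr_gt0//.
  by rewrite ler_peMr// ?(ltW n_gt0)//; have := L_ge1; lra.
apply: le_trans (union_bound_small n_eq L_ge1 ef_ge0 delta0 L_large_exp size_le L_large_delta).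
apply: le_trans (not_colorable_le q01 ah_ge0 ahC ah_q _ (expR_ge0 _) (expR_gt0 _)
  profile_admissible profiles_cover) => //.
apply: ler_sum_pred => [g|g]; first exact: edge_weight_nneg.
apply: contraTN => cg; rewrite -leNgt; apply: le_trans colour_budget.
by rewrite ler_nat; exact: chromatic_number_le.
Qed.

End colouring_budget.

Section upper_tail.
Context {R : realType}.
Variables (W : R -> R -> R) (lo hi : R).
Hypotheses (lo_gt0 : 0 < lo) (hi_lt1 : hi < 1).
Hypothesis W_bounds : forall x y, I01 R x -> I01 R y -> lo <= W x y <= hi.

Lemma upper_tail (f eps delta : R) : block_regulated W -> phi_star W = f%:E ->
  0 < eps -> 0 < delta ->
  exists L0 : R, forall (n : nat) (d : measure_display) (T : measurableType d)
    (P : probability T R) (G : T -> simple_graph 'I_n),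
    sampled_from P W G -> L0 <= ln (n%:R : R) ->
    (P [set w | ((1 + eps) * f * (n%:R / (2 * ln n%:R)) < (chromatic_number (G w))%:R)%R]
       <= delta%:E)%E.
Proof.
move=> Wbr phif eps0 delta0.
(* [rounding_loss] costs [12 * eta <= eps / 2]; the other [eps / 2] covers the leftover vertices and
   the rounding of the numbers of colours. *)
pose eta := Num.min eps 1 / 24.
have [e0 e1 e2] : [/\ 0 < eta, eta <= 24^-1 & 24 * eta <= eps].
  by rewrite /eta minEle; case: ifP => /= h; split; lra.
clearbody eta.
have e01 : 0 < eta <= 1 by lra.
have e24 : 0 < eta <= 24^-1 by rewrite e0.
have f_lo : lo <= f.
  by have := phi_star_ge_lower lo_gt0 hi_lt1 W_bounds; rewrite phif lee_fin.
have f0 : 0 < f by apply: lt_le_trans f_lo.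
have [k [F [a [mF tF UF aC [a0C Wa]]]]] := block_partition lo_gt0 hi_lt1 W_bounds Wbr e01.
have ef0 : 0 < eta * f by rewrite mulr_gt0.
have [I [mu [alpha [[mu1 al0 al1 al] alphi]]]] :=
  phi_star_near_optimal lo_gt0 hi_lt1 W_bounds phif ef0.
pose p j := fine (lambda01 R (F j)).
have p_ge0 j : 0 <= p j by rewrite fine_ge0.
pose q i j := fine (mu i (F j)).
have q_ge0 i j : 0 <= q i j by rewrite fine_ge0.
have sum_q i : \sum_j q i j = 1.
  have mI : measurable (I01 R : set (measurableTypeR R)) by exact: measurable_itv.
  have := sum_mass (mu i) mF tF UF mI (fun x Ix => Ix).
  have -> : fine (mu i (I01 R)) = 1 by have := mu1 i; rewrite /prob01 => ->.
  move=> <-; apply: eq_bigr => j _; rewrite /q; congr (fine (mu i _)).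
  by apply/esym/setIidPl => x Fx; rewrite -UF; exists j.
have sum_alq j : \sum_i alpha i * q i j = p j by apply: al; exact: mF.
pose ph i := fine (phi (mu i) W).
have phE i : phi (mu i) W = (ph i)%:E.
  apply: (phi_fin lo_gt0 hi_lt1 W_bounds).
  by apply: le_trans (phi_lower lo_gt0 hi_lt1 W_bounds (mu1 i)); rewrite lee_fin ltW.
have ph_itv i : lo <= ph i <= - ln (1 - hi).
  rewrite -!lee_fin -phE (phi_lower lo_gt0 hi_lt1 W_bounds (mu1 i)).
  exact: (phi_upper lo_gt0 hi_lt1 W_bounds).
have C_ge0 : 0 <= - ln (1 - hi).
  apply: le_trans (logw_upper hi_lt1 W_bounds (@I01_0 R) (@I01_0 R)).
  exact: (logw_ge0 lo_gt0 hi_lt1 W_bounds (@I01_0 R) (@I01_0 R)).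
set C := - ln (1 - hi) in a0C ph_itv C_ge0; clearbody C.
have a_ge0 i j : 0 <= a i j by have /andP[] := a0C i j.
have d2 : 0 < delta / 2 by rewrite divr_gt0.
have [L1 HL1] := unbalanced_small e0 d2 p_ge0.
have eta4 : 0 < eta / 4 by rewrite divr_gt0.
have M2 : 0 <= 2 / lo by rewrite divr_ge0// ltW.
have [L2 _ HL2] := exp_dominates eta4 M2.
have D0 : 0 <= (#|I|%:R + 2 * k%:R * (2 / lo + 1)) * (2 / (eps / 2 * f)).
  apply: mulr_ge0; first by rewrite addr_ge0// !mulr_ge0// addr_ge0.
  by rewrite divr_ge0// mulr_ge0 ?divr_ge0// ltW.
have [L3 _ HL3] := exp_dominates eta4 D0.
have c35 : 0 < 3 / 5 :> R by rewrite divr_gt0.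
have e12 : 0 <= 12 * expR 1 :> R by rewrite mulr_ge0// expR_ge0.
have [L4 _ HL4] := exp_dominates c35 e12.
(* Where [q i j = 0] this is 0 by the convention on division, and the rounding of such an entry is
   exact. *)
pose t i j := (1 + eta) * C / (2 * eta * (1 - eta) * q i j).
have t_ge0 i j : 0 <= t i j by apply: divr_ge0; rewrite !mulr_ge0//; lra.
exists (Num.max 1 (Num.max L1 (Num.max L2 (Num.max L3 (Num.max L4
  (Num.max (80 * C / eta ^+ 2) (Num.max (\sum_i \sum_j t i j)
    ((1 + eps) * f / (delta / 2))))))))) => n d T P G [X [iid mG Gc]].
set L := ln (n%:R : R); rewrite !ge_max.
move=> /and5P[L_ge1 L1L L2L L3L /and4P[L4L CL tL deltaL]].
have L_gt0 : 0 < L by lra.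
have n0 : (0 < n)%N.
  by rewrite lt0n; apply/eqP => n0; move: L_gt0; rewrite /L n0 ln0// ltxx.
have nR : 0 < n%:R :> R by rewrite ltr0n.
have nE : n%:R = expR L by rewrite /L lnK// posrE.
have Ln : L <= n%:R by rewrite nE; apply: le_trans (expR_ge1Dx L); rewrite lerDr.
have t_le i j : t i j <= L.
  apply: le_trans tL; rewrite (bigD1 i)//= (bigD1 j)//= -addrA lerDl addr_ge0//.
    exact: sumr_ge0.
  by apply: sumr_ge0 => i' _; apply: sumr_ge0.
rewrite (_ : delta = delta / 2 + delta / 2); last by field.
have [graphonW _] := Wbr.
apply: (sampled_graph_prob_le graphonW iid mG Gc mF tF UF (ok := balanced p eta)
  (Q := fun g => (1 + eps) * f * (n%:R / (2 * L)) < (chromatic_number g)%:R)); last 1 first.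
- apply: le_trans (unbalanced_weight_le p_ge0 (sum_lambda01_blocks mF tF UF) e01) _.
  by apply: HL1; [exact: le_trans Ln|by []].
- exact: ltW.
move=> tau x bal Fx.
have x01 i : I01 R (x i) by rewrite -UF; exists (tau i).
apply: (few_colours_suffice (tau := tau) a0C aC q_ge0 sum_q al0 sum_alq lo_gt0 ph_itv
  alphi _ f0 eps0 e24 e2 L_ge1 nE bal t_le (HL2 _ L2L) _ (HL3 _ L3L)) => //.
- move=> i sg r sg0 rq.
  by apply: (quadratic_le_phi hi_lt1 W_bounds mF tF UF a_ge0 _ (phE i) sg0 rq) => i' j' y z Fy Fz;
    have /andP[] := Wa _ _ _ _ Fy Fz.
- by move: CL; rewrite ler_pdivrMr ?exprn_gt0// [L * _]mulrC.
- exact: (edge_prob01 lo_gt0 hi_lt1 W_bounds x01).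
- move=> e; rewrite (one_minus_edge_prob hi_lt1 W_bounds x01) ler_expR lerN2.
  by have /andP[] := Wa _ _ _ _ (Fx (val e).1) (Fx (val e).2).
- exact: HL4.
Qed.

End upper_tail.

(** * Convergence in probability from the two tails *)

Theorem theorem2p11 (R : realType) (W : R -> R -> R)
  (W_block_regulated : block_regulated W)
  (W_inf : 0 < inf [set W x y | x in I01 R & y in I01 R]
             <= sup [set W x y | x in I01 R & y in I01 R])
  (W_sup : sup [set W x y | x in I01 R & y in I01 R] < 1)
  (d : nat -> measure_display) (T : forall n, measurableType (d n))
  (P : forall n, probability (T n) R)
  (G : forall n, T n -> simple_graph 'I_n)
  (G_sampled : forall n, sampled_from (P n) W (G n)) :
  forall eps : R, 0 < eps ->
    P n [set w |
          ((1 - eps)%:E * phi_star W * (n%:R / (2 * ln n%:R))%:E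
             <= (chromatic_number (G n w))%:R%:E
             <= (1 + eps)%:E * phi_star W * (n%:R / (2 * ln n%:R))%:E)%E]
      @[n --> \oo] --> 1%:E.
Proof.
move=> eps eps0.
set lo := inf _ in W_inf; set hi := sup _ in W_inf W_sup.
have /andP[lo_gt0 _] := W_inf.
have [[_ _ W01] _] := W_block_regulated.
have W_bounds x y : I01 R x -> I01 R y -> lo <= W x y <= hi.
  move=> Ix Iy; apply/andP; split.
    apply: ge_inf; last by exists x => //; exists y.
    by exists 0 => _ [s Is [t It <-]]; have /andP[] := W01 s t Is It.
  apply: ub_le_sup; last by exists x => //; exists y.
  by exists 1 => _ [s Is [t It <-]]; have /andP[] := W01 s t Is It.
have [f _ phif] := phi_star_fin lo_gt0 W_sup W_bounds.
pose Q n (g : simple_graph 'I_n) : bool :=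
  (1 - eps) * f * (n%:R / (2 * ln n%:R)) <= (chromatic_number g)%:R
    <= (1 + eps) * f * (n%:R / (2 * ln n%:R)).
have mG n g : measurable (G n @^-1` [set g]) by have [X [_ mG _]] := G_sampled n.
have mQ n (Q' : pred (simple_graph 'I_n)) : measurable [set w | Q' (G n w)].
  exact: measurable_graph_event.
rewrite (_ : (fun n => P n _) = (fun n => P n [set w | Q n (G n w)])); last first.
  apply/funext => n; congr (P n _); apply/seteqP; split => w /=;
  by rewrite phif -!EFinM !lee_fin.
apply/fine_cvgP; split.
  by apply: nearW => n; apply: fin_num_measure; exact: mQ.
apply/cvgrPdist_le => delta delta0.
have d2 : 0 < delta / 2 by rewrite divr_gt0.
have [L1 H1] := lower_tail lo_gt0 W_sup W_bounds W_block_regulated phif eps0 d2.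
have [L2 H2] := upper_tail lo_gt0 W_sup W_bounds W_block_regulated phif eps0 d2.
have := @nbhs_infty_ger R (expR L1); have := @nbhs_infty_ger R (expR L2).
apply: filterS2 => n nL2 nL1.
have ln_ge (L : R) : expR L <= n%:R -> L <= ln n%:R.
  move=> h; rewrite -[leLHS]expRK ler_ln ?posrE ?expR_gt0//.
  by apply: lt_le_trans h; exact: expR_gt0.
have {H1} := H1 n _ _ _ _ (G_sampled n) (ln_ge _ nL1).
have {H2} := H2 n _ _ _ _ (G_sampled n) (ln_ge _ nL2).
set U := [set w | _]; set B := [set w | _] => PU PB.
have mU : measurable U by exact: (mQ n (fun g => (1 + eps) * f * (n%:R / (2 * ln n%:R)) < (chromatic_number g)%:R)).
have mB : measurable B by exact: (mQ n (fun g => (chromatic_number g)%:R < (1 - eps) * f * (n%:R / (2 * ln n%:R)))).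
have PC : (P n (~` [set w | Q n (G n w)]) <= delta%:E)%E.
  apply: (@le_trans _ _ (P n (B `|` U))).
    apply: le_measure; rewrite ?inE; [exact/measurableC/mQ|exact: measurableU|].
    move=> w /= /negP; rewrite negb_and -!ltNge => /orP[]; by [left|right].
  apply: (le_trans (measureU2 _ mB mU)).
  rewrite (_ : delta = delta / 2 + delta / 2); last by field.
  by rewrite EFinD leeD.
have fin : P n [set w | Q n (G n w)] \is a fin_num by apply: fin_num_measure; exact: mQ.
have le1 : (P n [set w | Q n (G n w)] <= 1)%E by apply: probability_le1; exact: mQ.
move: PC le1; rewrite probability_setC; last exact: mQ.
rewrite -(fineK fin) -EFinB !lee_fin => h1 h2.
by rewrite /= ger0_norm ?subr_ge0.
Qed.
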